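(* Fix integers $n\ge 1$ and $k\geq 3$. There are positive functions $\psi_1,\psi_2,\psi_3,d,M,N,\eta$ of $(K,\varepsilon)$, $K>0$, $\varepsilon>0$ (depending only on $K$ and $\varepsilon$, for the fixed $n,k$), such that the following holds. Let $f_0:\overline{\mathbf{B}}^n\to\mathbb{R}$ be a function which is of class $C^k$ on an open set containing $\overline{\mathbf{B}}^n$, with all derivatives up to order $k$ uniformly bounded by $K$. Then for any given $\varepsilon>0$ there exists a $C^k$ function $h:\overline{\mathbf{B}}^n\to\mathbb{R}$ with $\|h\|_{C^k}\le\varepsilon$ such that $f=f_0+h$ satisfies the following conditions: (i) At each critical point $x_i$ of $f$, the smallest absolute value of the eigenvalues of the Hessian $Hf(x_i)$ is at least $\psi_1(K,\varepsilon)$. (ii) For any two different critical points $x_i$ and $x_j$ of $f$, $\|x_i-x_j\|\geq d(K,\varepsilon)$. Consequently, the number of critical points of $f$ does not exceed $N(K,\varepsilon)$. (iii) For any two different critical points $x_i$ and $x_j$ of $f$, $|f(x_i)-f(x_j)|\geq\psi_2(K,\varepsilon)$. (iv) For $\delta=\psi_3(K,\varepsilon)$ and for each critical point $x_i$ of $f$, there exists a coordinate transformation $\varphi:\mathbf{B}^n_\delta(x_i)\to\mathbb{R}^n$ of class $C^{k-1}$ such that $$f\circ\varphi^{-1}(y_1,\ldots,y_n)=y_1^2+\cdots+y_l^2-y_{l+1}^2-\cdots-y_n^2+\mathrm{const}$$ for some $l\in\{0,\ldots,n\}$, and $\|\varphi\|_{C^{k-1}}\le M(K,\varepsilon)$.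 (v) If $x\in\overline{\mathbf{B}}^n$ and $\|\operatorname{grad} f(x)\|\le\eta(K,\varepsilon)$, then $x\in\mathbf{B}^n_\delta(x_i)$ for some critical point $x_i$ of $f$, where $\delta=\psi_3(K,\varepsilon)$.
   Context: $\|x\|=(|x_1|^2+\cdots+|x_n|^2)^{1/2}$ is the Euclidean norm on $\mathbb{R}^n$. $\mathbf{B}^n$ is the unit ball in $\mathbb{R}^n$ centered at $0$, $\overline{\mathbf{B}}^n$ is the closed unit ball, and $\mathbf{B}^n_r(x_0)$ is the ball of radius $r$ centered at $x_0$. For a $C^k$ mapping $g:M\to\mathbb{R}^m$, $M\subset\mathbb{R}^n$, the $C^k$-norm is $$\|g\|_{C^k}=\sum_{j=1}^k\sup_{x\in M}\|D^jg(x)\|$$ (the sum starts at $j=1$), and $\|g\|_{C^{k-1}}$ is defined in the same way with $k-1$ in place of $k$. Critical points of $f$ are the points $x\in\overline{\mathbf{B}}^n$ with $Df(x)=0$; $Hf(x)$ denotes the Hessian matrix of $f$ at $x$. A coordinate transformation of class $C^{k-1}$ is a $C^{k-1}$ diffeomorphism onto its image. *)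

(* Defs.v *)
From mathcomp Require Import all_boot all_order all_algebra.
From mathcomp Require Import all_classical all_reals all_analysis.

Set Implicit Arguments.
Unset Strict Implicit.
Unset Printing Implicit Defensive.

Import Order.TTheory GRing.Theory Num.Theory.
Import numFieldNormedType.Exports.

Local Open Scope classical_set_scope.
Local Open Scope ring_scope.

(* The library norm on row vectors is the sup norm, hence a separate Euclidean
   norm; both induce the same topology, so [open], [differentiable], etc. are
   the library notions. *)
Definition enorm (R : realType) (n : nat) (x : 'rV[R]_n) : R :=
  Num.sqrt (\sum_(i < n) x 0 i ^+ 2).

Definition eball (R : realType) (n : nat) (x : 'rV[R]_n) (r : R) :
    set 'rV[R]_n := [set y | enorm (y - x) < r].

Definition closed_unit_eball (R : realType) (n : nat) : set 'rV[R]_n :=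
  [set y | enorm y <= 1].

Arguments closed_unit_eball R n : clear implicits.

(* In finite dimension x |-> 'd f x is of class C^k if and only if
   x |-> 'd f x v = 'D_v f x is of class C^k for every vector v. *)
Fixpoint classC (R : realType) (n : nat) (W : normedModType R) (k : nat)
    (U : set 'rV[R]_n) (f : 'rV[R]_n -> W) : Prop :=
  match k with
  | 0 => forall x, U x -> {for x, continuous f}
  | k'.+1 => (forall x, U x -> differentiable f x) /\
             (forall v : 'rV[R]_n, classC k' U ('D_v f))
  end.

Definition classC_near (R : realType) (n : nat) (W : normedModType R) (k : nat)
    (A : set 'rV[R]_n) (f : 'rV[R]_n -> W) : Prop :=
  exists U : set 'rV[R]_n, [/\ open U, A `<=` U & classC k U f].

(* For f of class C^j around x and a j-tuple v this is the value
   D^j f(x)(v_1, ..., v_j) of the j-th derivative as a multilinear map. *)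
Definition iterD (R : realType) (n : nat) (W : normedModType R)
    (v : seq 'rV[R]_n) (f : 'rV[R]_n -> W) : 'rV[R]_n -> W :=
  foldr (fun u g => 'D_u g) f v.

(* Operator norm of D^j f(x) : (R^n)^j -> W, for the Euclidean norm on R^n and
   the norm nrm on W (nrm is not the norm of the structure W when W = R^m). *)
Definition Dnorm (R : realType) (n : nat) (W : normedModType R) (nrm : W -> R)
    (j : nat) (f : 'rV[R]_n -> W) (x : 'rV[R]_n) : \bar R :=
  ereal_sup [set (nrm (iterD v f x))%:E |
             v in [set v : j.-tuple 'rV[R]_n | forall i, enorm (tnth v i) <= 1]].

(* The sum starts at j = 1: the values of f itself are not bounded. *)
Definition Cnorm (R : realType) (n : nat) (W : normedModType R) (nrm : W -> R)
    (k : nat) (A : set 'rV[R]_n) (f : 'rV[R]_n -> W) : \bar R :=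
  (\sum_(1 <= j < k.+1) ereal_sup [set Dnorm nrm j f x | x in A])%E.

Definition grad (R : realType) (n : nat) (f : 'rV[R]_n -> R) (x : 'rV[R]_n) :
    'rV[R]_n := \row_(i < n) 'D_(delta_mx 0 i) f x.

Definition hessian (R : realType) (n : nat) (f : 'rV[R]_n -> R)
    (x : 'rV[R]_n) : 'M[R]_n :=
  \matrix_(i < n, j < n) 'D_(delta_mx 0 i) ('D_(delta_mx 0 j) f) x.

Definition critical (R : realType) (n : nat) (f : 'rV[R]_n -> R) :
    set 'rV[R]_n :=
  [set x | closed_unit_eball R n x /\ forall v, 'd f x v = 0].

(* phi is a C^m diffeomorphism of the open set U onto its image, and psi
   restricts to its inverse on phi @` U. *)
Definition coord_transf (R : realType) (n : nat) (m : nat) (U : set 'rV[R]_n)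
    (phi psi : 'rV[R]_n -> 'rV[R]_n) : Prop :=
  [/\ classC m U phi,
      open (phi @` U),
      classC m (phi @` U) psi &
      forall x, U x -> psi (phi x) = x].

(* Main.v *)
(* Adding a linear form [v] suffices for all but the critical values, by a quantitative Sard
   argument: on a fine grid of vectors, those for which [f0 + v] has a point with small gradient
   close to the unit sphere, or with an almost singular Hessian, are determined by fewer data
   than there are grid points. For the remaining [v] the critical points are separated, by
   Taylor's formula, and Newton's method finds one close to any point with small gradient.
   Adding [t g], where [g] is a polynomial with [g x_i = i] and zero gradient at the critical
   points [x_i], separates the critical values for a suitable small [t] and creates no new
   critical points.

   The usual proof of the Morse lemma loses two derivatives and would only give charts of class
   C^(k-2). Here the Taylor polynomial of order [k] is brought into normal form by a polynomial
   square root, and the remainder, which is o(|x - x_i|^k) together with its derivatives, is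
   absorbed by a displacement that is C^k off [x_i] and o(|x - x_i|^(k-1)) with its derivatives,
   hence C^(k-1). Estimates are carried out for families of functions, so that all constants
   are uniform. *)

Require Import Defs.
From HB Require Import structures.
From mathcomp Require Import all_boot all_order all_algebra perm.
From mathcomp Require Import all_classical all_reals all_analysis.
From mathcomp Require Import ring lra.

Set Implicit Arguments.
Unset Strict Implicit.
Unset Printing Implicit Defensive.

Import Order.TTheory GRing.Theory Num.Theory.
Import numFieldNormedType.Exports.

Local Open Scope classical_set_scope.
Local Open Scope card_scope.
Local Open Scope ring_scope.

(** * Norms and partial derivatives *)

(** The constants precede [f0], and compactness does not provide them: functions with bounded
    derivatives of order [k] share no modulus of continuity for these derivatives. The little-o in
    the Morse chart is therefore not uniform, and two claims are kept apart. On a ball of uniform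
    radius the displacement is only O(e |x - x0|^(k-1)), with [e] a fixed bound for the oscillation
    of the top derivatives; this yields the radius and the norm bound of the chart. For each single
    function the same estimate, applied on shrinking balls with [e] tending to 0, yields class
    C^(k-1) at the centre. Points of small gradient near the sphere have to be excluded because
    nothing is known of [f0] outside the ball: both Newton's iteration and the domain of a chart
    must stay inside. The linear step fixes the quality of the Hessian and a bound on the number of
    critical points; only then can the size of [t g] be chosen, small against both. Hence the order
    of the constants: first the linear perturbation, then the interpolation, then charts and
    gradient threshold for the halved quality. *)

Section Norms.
Context {R : realType} {n : nat}.
Implicit Types (x y z : 'rV[R]_n) (r : R).

Lemma ler_coord_norm x i : `|x 0 i| <= `|x|.
Proof.
by rewrite [leRHS]/Num.Def.normr /= mx_normrE; exact: (le_bigmax _ _ (0, i)).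
Qed.

Lemma rV_norm_le x r : 0 <= r -> (forall i, `|x 0 i| <= r) -> `|x| <= r.
Proof.
move=> r0 xr; rewrite /Num.Def.normr /= mx_normrE.
by apply: bigmax_le => // -[i j] _ /=; rewrite ord1.
Qed.

Lemma rV_norm_lt x r : 0 < r -> (forall i, `|x 0 i| < r) -> `|x| < r.
Proof.
move=> r0 xr; rewrite /Num.Def.normr /= mx_normrE.
by apply: bigmax_lt => // -[i j] _ /=; rewrite ord1.
Qed.

Lemma rV_norm_argmax x : (0 < n)%N -> exists i, `|x 0 i| = `|x|.
Proof.
move=> n0; have [x0|x0] := eqVneq `|x| 0.
  by exists (Ordinal n0); apply/eqP; rewrite eq_le ler_coord_norm x0 normr_ge0.
have [[i j] e] := mx_norm_neq0 x0; exists j.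
by rewrite [RHS]e /= ord1.
Qed.

Lemma sqr_enorm x : enorm x ^+ 2 = \sum_(i < n) x 0 i ^+ 2.
Proof. by rewrite sqr_sqrtr // sumr_ge0 // => i _; exact: sqr_ge0. Qed.

Lemma enorm_ge0 x : 0 <= enorm x. Proof. exact: sqrtr_ge0. Qed.

Lemma ler_coord_enorm x i : `|x 0 i| <= enorm x.
Proof.
rewrite -(@ler_pXn2r _ 2) ?nnegrE ?enorm_ge0 // sqr_enorm (bigD1 i) //=.
by rewrite real_normK ?num_real // lerDl sumr_ge0 // => j _; exact: sqr_ge0.
Qed.

Lemma ler_norm_enorm x : `|x| <= enorm x.
Proof. by apply: rV_norm_le (enorm_ge0 x) _ => i; exact: ler_coord_enorm. Qed.

Lemma enorm_le_sum x : enorm x <= \sum_i `|x 0 i|.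
Proof.
rewrite -(@ler_pXn2r _ 2) ?nnegrE ?enorm_ge0 ?sumr_ge0 // sqr_enorm.
rewrite expr2 mulr_suml; apply: ler_sum => i _.
rewrite -[x 0 i ^+ 2](real_normK (num_real _)) expr2 ler_wpM2l //.
by rewrite (bigD1 i) //= lerDl sumr_ge0.
Qed.

Lemma enorm_le_norm x : enorm x <= n%:R * `|x|.
Proof.
apply: le_trans (enorm_le_sum x) _.
have : \sum_(i < n) `|x 0 i| <= \sum_(i < n) `|x|.
  by apply: ler_sum => i _; exact: ler_coord_norm.
by rewrite sumr_const card_ord mulr_natl.
Qed.

Lemma enormN x : enorm (- x) = enorm x.
Proof. by congr Num.sqrt; apply: eq_bigr => i _; rewrite mxE sqrrN. Qed.

Lemma enormZ r x : enorm (r *: x) = `|r| * enorm x.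
Proof.
apply/eqP; rewrite -(@eqrXn2 _ 2) ?enorm_ge0 ?mulr_ge0 ?enorm_ge0 //.
rewrite exprMn !sqr_enorm real_normK ?num_real // mulr_sumr.
by apply/eqP/eq_bigr => i _; rewrite mxE exprMn.
Qed.

(** The Cauchy-Schwarz inequality, by Lagrange's identity: the gap is half the sum over all pairs of
    the squares of [x_i y_j - x_j y_i]. *)
Lemma enorm_dot x y : (\sum_i x 0 i * y 0 i) ^+ 2 <= enorm x ^+ 2 * enorm y ^+ 2.
Proof.
rewrite !sqr_enorm -subr_ge0.
have -> : (\sum_i x 0 i ^+ 2) * (\sum_i y 0 i ^+ 2) - (\sum_i x 0 i * y 0 i) ^+ 2
  = (\sum_i \sum_j (x 0 i * y 0 j - x 0 j * y 0 i) ^+ 2) / 2.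
  have e1 : (\sum_i x 0 i ^+ 2) * (\sum_i y 0 i ^+ 2) =
     \sum_i \sum_j x 0 i ^+ 2 * y 0 j ^+ 2.
    by rewrite mulr_suml; apply: eq_bigr => i _; rewrite mulr_sumr.
  have e2 : (\sum_i x 0 i * y 0 i) ^+ 2 =
     \sum_i \sum_j x 0 i * y 0 i * (x 0 j * y 0 j).
    by rewrite expr2 mulr_suml; apply: eq_bigr => i _; rewrite mulr_sumr.
  have e3 : \sum_i \sum_j x 0 i ^+ 2 * y 0 j ^+ 2 =
     \sum_i \sum_j x 0 j ^+ 2 * y 0 i ^+ 2 by rewrite exchange_big.
  rewrite e1 e2.
  suff -> : \sum_i \sum_j (x 0 i * y 0 j - x 0 j * y 0 i) ^+ 2 =
    \sum_i \sum_j x 0 i ^+ 2 * y 0 j ^+ 2 + \sum_i \sum_j x 0 i ^+ 2 * y 0 j ^+ 2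
     - 2 * \sum_i \sum_j x 0 i * y 0 i * (x 0 j * y 0 j) by field.
  rewrite [X in _ + X - _]e3 mulr_sumr -sumrN -!big_split /=.
  apply: eq_bigr => i _; rewrite mulr_sumr -sumrN -!big_split /=.
  by apply: eq_bigr => j _; ring.
by rewrite divr_ge0 // sumr_ge0 // => i _; rewrite sumr_ge0 // => j _; exact: sqr_ge0.
Qed.

Lemma enormD x y : enorm (x + y) <= enorm x + enorm y.
Proof.
rewrite -(@ler_pXn2r _ 2) ?nnegrE ?addr_ge0 ?enorm_ge0 //.
rewrite sqrrD !sqr_enorm.
have -> : \sum_i (x + y) 0 i ^+ 2 = \sum_i x 0 i ^+ 2 + (\sum_i x 0 i * y 0 i) *+ 2 +
  \sum_i y 0 i ^+ 2.
  by rewrite -sumrMnl -!big_split /=; apply: eq_bigr => i _; rewrite mxE sqrrD.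
rewrite lerD2r lerD2l lerMn2r /=; apply: le_trans (ler_norm _) _.
rewrite -(@ler_pXn2r _ 2) ?nnegrE ?mulr_ge0 ?enorm_ge0 //.
by rewrite real_normK ?num_real // exprMn enorm_dot.
Qed.

Lemma enorm_convex x y (t r : R) : 0 <= t <= 1 -> enorm x <= r -> enorm y <= r ->
  enorm (x + t *: (y - x)) <= r.
Proof.
move=> /andP[t0 t1] xr yr.
have -> : x + t *: (y - x) = (1 - t) *: x + t *: y.
  by rewrite scalerBr scalerBl scale1r addrCA addrA [LHS]addrC addrA addrC addrA.
apply: le_trans (enormD _ _) _; rewrite !enormZ !ger0_norm ?subr_ge0 //.
have := ler_wpM2l t0 yr; have : (1 - t) * enorm x <= (1 - t) * r.
  by rewrite ler_wpM2l // subr_ge0.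
by move=> *; nra.
Qed.

Lemma eball_center x r : 0 < r -> eball x r x.
Proof. by move=> r0; rewrite /eball /= subrr /enorm big1 ?sqrtr0 // => i _; rewrite mxE expr0n. Qed.

Lemma eball_convex z r x y (t : R) : 0 <= t <= 1 -> eball z r x -> eball z r y ->
  eball z r (x + t *: (y - x)).
Proof.
rewrite /eball /= => t01 xr yr.
have -> : x + t *: (y - x) - z = (x - z) + t *: ((y - z) - (x - z)).
  by rewrite opprB addrA subrK addrAC.
have mx : enorm (x - z) <= Num.max (enorm (x - z)) (enorm (y - z)).
  by rewrite le_max lexx.
have my : enorm (y - z) <= Num.max (enorm (x - z)) (enorm (y - z)).
  by rewrite le_max lexx orbT.
by apply: le_lt_trans (enorm_convex t01 mx my) _; rewrite gt_max xr yr.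
Qed.

Lemma ball_sub_eball z x r : eball z r x ->
  exists2 e, 0 < e & forall y, `|y - x| <= e -> eball z r y.
Proof.
(* Dividing by [n.+1] instead of [n] keeps the radius positive for [n = 0] and makes the last
   inequality strict. *)
rewrite /eball /= => zx; exists ((r - enorm (x - z)) / n.+1%:R).
  by rewrite divr_gt0 // subr_gt0.
move=> y yx; rewrite -[y](subrK x) -addrA.
apply: le_lt_trans (enormD _ _) _; rewrite -ltrBrDr.
apply: le_lt_trans (enorm_le_norm _) _.
apply: le_lt_trans (ler_wpM2l _ yx) _ => //.
rewrite mulrCA gtr_pMr ?subr_gt0 // ltr_pdivrMr // mul1r.
by rewrite ltr_nat.
Qed.

Lemma open_eball z r : open (eball z r).
Proof.
rewrite openE => x /ball_sub_eball[e e0 H]; apply/nbhs_ballP; exists e => //= y xy.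
apply: H; rewrite distrC ltW //.
by move: xy; rewrite -ball_normE.
Qed.

Lemma eball_norm z r x : eball z r x -> `|x - z| < r.
Proof. exact: le_lt_trans (ler_norm_enorm _). Qed.

Lemma norm_eball z r x : `|x - z| * n.+1%:R < r -> eball z r x.
Proof.
move=> H; rewrite /eball /=; apply: le_lt_trans (enorm_le_norm _) _.
apply: le_lt_trans H; rewrite mulrC ler_wpM2l // ler_nat; exact: leqnSn.
Qed.

End Norms.

Section Partial.
Context {R : realType} {n : nat}.
Implicit Types (f g : 'rV[R]_n -> R) (x y v : 'rV[R]_n) (i : 'I_n).

Definition pd i f : 'rV[R]_n -> R := 'D_(delta_mx 0 i) f.

Lemma derive_pd f x v : differentiable f x -> 'D_v f x = \sum_i v 0 i * pd i f x.
Proof.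
move=> df; rewrite deriveE // {1}(row_sum_delta v) linear_sum.
by apply: eq_bigr => i _; rewrite linearZ /= /pd deriveE.
Qed.

End Partial.

Section Partial2.
Context {R : realType} {n : nat}.
Implicit Types (f g : 'rV[R]_n -> R) (x y v : 'rV[R]_n) (i : 'I_n).

Lemma differentiable_eps (V W : normedModType R) (f : V -> W) (x : V) (e : R) :
  differentiable f x -> 0 < e ->
  \forall h \near 0, `|f (h + x) - f x - 'd f x h| <= e * `|h|.
Proof.
move=> /diff_locally/eqaddoP H e0; have := H _ e0.
by apply: filterS => h /=; rewrite opprD addrA.
Qed.

Lemma eps_differentiable (V W : normedModType R) (f : V -> W) (x : V)
  (L : {linear V -> W}) : continuous L ->
  (forall e : R, 0 < e -> \forall h \near 0, `|f (h + x) - f x - L h| <= e * `|h|) ->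
  is_diff x f L.
Proof.
move=> cL H.
have E : f \o shift x = cst (f x) + L +o_ 0 id.
  apply/eqaddoP => e /H; apply: filterS => h /=.
  by rewrite -[(_ - _) _]/(f (h + x) - (f x + L h)) opprD addrA.
have dE := diff_unique cL E.
by split=> //; apply/diff_locallyP; rewrite dE.
Qed.

Lemma near_eq_differentiable (V W : normedModType R) (f g : V -> W) (x : V) :
  (\near x, f x = g x) -> differentiable f x -> differentiable g x.
Proof.
move=> fg df.
have [//|] := @eps_differentiable V W g x ('d f x) (diff_continuous df) _.
move=> e e0; near=> h.
rewrite -(nbhs_singleton fg).
have <- : f (h + x) = g (h + x).
  near: h.
  by move: fg; rewrite (near_shift 0) /= subr0.
by near: h; exact: differentiable_eps.
Unshelve. all: by end_near. Qed.

Lemma pd_eq i f g (U : set 'rV[R]_n) x : open U -> (forall y, U y -> f y = g y) ->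
  U x -> pd i f x = pd i g x.
Proof.
move=> oU fg Ux; apply: near_eq_derive.
by apply: filterS (open_nbhs_nbhs (conj oU Ux)) => y; exact: fg.
Qed.

Lemma differentiable_eq f g (U : set 'rV[R]_n) x : open U ->
  (forall y, U y -> f y = g y) -> U x -> differentiable f x -> differentiable g x.
Proof.
move=> oU fg Ux; apply: near_eq_differentiable.
by apply: filterS (open_nbhs_nbhs (conj oU Ux)) => y; exact: fg.
Qed.

Lemma pdD i f g x : differentiable f x -> differentiable g x ->
  pd i (fun y => f y + g y) x = pd i f x + pd i g x.
Proof. by move=> df dg; rewrite /pd deriveD //; exact: diff_derivable. Qed.

Lemma pdN i f x : differentiable f x -> pd i (fun y => - f y) x = - pd i f x.
Proof. by move=> df; rewrite /pd deriveN //; exact: diff_derivable. Qed.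

Lemma pdM i f g x : differentiable f x -> differentiable g x ->
  pd i (fun y => f y * g y) x = pd i f x * g x + f x * pd i g x.
Proof.
move=> df dg; rewrite /pd deriveM //; try exact: diff_derivable.
by rewrite addrC /GRing.scale /= [g x * _]mulrC.
Qed.

Lemma pd_cst i (c : R) x : pd i (fun=> c) x = 0.
Proof. exact: derive_cst. Qed.

Lemma pdV i f x : f x != 0 -> differentiable f x ->
  pd i (fun y => (f y)^-1) x = - pd i f x * (f x)^-1 * (f x)^-1.
Proof.
move=> f0 df; rewrite /pd deriveV //; last exact: diff_derivable.
by rewrite /GRing.scale /= expr2 invfM; ring.
Qed.

Lemma pd_comp1 i f (s : R -> R) x : differentiable f x -> derivable s (f x) 1 ->
  pd i (fun y => s (f y)) x = (derive1 s) (f x) * pd i f x.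
Proof.
move=> df ds; have ds' := iffLR (derivable1_diffP _ _) ds.
have dc : differentiable (s \o f) x by exact: differentiable_comp.
rewrite /pd (deriveE _ dc) diff_comp //= (deriveE _ df) /=.
by rewrite (deriv1E ds) mulrC.
Qed.

Lemma differentiable_comp1 f (s : R -> R) x : differentiable f x -> derivable s (f x) 1 ->
  differentiable (fun y => s (f y)) x.
Proof. by move=> df /derivable1_diffP ds; exact: differentiable_comp. Qed.

Lemma differentiable_sumr (I : Type) (r : seq I) (P : pred I) (F : I -> 'rV[R]_n -> R) x :
  (forall j, P j -> differentiable (F j) x) ->
  differentiable (fun y => \sum_(i <- r | P i) F i y) x.
Proof.
move=> dF; elim: r => [|a r IH].
  rewrite (_ : (fun _ => _) = cst 0); first exact: differentiable_cst.
  by apply/funext => y; rewrite big_nil.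
rewrite (_ : (fun _ => _) = fun y => (if P a then F a y else 0) + \sum_(i <- r | P i) F i y).
  apply: differentiableD => //; have [Pa|Pa] := boolP (P a); first exact: dF.
  exact: differentiable_cst.
by apply/funext => y; rewrite big_cons; case: ifP => // _; rewrite add0r.
Qed.

Lemma pd_sum (I : Type) (r : seq I) (P : pred I) (F : I -> 'rV[R]_n -> R) i x :
  (forall j, P j -> differentiable (F j) x) ->
  pd i (fun y => \sum_(j <- r | P j) F j y) x = \sum_(j <- r | P j) pd i (F j) x.
Proof.
move=> dF; elim: r => [|a r IH].
  rewrite (_ : (fun _ => _) = fun=> 0) ?big_nil ?pd_cst //.
  by apply/funext => y; rewrite big_nil.
rewrite big_cons -IH.
rewrite (_ : (fun _ => _) = fun y => (if P a then F a y else 0) + \sum_(i <- r | P i) F i y).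
  rewrite pdD; last exact: differentiable_sumr.
    by case: ifP => // _; rewrite pd_cst add0r.
  have [Pa|Pa] := boolP (P a); first exact: dF.
  exact: differentiable_cst.
by apply/funext => y; rewrite big_cons; case: ifP => // _; rewrite add0r.
Qed.

Lemma differentiable_coordB (a : 'rV[R]_n) i x : differentiable (fun y => y 0 i - a 0 i) x.
Proof.
apply: differentiableB => //.
exact: differentiable_coord.
Qed.

Lemma pd_coordB (a : 'rV[R]_n) i j x : pd i (fun y => y 0 j - a 0 j) x = (i == j)%:R.
Proof.
rewrite /pd deriveB //; last first.
  exact/diff_derivable/differentiable_coord.
rewrite derive_cst subr0 deriveE; last exact: differentiable_coord.
have @l : {linear 'rV[R]_n -> R}.
  by exists (fun N : 'rV[R]_n => N 0 j); do 2![eexists]; do ?[constructor];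
     rewrite ?mxE// => ? *; rewrite ?mxE//; move=> ?; rewrite !mxE.
rewrite (_ : (fun y : 'rV[R]_n => y 0 j) = l) // diff_lin /=; last exact: coord_continuous.
by rewrite mxE eqxx eq_sym.
Qed.

Lemma mean_value_segment f x y : (forall t : R, 0 <= t <= 1 -> differentiable f (x + t *: (y - x))) ->
  exists2 t : R, 0 <= t <= 1 & f y - f x = \sum_i (y - x) 0 i * pd i f (x + t *: (y - x)).
Proof.
move=> df; set g := fun t : R => f (x + t *: (y - x)).
have dl t : is_diff t (fun t : R => x + t *: (y - x)) ( *:%R^~ (y - x)).
  by apply: is_diff_eq; rewrite add0r.
have dg (t : R) : 0 <= t <= 1 -> is_derive t 1 g ('D_(y - x) f (x + t *: (y - x))).
  move=> t01; have dft := df _ t01.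
  have dgt : differentiable g t by exact: differentiable_comp.
  split; first exact: diff_derivable.
  rewrite (deriveE _ dgt) (deriveE _ dft) /g (_ : (fun t => _) = f \o (fun t : R => x + t *: (y - x))) //.
  rewrite diff_comp //=.
  by rewrite (@diff_val _ _ _ _ _ _ _ (dl t)) /= scale1r.
have [t tI|| t t01 e] := @MVT_segment R g (fun t => 'D_(y - x) f (x + t *: (y - x))) 0 1 ler01.
- by apply: dg; move: tI; rewrite in_itv /= => /andP[/ltW -> /ltW ->].
- apply: derivable_within_continuous => t tI.
  by have [] := dg t _; first by move: tI; rewrite in_itv.
exists t; first by move: t01; rewrite in_itv.
rewrite -derive_pd; last by apply: df; move: t01; rewrite in_itv.
by move: e; rewrite subr0 mulr1 /g scale0r addr0 scale1r [x + (y - x)]addrC subrK.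
Qed.

Lemma sum_norm_le (a b : 'I_n -> R) (A B : R) : 0 <= A ->
  (forall i, `|a i| <= A) -> (forall i, `|b i| <= B) ->
  `|\sum_i a i * b i| <= n%:R * (A * B).
Proof.
move=> A0 aA bB; apply: le_trans (ler_norm_sum _ _ _) _.
have : \sum_(i < n) `|a i * b i| <= \sum_(i < n) A * B.
  by apply: ler_sum => i _; rewrite normrM; apply: ler_pM.
by rewrite sumr_const card_ord mulr_natl.
Qed.

(** [D] need not be open: it is also taken to be the closed unit ball, or a ball cut down to the
    points no farther from the centre than [x]. *)
Lemma lipschitz_pd f (D : set 'rV[R]_n) (C : R) x y :
  (forall t : R, 0 <= t <= 1 -> D (x + t *: (y - x))) ->
  (forall z, D z -> differentiable f z) ->
  (forall i z, D z -> `|pd i f z| <= C) ->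
  `|f y - f x| <= n%:R * C * `|y - x|.
Proof.
move=> Dt df fC; have [t t01 ->] := mean_value_segment (fun t h => df _ (Dt t h)).
rewrite -mulrA [C * _]mulrC; apply: sum_norm_le => // i; first exact: ler_coord_norm.
exact/fC/Dt.
Qed.

End Partial2.

Lemma open_ballP (R : realType) (V : normedModType R) (U : set V) (x : V) : open U -> U x ->
  exists2 e : R, 0 < e & forall y, `|y - x| < e -> U y.
Proof.
rewrite openE => oU /oU /nbhs_ballP[e /= e0 H]; exists e => // y yx.
by apply: H; rewrite -ball_normE /= distrC.
Qed.

Lemma continuous_eps (R : realType) (V W : normedModType R) (f : V -> W) (x : V) :
  {for x, continuous f} <-> forall e : R, 0 < e ->
    exists2 d : R, 0 < d & forall y, `|y - x| < d -> `|f y - f x| <= e.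
Proof.
split=> [cf e e0|H].
  have /cvgrPdist_le/(_ _ e0)/nbhs_ballP[d /= d0 Hd] : f y @[y --> x] --> f x := cf.
  exists d => // y yx; rewrite distrC; apply: Hd; by rewrite -ball_normE /= distrC.
apply/(@cvgrPdist_le _ W) => e /H[d d0 Hd].
apply/nbhs_ballP; exists d => //= y; rewrite -ball_normE /= => xy.
by rewrite distrC; apply: Hd; rewrite distrC.
Qed.

Lemma near0_norm (R : realType) (V : normedModType R) (P : V -> Prop) :
  (\forall h \near 0, P h) <-> exists2 d : R, 0 < d & forall h, `|h| < d -> P h.
Proof.
split=> [/nbhs_ballP[d /= d0 Hd]|[d d0 Hd]].
  by exists d => // h hd; apply: Hd; rewrite -ball_normE /= sub0r normrN.
by apply/nbhs_ballP; exists d => //= h; rewrite -ball_normE /= sub0r normrN; exact: Hd.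
Qed.

(** * Symmetry of second derivatives *)

Section Schwarz.
Context {R : realType} {n : nat}.
Implicit Types (f : 'rV[R]_n -> R) (x y v : 'rV[R]_n) (i : 'I_n).

Lemma pdB i f g x : differentiable f x -> differentiable g x ->
  pd i (fun y => f y - g y) x = pd i f x - pd i g x.
Proof. by move=> df dg; rewrite /pd deriveB //; exact: diff_derivable. Qed.

Lemma segment_delta x i (t : R) : (x + t *: delta_mx 0 i) - x = t *: delta_mx 0 i.
Proof. by rewrite addrAC subrr add0r. Qed.

Lemma mean_value_delta f x i (h : R) :
  (forall t : R, 0 <= t <= 1 -> differentiable f (x + (t * h) *: delta_mx 0 i)) ->
  exists2 t : R, 0 <= t <= 1 &
    f (x + h *: delta_mx 0 i) - f x = h * pd i f (x + (t * h) *: delta_mx 0 i).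
Proof.
move=> df; have [t h01|t t01] := @mean_value_segment R n f x (x + h *: delta_mx 0 i).
  by rewrite segment_delta scalerA; exact: df.
rewrite segment_delta scalerA => e; exists t => //; rewrite e (bigD1 i) //= big1 ?addr0.
  by rewrite !mxE !eqxx mulr1.
by move=> j ji; rewrite !mxE (negbTE ji) andbF mulr0 mul0r.
Qed.

Lemma pd_shift f i (a x : 'rV[R]_n) : pd i (fun y => f (y + a)) x = pd i f (x + a).
Proof.
rewrite /pd /derive (_ : (fun h : R => _) = fun h : R =>
  h^-1 *: ((f \o shift (x + a)) (h *: delta_mx 0 i) - f (x + a))) //.
by apply/funext => h /=; rewrite addrA.
Qed.

(** The mean value theorem is applied to the increment [f (y + h e_j) - f y] in direction [i], then
    to [pd i f] in direction [j]. *)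
Lemma mean_value_square f x i j (h : R) :
  (forall s t : R, 0 <= s <= 1 -> 0 <= t <= 1 ->
     differentiable f (x + (s * h) *: delta_mx 0 i + (t * h) *: delta_mx 0 j)) ->
  (forall s t : R, 0 <= s <= 1 -> 0 <= t <= 1 ->
     differentiable (pd i f) (x + (s * h) *: delta_mx 0 i + (t * h) *: delta_mx 0 j)) ->
  exists s t : R, [/\ 0 <= s <= 1, 0 <= t <= 1 &
    f (x + h *: delta_mx 0 i + h *: delta_mx 0 j) - f (x + h *: delta_mx 0 i)
    - f (x + h *: delta_mx 0 j) + f x =
    h * h * pd j (pd i f) (x + (s * h) *: delta_mx 0 i + (t * h) *: delta_mx 0 j)].
Proof.
move=> df dpf.
pose g y := f (y + h *: delta_mx 0 j) - f y.
have dsh y : is_diff y (fun y : 'rV[R]_n => y + h *: delta_mx 0 j) id.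
  by apply: is_diff_eq; rewrite addr0.
have l01 : 0 <= (1 : R) <= 1 by rewrite ler01 lexx.
have o01 : 0 <= (0 : R) <= 1 by rewrite ler01 lexx.
have dg1 (s : R) : 0 <= s <= 1 ->
    differentiable (fun y => f (y + h *: delta_mx 0 j)) (x + (s * h) *: delta_mx 0 i).
  move=> s01; apply: differentiable_comp; first exact: (@ex_diff _ _ _ _ _ _ _ (dsh _)).
  by have := df s 1 s01 l01; rewrite mul1r.
have dg0 (s : R) : 0 <= s <= 1 -> differentiable f (x + (s * h) *: delta_mx 0 i).
  by move=> s01; have := df s 0 s01 o01; rewrite mul0r scale0r addr0.
have dg (s : R) : 0 <= s <= 1 -> differentiable g (x + (s * h) *: delta_mx 0 i).
  by move=> s01; apply: differentiableB; [exact: dg1|exact: dg0].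
have [s s01 es] := mean_value_delta dg.
have pg : pd i g (x + (s * h) *: delta_mx 0 i) =
   pd i f (x + (s * h) *: delta_mx 0 i + h *: delta_mx 0 j) - pd i f (x + (s * h) *: delta_mx 0 i).
  rewrite -(pd_shift f) -pdB //; [exact: dg1|exact: dg0].
have dpg (t : R) : 0 <= t <= 1 ->
   differentiable (pd i f) (x + (s * h) *: delta_mx 0 i + (t * h) *: delta_mx 0 j).
  by move=> t01; exact: dpf.
have [t t01 et] := mean_value_delta dpg.
exists s, t; split => //.
rewrite -mulrA -et -pg -es /g; ring.
Qed.

(** The mixed second difference over a small square is symmetric in the two directions and equals
    [h ^ 2] times a nearby value of either mixed derivative; continuity at [x] does the rest. *)
Lemma schwarz f (U : set 'rV[R]_n) i j x : open U -> U x ->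
  (forall y, U y -> differentiable f y) ->
  (forall l y, U y -> differentiable (pd l f) y) ->
  (forall l m, {for x, continuous (pd l (pd m f))}) ->
  pd i (pd j f) x = pd j (pd i f) x.
Proof.
move=> oU Ux df dpf cf; apply/eqP; rewrite -subr_eq0 -normr_le0.
apply/ler_addgt0Pr => e e0; rewrite add0r.
have e20 : 0 < e / 2 by rewrite divr_gt0.
have [d1 d10 H1] := iffLR (continuous_eps _ _) (cf j i) _ e20.
have [d2 d20 H2] := iffLR (continuous_eps _ _) (cf i j) _ e20.
have [d3 d30 H3] := open_ballP oU Ux.
have [d d0 Hd] : exists2 d : R, 0 < d & forall y, `|y - x| < d -> [/\ U y,
   `|pd j (pd i f) y - pd j (pd i f) x| <= e / 2 &
   `|pd i (pd j f) y - pd i (pd j f) x| <= e / 2].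
  exists (Num.min d3 (Num.min d1 d2)); first by rewrite !lt_min d10 d20 d30.
  by move=> y; rewrite !lt_min => /and3P[? ? ?]; split; [exact: H3|exact: H1|exact: H2].
(* Both displacements may fall on the same coordinate when [i = j]; with this [h] they still add up
   to at most [d / 2]. *)
pose h := d / 4.
have h0 : 0 < h by rewrite divr_gt0.
have bd (s t : R) k l : 0 <= s <= 1 -> 0 <= t <= 1 ->
   `|x + (s * h) *: delta_mx 0 k + (t * h) *: delta_mx 0 l - x| < d.
  move=> s01 t01; apply: rV_norm_lt => // m.
  rewrite !mxE.
  have B (c : bool) (u : R) : 0 <= u <= 1 -> 0 <= u * h * c%:R <= h.
    move=> /andP[u0 u1]; case: c; rewrite ?mulr1 ?mulr0 ?lexx /=; last exact: ltW.
    by rewrite mulr_ge0 ?(ltW h0) //= ler_piMl // ltW.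
  have := B ((0 == 0 :> 'I_1) && (m == k)) s s01.
  have := B ((0 == 0 :> 'I_1) && (m == l)) t t01.
  set A1 := _ * _ * _; set A2 := _ * _ * _; move: A1 A2 => A1 A2 /andP[? ?] /andP[? ?].
  have hd : d = 4 * h by rewrite /h; field.
  by rewrite ltr_norml; apply/andP; split; lra.
have [||s [t [s01 t01 e1]]] := @mean_value_square f x i j h.
- by move=> s t s01 t01; have [/df] := Hd _ (bd s t i j s01 t01).
- by move=> s t s01 t01; have [/dpf] := Hd _ (bd s t i j s01 t01).
have [||s' [t' [s01' t01' e2]]] := @mean_value_square f x j i h.
- by move=> ? ? s01' t01'; have [/df] := Hd _ (bd _ _ j i s01' t01').
- by move=> ? ? s01' t01'; have [/dpf] := Hd _ (bd _ _ j i s01' t01').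
have [_ {}H1 _] := Hd _ (bd s t i j s01 t01).
have [_ _ {}H2] := Hd _ (bd s' t' j i s01' t01').
move: e2; rewrite [x + _ + _]addrAC.
have -> : f (x + h *: delta_mx 0 i + h *: delta_mx 0 j) - f (x + h *: delta_mx 0 j) -
    f (x + h *: delta_mx 0 i) + f x = f (x + h *: delta_mx 0 i + h *: delta_mx 0 j) - f (x + h *: delta_mx 0 i) -
    f (x + h *: delta_mx 0 j) + f x by ring.
rewrite e1 => E.
have hh0 : h * h != 0 := mulf_neq0 (lt0r_neq0 h0) (lt0r_neq0 h0).
move: H1 H2 E; set z1 := pd j (pd i f) (_ + _); set z2 := pd i (pd j f) (_ + _).
move=> H1 H2 /(mulfI hh0) E; move: H1 H2; rewrite -E.
move=> H1 H2; rewrite -(subrKA z1) (splitr e).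
apply: le_trans (ler_normD _ _) (lerD _ H1).
by rewrite distrC.
Qed.

End Schwarz.

(** * Families of functions with uniformly bounded derivatives *)

Lemma continuous_eq (R : realType) (V W : normedModType R) (f g : V -> W) (U : set V) x :
  open U -> (forall y, U y -> f y = g y) -> U x ->
  {for x, continuous f} -> {for x, continuous g}.
Proof.
move=> oU fg Ux /continuous_eps cf; apply/continuous_eps => e /cf[d d0 Hd].
have [d' d'0 Hd'] := open_ballP oU Ux.
exists (Num.min d d') => [|y]; first by rewrite lt_min d0 d'0.
by rewrite lt_min => /andP[yd yd']; rewrite -!fg //; [exact: Hd|exact: Hd'].
Qed.

Section UniformFamilies.
Context {R : realType} {n : nat} {T : Type}.
Implicit Types (U : T -> set 'rV[R]_n) (w rho f g : T -> 'rV[R]_n -> R).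

Definition fbound U w f := exists C : R, forall t x, U t x -> `|f t x| <= C * w t x.

(* [|D^s f| <= C * w / rho ^+ size s] for all multi-indices [s] of length at most [j], with [C]
   independent of the index [t] of the family. *)
Fixpoint Fl (j : nat) U rho w f : Prop :=
  fbound U w f /\
  match j with
  | 0 => forall t x, U t x -> {for x, continuous (f t)}
  | j'.+1 => (forall t x, U t x -> differentiable (f t) x) /\
      forall i, Fl j' U rho (fun t x => w t x / rho t x) (fun t => pd i (f t))
  end.

Lemma fbound_ge0 U w f : fbound U w f -> (forall t x, U t x -> 0 <= w t x) ->
  exists2 C : R, 0 <= C & forall t x, U t x -> `|f t x| <= C * w t x.
Proof.
move=> [C HC] w0; exists `|C| => // t x Ux; apply: le_trans (HC t x Ux) _.
by rewrite ler_wpM2r ?w0 ?ler_norm.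
Qed.

Lemma Fl_bound j U rho w f : Fl j U rho w f -> fbound U w f.
Proof. by case: j => [|j] []. Qed.

Lemma Fl_diff j U rho w f : Fl j.+1 U rho w f -> forall t x, U t x -> differentiable (f t) x.
Proof. by case=> _ []. Qed.

Lemma Fl_pd i j U rho w f : Fl j.+1 U rho w f ->
  Fl j U rho (fun t x => w t x / rho t x) (fun t => pd i (f t)).
Proof. by case=> _ [_]; exact. Qed.

Lemma Fl_cont j U rho w f : Fl j U rho w f -> forall t x, U t x -> {for x, continuous (f t)}.
Proof.
case: j => [|j]; first by case.
by move=> /Fl_diff df t x Ux; exact: differentiable_continuous (df t x Ux).
Qed.

Lemma FlW j U rho w f : Fl j.+1 U rho w f -> Fl j U rho w f.
Proof.
elim: j w f => [|j IH] w f; first by move=> H; split; [exact: Fl_bound H|exact: Fl_cont H].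
move=> H; split; first exact: Fl_bound H.
split; first exact: Fl_diff H.
by move=> i; apply: IH; exact: Fl_pd.
Qed.

Lemma Fl_leq j j' U rho w f : (j <= j')%N -> Fl j' U rho w f -> Fl j U rho w f.
Proof.
move=> jj'; rewrite -(subnK jj'); elim: (j' - j)%N => // d IH H.
by apply: IH; exact: FlW.
Qed.

Variable U : T -> set 'rV[R]_n.
Hypothesis oU : forall t, open (U t).

Lemma Fl_eq j rho w f w' g : (forall t x, U t x -> f t x = g t x) ->
  (forall t x, U t x -> w t x = w' t x) -> Fl j U rho w f -> Fl j U rho w' g.
Proof.
elim: j w f w' g => [|j IH] w f w' g fg ww' H.
  have [C HC] := Fl_bound H; split.
    by exists C => t x Ux; rewrite -fg // -ww' //; exact: HC.
  move=> t x Ux.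
  refine (@continuous_eq R _ R (f t) (g t) (U t) x (@oU t) (fg t) Ux _).
  exact: Fl_cont H _ _ Ux.
have [C HC] := Fl_bound H; split.
  by exists C => t x Ux; rewrite -fg // -ww' //; exact: HC.
split=> [t x Ux|i].
  by apply: (differentiable_eq (@oU t) (fg t) Ux); exact: Fl_diff H _ _ Ux.
apply: IH (Fl_pd i H) => t x Ux; first exact: (pd_eq i (@oU t) (fg t) Ux).
by rewrite ww'.
Qed.

Lemma Fl_eqf j rho w f g : (forall t x, U t x -> f t x = g t x) ->
  Fl j U rho w f -> Fl j U rho w g.
Proof. by move=> fg; apply: Fl_eq. Qed.

Lemma Fl_mono j rho w f w' : (forall t x, U t x -> 0 < rho t x) ->
  (forall t x, U t x -> 0 <= w t x) ->
  (exists K : R, forall t x, U t x -> w t x <= K * w' t x) ->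
  Fl j U rho w f -> Fl j U rho w' f.
Proof.
move=> rho0; elim: j w f w' => [|j IH] w f w' w0 [K HK] H;
  have [C C0 HC] := fbound_ge0 (Fl_bound H) w0;
  (split; [exists (C * K) => t x Ux; rewrite -mulrA;
    apply: le_trans (HC t x Ux) (ler_wpM2l C0 (HK t x Ux))|]).
  exact: Fl_cont H.
split; first exact: Fl_diff H.
move=> i; apply: IH (Fl_pd i H) => [t x Ux|]; first by rewrite divr_ge0 ?w0 ?(ltW (rho0 _ _ Ux)).
by exists K => t x Ux; rewrite mulrA ler_pM2r ?invr_gt0 ?rho0 //; exact: HK.
Qed.

Lemma FlD j rho w f g : Fl j U rho w f -> Fl j U rho w g ->
  Fl j U rho w (fun t x => f t x + g t x).
Proof.
elim: j w f g => [|j IH] w f g Hf Hg;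
  have [C HC] := Fl_bound Hf; have [D HD] := Fl_bound Hg;
  (split; [exists (C + D) => t x Ux; rewrite mulrDl;
    exact: le_trans (ler_normD _ _) (lerD (HC t x Ux) (HD t x Ux))|]).
  by move=> t x Ux; apply: continuousD; [exact: Fl_cont Hf _ _ Ux|exact: Fl_cont Hg _ _ Ux].
split=> [t x Ux|i].
  by apply: differentiableD; [exact: Fl_diff Hf _ _ Ux|exact: Fl_diff Hg _ _ Ux].
apply: Fl_eqf (IH _ _ _ (Fl_pd i Hf) (Fl_pd i Hg)) => t x Ux.
by rewrite pdD //; [exact: Fl_diff Hf _ _ Ux|exact: Fl_diff Hg _ _ Ux].
Qed.

Lemma FlN j rho w f : Fl j U rho w f -> Fl j U rho w (fun t x => - f t x).
Proof.
elim: j w f => [|j IH] w f Hf; have [C HC] := Fl_bound Hf;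
  (split; [by exists C => t x Ux; rewrite normrN; exact: HC|]).
  by move=> t x Ux; apply: continuousN; exact: Fl_cont Hf _ _ Ux.
split=> [t x Ux|i]; first by apply: differentiableN; exact: Fl_diff Hf _ _ Ux.
apply: Fl_eqf (IH _ _ (Fl_pd i Hf)) => t x Ux.
by rewrite pdN //; exact: Fl_diff Hf _ _ Ux.
Qed.

Lemma FlB j rho w f g : Fl j U rho w f -> Fl j U rho w g ->
  Fl j U rho w (fun t x => f t x - g t x).
Proof. by move=> Hf Hg; apply: FlD => //; exact: FlN. Qed.

Lemma Fl0 j rho w : Fl j U rho w (fun _ _ => 0).
Proof.
elim: j w => [|j IH] w; (split; [by exists 0 => t x _; rewrite normr0 mul0r|]).
  by move=> t x _; exact: cst_continuous.
split=> [t x _|i]; first exact: differentiable_cst.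
by apply: Fl_eqf (IH _) => t x _; rewrite pd_cst.
Qed.

Lemma Fl_cst j rho w (c : T -> R) : fbound U w (fun t _ => c t) ->
  Fl j U rho w (fun t _ => c t).
Proof.
case: j => [|j] H; split=> //; first by move=> t x _; exact: cst_continuous.
split=> [t x _|i]; first exact: differentiable_cst.
by apply: Fl_eqf (Fl0 _ _ _) => t x _; rewrite pd_cst.
Qed.

(** Leibniz' rule respects the weights because a derivative costs one factor [rho] whichever of the
    two functions it falls on. *)
Lemma FlM j rho w1 w2 f g : Fl j U rho w1 f -> Fl j U rho w2 g ->
  Fl j U rho (fun t x => w1 t x * w2 t x) (fun t x => f t x * g t x).
Proof.
elim: j w1 w2 f g => [|j IH] w1 w2 f g Hf Hg;
  have [C HC] := Fl_bound Hf; have [D HD] := Fl_bound Hg;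
  (split; [exists (C * D) => t x Ux; rewrite mulrACA normrM;
    exact: ler_pM (normr_ge0 _) (normr_ge0 _) (HC t x Ux) (HD t x Ux)|]).
  by move=> t x Ux; apply: continuousM; [exact: Fl_cont Hf _ _ Ux|exact: Fl_cont Hg _ _ Ux].
split=> [t x Ux|i].
  by apply: differentiableM; [exact: Fl_diff Hf _ _ Ux|exact: Fl_diff Hg _ _ Ux].
have H1 := IH _ _ _ _ (Fl_pd i Hf) (FlW Hg).
have H2 := IH _ _ _ _ (FlW Hf) (Fl_pd i Hg).
apply: (@Fl_eq j rho _ _ _ _ _ _ (FlD (w := fun t x => w1 t x * w2 t x / rho t x) _ _)).
- move=> t x Ux; rewrite pdM; first reflexivity.
    exact: Fl_diff Hf _ _ Ux.
  exact: Fl_diff Hg _ _ Ux.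
- by [].
- by apply: Fl_eq H1 => // t x Ux; rewrite mulrAC.
- by apply: Fl_eq H2 => // t x Ux; rewrite mulrA.
Qed.

Lemma FlZ j rho w (c : R) f : Fl j U rho w f -> Fl j U rho w (fun t x => c * f t x).
Proof.
move=> Hf; have Hc : Fl j U rho (fun _ _ => 1) (fun (_ : T) _ => c).
  by apply: Fl_cst; exists `|c| => t x _; rewrite mulr1.
by apply: Fl_eq (FlM Hc Hf) => // t x Ux; rewrite mul1r.
Qed.

Lemma FlM1 j rho w f g : Fl j U rho (fun _ _ => 1) f -> Fl j U rho w g ->
  Fl j U rho w (fun t x => f t x * g t x).
Proof. by move=> Hf Hg; apply: Fl_eq (FlM Hf Hg) => // t x Ux; rewrite mul1r. Qed.

Lemma Fl_sum j rho w (I : Type) (r : seq I) (P : pred I) (F : I -> T -> 'rV[R]_n -> R) :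
  (forall i, P i -> Fl j U rho w (F i)) ->
  Fl j U rho w (fun t x => \sum_(i <- r | P i) F i t x).
Proof.
move=> HF; elim: r => [|a r IH].
  by apply: Fl_eqf (Fl0 _ _ _) => t x _; rewrite big_nil.
have [Pa|Pa] := boolP (P a).
  by apply: Fl_eqf (FlD (HF a Pa) IH) => t x _; rewrite big_cons Pa.
by apply: Fl_eqf IH => t x _; rewrite big_cons (negbTE Pa).
Qed.

Lemma FlX j rho w f m : Fl j U rho w f ->
  Fl j U rho (fun t x => w t x ^+ m) (fun t x => f t x ^+ m).
Proof.
move=> Hf; elim: m => [|m IH].
  by apply: (@Fl_cst j rho _ (fun=> 1)); exists 1 => t x _; rewrite normr1 expr0 mulr1.
by apply: Fl_eq (FlM Hf IH) => t x _; rewrite exprS.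
Qed.

(** The derivative [- f' / f ^ 2] has weight [(w / rho) / w ^ 2], which is [w^-1 / rho], so the
    induction closes; the lower bound makes [w] the exact size of [f]. *)
Lemma FlV j rho w f : (forall t x, U t x -> 0 < w t x) ->
  (exists2 c : R, 0 < c & forall t x, U t x -> c * w t x <= `|f t x|) ->
  Fl j U rho w f -> Fl j U rho (fun t x => (w t x)^-1) (fun t x => (f t x)^-1).
Proof.
move=> w0 [c c0 Hc].
have f0 t x : U t x -> f t x != 0.
  by move=> Ux; rewrite -normr_gt0; apply: lt_le_trans (Hc t x Ux); rewrite mulr_gt0 ?w0.
have B : fbound U (fun t x => (w t x)^-1) (fun t x => (f t x)^-1).
  exists c^-1 => t x Ux; rewrite normfV -invfM lef_pV2 ?posrE ?normr_gt0 ?f0 //.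
    exact: Hc.
  by rewrite mulr_gt0 ?w0.
elim: j => [|j IH] Hf; split=> //.
  by move=> t x Ux; apply: continuousV; [exact: f0|exact: Fl_cont Hf _ _ Ux].
split=> [t x Ux|i].
  by apply: differentiableV; [exact: Fl_diff Hf _ _ Ux|exact: f0].
have HV := IH (FlW Hf).
apply: Fl_eq (FlM (FlM (FlN (Fl_pd i Hf)) HV) HV) => t x Ux.
  by rewrite pdV //; [exact: f0|exact: Fl_diff Hf _ _ Ux].
by have := w0 _ _ Ux; move: (rho t x)^-1 => r wp; field; rewrite gt_eqF.
Qed.

(** The inverse root is treated first because its derivative is a polynomial in itself and [f'],
    which closes the induction; the root is then recovered as [f] times the inverse root. *)
Lemma Fl_Vsqrt j rho f : (exists2 c : R, 0 < c & forall t x, U t x -> c <= f t x) ->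
  Fl j U rho (fun _ _ => 1) f -> Fl j U rho (fun _ _ => 1) (fun t x => (Num.sqrt (f t x))^-1).
Proof.
move=> [c c0 Hc].
have f0 t x : U t x -> 0 < f t x by move=> Ux; exact: lt_le_trans (Hc t x Ux).
have s0 t x : U t x -> 0 < Num.sqrt (f t x) by move=> Ux; rewrite sqrtr_gt0 f0.
have B : fbound U (fun _ _ => 1) (fun t x => (Num.sqrt (f t x))^-1).
  exists (Num.sqrt c)^-1 => t x Ux; rewrite mulr1 ger0_norm ?invr_ge0 ?sqrtr_ge0 //.
  by rewrite lef_pV2 ?posrE ?sqrtr_gt0 ?f0 // ler_wsqrtr // Hc.
elim: j => [|j IH] Hf; split=> //.
  move=> t x Ux; apply: continuousV; first exact: lt0r_neq0 (s0 _ _ Ux).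
  exact: (continuous_comp (Fl_cont Hf Ux) (@sqrt_continuous _ _)).
have ds t x : U t x -> is_derive (f t x) 1 (fun y : R => (Num.sqrt y)^-1)
   (- (2^-1 * ((Num.sqrt (f t x))^-1 * ((Num.sqrt (f t x))^-1 * (Num.sqrt (f t x))^-1)))).
  move=> Ux; have sn := lt0r_neq0 (s0 _ _ Ux).
  have [d1 d2] := is_derive1_sqrt (f0 _ _ Ux).
  split; first exact: derivableV.
  rewrite deriveV // d2 /GRing.scale /=.
  by field.
split=> [t x Ux|i].
  apply: (@differentiable_comp1 _ _ (f t) (fun y => (Num.sqrt y)^-1)).
    exact: Fl_diff Hf _ _ Ux.
  by have [] := ds t x Ux.
have HV := IH (FlW Hf).
have H2 := FlZ (- 2^-1) (FlM1 (FlM1 HV (FlM1 HV HV)) (Fl_pd i Hf)).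
apply: Fl_eq H2 => t x Ux.
  rewrite (@pd_comp1 _ _ _ (f t) (fun y => (Num.sqrt y)^-1)); [|exact: Fl_diff Hf _ _ Ux|by have [] := ds t x Ux].
  by rewrite derive1E (@derive_val _ _ _ _ _ _ _ (ds t x Ux)); ring.
by rewrite mul1r.
Qed.

End UniformFamilies.

Lemma Fl_reindex (R : realType) (n : nat) (T T' : Type) (s : T' -> T) j
    (U : T -> set 'rV[R]_n) (U' : T' -> set 'rV[R]_n) rho w f :
  (forall t, U' t `<=` U (s t)) -> Fl j U rho w f ->
  Fl j U' (fun t => rho (s t)) (fun t => w (s t)) (fun t => f (s t)).
Proof.
move=> sU; elim: j w f => [|j IH] w f H;
  have [C HC] := Fl_bound H;
  (split; [by exists C => t x /sU Ux; exact: HC|]).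
  by move=> t x /sU Ux; exact: Fl_cont H _ _ Ux.
split=> [t x /sU Ux|i]; first exact: Fl_diff H _ _ Ux.
exact: IH _ _ (Fl_pd i H).
Qed.

(** * Functions of class C^j and iterated partial derivatives *)

Section ClassC.
Context {R : realType} {n : nat}.
Implicit Types (U : set 'rV[R]_n) (x v : 'rV[R]_n).

Lemma classC_cont (W : normedModType R) j U (f : 'rV[R]_n -> W) : classC j U f ->
  forall x, U x -> {for x, continuous f}.
Proof.
case: j => [|j]; first exact.
by case=> df _ x Ux; exact: differentiable_continuous (df x Ux).
Qed.

Lemma classCW (W : normedModType R) j U (f : 'rV[R]_n -> W) : classC j.+1 U f -> classC j U f.
Proof.
elim: j f => [|j IH] f; first exact: classC_cont.
by move=> [df H]; split=> // v; exact: IH.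
Qed.

Lemma classC_leq (W : normedModType R) i j U (f : 'rV[R]_n -> W) : (i <= j)%N ->
  classC j U f -> classC i U f.
Proof.
move=> ij; rewrite -(subnK ij); elim: (j - i)%N => // d IH H.
by apply: IH; exact: classCW.
Qed.

Lemma classC_sub (W : normedModType R) j U U' (f : 'rV[R]_n -> W) : U' `<=` U ->
  classC j U f -> classC j U' f.
Proof.
move=> sU; elim: j f => [|j IH] f; first by move=> H x /sU; exact: H.
by move=> [df H]; split=> [x /sU|v]; [exact: df|apply: IH; exact: H].
Qed.

Lemma classC_eq (W : normedModType R) j U (f g : 'rV[R]_n -> W) : open U ->
  (forall x, U x -> f x = g x) -> classC j U f -> classC j U g.
Proof.
move=> oU; elim: j f g => [|j IH] f g fg.
  by move=> H x Ux; exact: (continuous_eq oU fg Ux (H x Ux)).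
move=> [df H]; split=> [x Ux|v].
  apply: near_eq_differentiable (df x Ux).
  by apply: filterS (open_nbhs_nbhs (conj oU Ux)) => y; exact: fg.
apply: IH (H v) => x Ux; apply: near_eq_derive.
by apply: filterS (open_nbhs_nbhs (conj oU Ux)) => y; exact: fg.
Qed.

(** With real coefficients it reduces all directional derivatives to partial ones; with row vectors
    it assembles a map from its coordinates. *)
Lemma classC_lincomb (W : normedModType R) j U m (f : 'I_m -> 'rV[R]_n -> R) (a : 'I_m -> W) :
  open U -> (forall i, classC j U (f i)) -> classC j U (fun x => \sum_i f i x *: a i).
Proof.
move=> oU; elim: j f => [|j IH] f H.
  move=> x Ux; rewrite (_ : (fun x => _) = \sum_i (fun x => f i x *: a i)); last first.
    by apply/funext => y; rewrite fct_sumE.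
  apply: (big_ind (fun g : 'rV[R]_n -> W => {for x, continuous g})).
  - exact: cst_continuous.
  - by move=> g1 g2; exact: continuousD.
  - by move=> i _; apply: continuousZr_tmp; exact: H.
have dZ i x : U x -> differentiable (fun x => f i x *: a i) x.
  by move=> Ux; apply: differentiableZl; exact: (H i).1.
have sE : (fun x => \sum_i f i x *: a i) = \sum_i (fun x => f i x *: a i).
  by apply/funext => y; rewrite fct_sumE.
split=> [x Ux|v].
  by rewrite sE; apply: differentiable_sum => i; exact: dZ.
apply: classC_eq oU _ (IH (fun i => 'D_v (f i)) (fun i => (H i).2 v)) => x Ux.
rewrite sE derive_sum; last by move=> i; apply: diff_derivable; exact: dZ.
apply: eq_bigr => i _; rewrite (deriveE _ (dZ i x Ux)) (deriveE _ ((H i).1 x Ux)).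
by rewrite diffZl //; exact: (H i).1.
Qed.

Lemma classC_pd j U (f : 'rV[R]_n -> R) : open U -> (forall x, U x -> differentiable f x) ->
  (forall i, classC j U (pd i f)) -> classC j.+1 U f.
Proof.
move=> oU df H; split=> // v.
apply: classC_eq oU _ (classC_lincomb (fun i => v 0 i : R) oU H) => x Ux.
by rewrite derive_pd; [apply: eq_bigr => i _; rewrite mulrC|exact: df].
Qed.

Lemma pd_classC i j U (f : 'rV[R]_n -> R) : classC j.+1 U f -> classC j U (pd i f).
Proof. by case=> _; exact. Qed.

Lemma Fl_classC (T : Type) (U : T -> set 'rV[R]_n) rho w f j : (forall t, open (U t)) ->
  Fl j U rho w f -> forall t, classC j (U t) (f t).
Proof.
move=> oU; elim: j w f => [|j IH] w f Hf t; first by move=> x; exact: Fl_cont Hf _ _.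
apply: classC_pd => //; first exact: Fl_diff Hf _.
by move=> i; exact: (IH _ _ (Fl_pd i Hf) t).
Qed.

(** The last index of [s] acts first on [f]; hence the inductions from the right, by [rcons],
    whenever [f] is replaced by a derivative. *)
Definition iterpd (s : seq 'I_n) (f : 'rV[R]_n -> R) : 'rV[R]_n -> R := foldr pd f s.

Lemma iterpd_rcons s i f : iterpd (rcons s i) f = iterpd s (pd i f).
Proof. exact: foldr_rcons. Qed.

Lemma classC_Fl (T : Type) (U : T -> set 'rV[R]_n) (f : T -> 'rV[R]_n -> R) j :
  (forall t, classC j (U t) (f t)) ->
  (forall s : seq 'I_n, (size s <= j)%N ->
     fbound U (fun _ _ => 1) (fun t => iterpd s (f t))) ->
  Fl j U (fun _ _ => 1) (fun _ _ => 1) f.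
Proof.
elim: j f => [|j IH] f cf Hf; (split; [exact: (Hf [::])|]).
  by move=> t; exact: cf.
split=> [t|i]; first by have [] := cf t.
have -> : (fun (t : T) (x : 'rV[R]_n) => 1 / 1 : R) = fun _ _ => 1.
  by apply/funext => t; apply/funext => x; rewrite divr1.
apply: IH => [t|s sj]; first exact: pd_classC (cf t).
have [|C HC] := Hf (rcons s i); first by rewrite size_rcons.
by exists C => t x Ux; have := HC t x Ux; rewrite iterpd_rcons.
Qed.

End ClassC.

(** * Vector-valued maps and composition *)

Section VectorValued.
Context {R : realType} {n m : nat}.

Lemma rV_sum_delta (x : 'rV[R]_m) : x = \sum_j x 0 j *: delta_mx 0 j.
Proof. exact: row_sum_delta. Qed.

Lemma differentiable_rV (V : normedModType R) (g : V -> 'rV[R]_m) x :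
  (forall j, differentiable (fun y => g y 0 j) x) -> differentiable g x.
Proof.
move=> dg; rewrite (_ : g = \sum_j (fun y => g y 0 j *: delta_mx 0 j)); last first.
  by apply/funext => y; rewrite fct_sumE -rV_sum_delta.
by apply: differentiable_sum => j; apply: differentiableZl; exact: dg.
Qed.

Lemma derive_coord (V : normedModType R) (g : V -> 'rV[R]_m) x v j : differentiable g x ->
  'D_v (fun y => g y 0 j) x = ('D_v g x) 0 j.
Proof. by move=> dg; rewrite derive_mx ?mxE //; exact: diff_derivable. Qed.

Lemma differentiable_coordf (V : normedModType R) (g : V -> 'rV[R]_m) x j : differentiable g x ->
  differentiable (fun y => g y 0 j) x.
Proof.
move=> dg; apply: (@differentiable_comp _ _ _ _ g (fun z : 'rV[R]_m => z 0 j : R)) => //.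
exact: differentiable_coord.
Qed.

Lemma pd_comp (g : 'rV[R]_n -> 'rV[R]_m) (f : 'rV[R]_m -> R) i x :
  (forall j, differentiable (fun y => g y 0 j) x) -> differentiable f (g x) ->
  pd i (fun y => f (g y)) x = \sum_j pd j f (g x) * pd i (fun y => g y 0 j) x.
Proof.
move=> dgj df; have dg := differentiable_rV dgj.
have dfg : differentiable (f \o g) x by exact: differentiable_comp.
rewrite /pd (deriveE _ dfg) diff_comp //= -(deriveE _ dg) -(deriveE _ df).
rewrite derive_pd //; apply: eq_bigr => j _.
by rewrite derive_coord // mulrC.
Qed.

Lemma continuous_rV (V : normedModType R) (g : V -> 'rV[R]_m) x :
  (forall j, {for x, continuous (fun y => g y 0 j)}) -> {for x, continuous g}.
Proof.
move=> cg.
have cg' j : {for x, continuous (fun y => g y 0 j *: (delta_mx 0 j : 'rV[R]_m))}.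
  by apply: continuousZr_tmp; exact: cg.
rewrite (_ : g = \sum_j (fun y => g y 0 j *: delta_mx 0 j)); last first.
  by apply/funext => y; rewrite fct_sumE -rV_sum_delta.
apply: (big_ind (fun g : V -> 'rV[R]_m => {for x, continuous g})).
- exact: cst_continuous.
- by move=> g1 g2; exact: continuousD.
- by move=> j _; exact: cg'.
Qed.

Lemma Fl_comp (T : Type) j (U : T -> set 'rV[R]_n) (V : T -> set 'rV[R]_m)
    (f : T -> 'rV[R]_m -> R) (g : T -> 'rV[R]_n -> 'rV[R]_m) :
  (forall t, open (U t)) -> (forall t x, U t x -> V t (g t x)) ->
  Fl j V (fun _ _ => 1) (fun _ _ => 1) f ->
  (forall i, Fl j U (fun _ _ => 1) (fun _ _ => 1) (fun t x => g t x 0 i)) ->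
  Fl j U (fun _ _ => 1) (fun _ _ => 1) (fun t x => f t (g t x)).
Proof.
move=> oU UV; elim: j f => [|j IH] f Hf Hg; have [C HC] := Fl_bound Hf;
  (split; [by exists C => t x Ux; exact: HC t _ (UV _ _ Ux)|]).
  move=> t x Ux.
  have cf : {for g t x, continuous (f t)} by exact: Fl_cont Hf _ _ (UV _ _ Ux).
  have cg : {for x, continuous (g t)}.
    by apply: continuous_rV => i; exact: Fl_cont (Hg i) _ _ Ux.
  exact: continuous_comp cg cf.
have dg t x i : U t x -> differentiable (fun y => g t y 0 i) x.
  by move=> Ux; exact: Fl_diff (Hg i) _ _ Ux.
have df t x : U t x -> differentiable (f t) (g t x).
  by move=> Ux; exact: Fl_diff Hf _ _ (UV _ _ Ux).
split=> [t x Ux|i].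
  apply: (@differentiable_comp _ _ _ _ (g t) (f t)); last exact: df.
  by apply: differentiable_rV => l; exact: dg.
have e1 : (fun (t : T) (x : 'rV[R]_m) => 1 / 1 : R) = fun _ _ => 1.
  by apply/funext => t; apply/funext => x; rewrite divr1.
have e2 : (fun (t : T) (x : 'rV[R]_n) => 1 / 1 : R) = fun _ _ => 1.
  by apply/funext => t; apply/funext => x; rewrite divr1.
rewrite e2.
apply: (@Fl_eqf _ _ _ _ oU _ _ _
  (fun t x => \sum_l pd l (f t) (g t x) * pd i (fun y => g t y 0 l) x)).
  move=> t x Ux; rewrite pd_comp //; first by move=> l; exact: dg.
  exact: df.
apply: Fl_sum => // l _; apply: FlM1 => //.
  apply: (IH (fun t => pd l (f t))); first by have := Fl_pd l Hf; rewrite e1.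
  by move=> i'; exact: FlW (Hg i').
by have := Fl_pd i (Hg l); rewrite e2.
Qed.

End VectorValued.

(** * Determinants and inverse matrices *)

Section Determinants.
Context {R : realType} {n : nat} {T : Type}.
Variable U : T -> set 'rV[R]_n.
Hypothesis oU : forall t, open (U t).
Variable rho : T -> 'rV[R]_n -> R.
Let one : T -> 'rV[R]_n -> R := fun _ _ => 1.

Lemma Fl_prod j (I : Type) (r : seq I) (P : pred I) (F : I -> T -> 'rV[R]_n -> R) :
  (forall i, P i -> Fl j U rho one (F i)) ->
  Fl j U rho one (fun t x => \prod_(i <- r | P i) F i t x).
Proof.
move=> HF; elim: r => [|a r IH].
  apply: (@Fl_eqf _ _ _ _ oU _ _ _ (fun _ _ => 1)).
    by move=> t x _; rewrite big_nil.
  by apply: (@Fl_cst _ _ _ _ oU _ _ _ (fun=> 1)); exists 1 => t x _; rewrite normr1 mulr1.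
have [Pa|Pa] := boolP (P a).
  by apply: Fl_eqf (FlM1 oU (HF a Pa) IH) => // t x _; rewrite big_cons Pa.
by apply: Fl_eqf IH => // t x _; rewrite big_cons (negbTE Pa).
Qed.

Lemma Fl_det j m (A : T -> 'rV[R]_n -> 'M[R]_m) :
  (forall k l, Fl j U rho one (fun t x => A t x k l)) ->
  Fl j U rho one (fun t x => \det (A t x)).
Proof.
move=> HA; rewrite /determinant; apply: Fl_sum => // s _; apply: FlZ => //.
by apply: Fl_prod => i _; exact: HA.
Qed.

(** Cramer's formula: only the determinant has to be inverted, and it is bounded away from 0. *)
Lemma Fl_invmx j m (A : T -> 'rV[R]_n -> 'M[R]_m) :
  (exists2 c : R, 0 < c & forall t x, U t x -> c <= `|\det (A t x)|) ->
  (forall k l, Fl j U rho one (fun t x => A t x k l)) ->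
  forall k l, Fl j U rho one (fun t x => invmx (A t x) k l).
Proof.
move=> [c c0 Hc] HA k l.
apply: (@Fl_eqf _ _ _ _ oU _ _ _ (fun t x => (\det (A t x))^-1 * cofactor (A t x) l k)).
  move=> t x Ux; rewrite /invmx unitmxE unitfE -normr_gt0 (lt_le_trans c0) ?Hc //.
  by rewrite !mxE.
apply: FlM1 => //.
  apply: Fl_eq (FlV oU (w := one) _ _ (Fl_det HA)) => //.
  - by move=> t x _; rewrite /one invr1.
  - by exists c => // t x Ux; rewrite mulr1; exact: Hc.
apply: FlZ => //; apply: Fl_det => a b.
apply: Fl_eqf (HA (lift l a) (lift k b)) => // t x _.
by rewrite !mxE.
Qed.

End Determinants.

Lemma det_bound (R : realType) m (C : R) : 0 <= C -> exists2 D : R, 0 < D &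
  forall A : 'M[R]_m, (forall i j, `|A i j| <= C) -> `|\det A| <= D.
Proof.
move=> C0; exists (\sum_(s : 'S_m) C ^+ m + 1) => [|A HA].
  by rewrite ltr_wpDl // sumr_ge0 // => s _; rewrite exprn_ge0.
apply: le_trans (ler_norm_sum _ _ _) _; apply: ler_wpDr => //.
apply: ler_sum => s _; rewrite normrM normrX normrN1 expr1n mul1r normr_prod.
have -> : C ^+ m = \prod_(i < m) C by rewrite prodr_const card_ord.
by apply: ler_prod => i _; rewrite normr_ge0 HA.
Qed.

(** * Surjectivity of maps close to the identity *)

Section NearIdentity.
Context {R : realType} {n : nat}.
Implicit Types (x y z : 'rV[R]_n).

(* Solving z + u z = y0 is finding the fixed point of the contraction z |-> y0 - u z. *)
Lemma near_identity_onto (u : 'rV[R]_n -> 'rV[R]_n) x y (r : R) : 0 < r ->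
  (forall z z', `|z - x| <= r -> `|z' - x| <= r -> `|u z - u z'| <= 2^-1 * `|z - z'|) ->
  `|y - (x + u x)| <= r / 2 -> exists2 z, `|z - x| <= r & z + u z = y.
Proof.
move=> r0 Hu yx.
pose B := closed_ball x r.
have BE z : B z <-> `|z - x| <= r.
  by rewrite /B closed_ballE // /closed_ball_ /= distrC.
have Bx : B x by apply/BE; rewrite subrr normr0 ltW.
have fB : set_fun B B (fun z => y - u z).
  move=> z /= /BE zr; apply/BE.
  have -> : y - u z - x = (y - (x + u x)) + (u x - u z).
    by apply/rowP => i; rewrite !mxE; ring.
  rewrite (splitr r); apply: le_trans (ler_normD _ _) (lerD yx _).
  have xr : `|x - x| <= r by rewrite subrr normr0 ltW.
  apply: le_trans (Hu x z xr zr) _.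
  by rewrite mulrC ler_pM2r ?invr_gt0 // distrC.
pose X : completeNormedModType R := HB.pack 'rV[R]_n (NormedModule.on 'rV[R]_n) (Complete.on 'rV[R]_n).
pose F : {fun (B : set X) >-> (B : set X)} := mkfun fB.
have cF : is_contraction F.
  exists (2^-1)%:nng; split=> /=; first by rewrite invf_lt1 // ltr1n.
  move=> [a b] /= [/BE ha /BE hb].
  rewrite /mkfun (_ : y - u a - (y - u b) = u b - u a); first by rewrite distrC Hu.
  by apply/rowP => i; rewrite !mxE; ring.
have [z /BE zr e] := banach_fixed_point cF (@closed_ball_closed _ _ _ _) (ex_intro _ _ Bx).
by exists z => //; rewrite {1}e /= subrK.
Qed.

End NearIdentity.

(** * Inverses of maps close to the identity *)

Section InverseFunction.
Context {R : realType} {n : nat}.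
Implicit Types (x y z h k : 'rV[R]_n).

Lemma eps_pd (f : 'rV[R]_n -> R) x (L : 'I_n -> R) :
  (forall e : R, 0 < e -> exists2 d : R, 0 < d &
     forall h, `|h| < d -> `|f (h + x) - f x - \sum_i h 0 i * L i| <= e * `|h|) ->
  differentiable f x /\ forall i, pd i f x = L i.
Proof.
move=> H; pose l h : R := \sum_i h 0 i * L i.
have lin : linear l.
  move=> a u v; rewrite /l scaler_sumr -big_split /=; apply: eq_bigr => i _.
  by rewrite !mxE mulrDl -mulrA.
pose lM := GRing.isLinear.Build R 'rV[R]_n R _ l lin.
pose LL : {linear 'rV[R]_n -> R} := HB.pack l lM.
have cL : continuous LL.
  move=> y; apply: differentiable_continuous.
  apply: (@differentiable_sumr _ _ _ _ _ (fun i (h : 'rV[R]_n) => h 0 i * L i)) => i _.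
  by apply: differentiableM => //; exact: differentiable_coord.
have [|df dE] := @eps_differentiable R _ _ f x LL cL.
  by move=> e /H ?; apply/near0_norm.
split=> // i; rewrite /pd deriveE // dE /= /l (bigD1 i) //= big1 => [|j ji].
  by rewrite mxE !eqxx mul1r addr0.
by rewrite mxE (negbTE ji) andbF mul0r.
Qed.

Lemma mulmx_norm_le m (v : 'rV[R]_n) (M : 'M[R]_(n, m)) (C : R) : 0 <= C ->
  (forall i j, `|M i j| <= C) -> `|v *m M| <= n%:R * C * `|v|.
Proof.
move=> C0 HM; apply: rV_norm_le => [|j]; first by rewrite !mulr_ge0.
rewrite mxE -mulrA [C * _]mulrC; apply: sum_norm_le => // i.
exact: ler_coord_norm.
Qed.

(** The transpose of the usual Jacobian matrix: vectors are rows, and the differential is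
    [h *m jac phi x]. *)
Definition jac (phi : 'rV[R]_n -> 'rV[R]_n) x : 'M[R]_n :=
  \matrix_(i, j) pd i (fun y => phi y 0 j) x.

Lemma diff_jac (phi : 'rV[R]_n -> 'rV[R]_n) x (e : R) :
  (forall j, differentiable (fun y => phi y 0 j) x) -> 0 < e ->
  exists2 d : R, 0 < d & forall h, `|h| < d -> `|phi (h + x) - phi x - h *m jac phi x| <= e * `|h|.
Proof.
move=> dphi e0; have dp := differentiable_rV dphi.
have /near0_norm[d d0 Hd] := @differentiable_eps R _ _ phi x e dp e0.
exists d => // h /Hd; congr (`|_ - _| <= _).
rewrite -deriveE //; apply/rowP => j.
rewrite -derive_coord // derive_pd // mxE; apply: eq_bigr => i _.
by rewrite mxE.
Qed.

Variables (U : set 'rV[R]_n) (phi : 'rV[R]_n -> 'rV[R]_n) (m : nat).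
Hypothesis oU : open U.
Hypothesis bU : exists C : R, forall x, U x -> `|x| <= C.
Hypothesis phi_id : forall x y, U x -> U y ->
  `|(phi x - phi y) - (x - y)| <= 2^-1 * `|x - y|.
Hypothesis phiC : forall j,
  Fl m.+1 (fun _ : unit => U) (fun _ _ => 1) (fun _ _ => 1) (fun _ x => phi x 0 j).

Let dphi x j : U x -> differentiable (fun y => phi y 0 j) x.
Proof. by move=> Ux; exact: (Fl_diff (phiC j) (t := tt)). Qed.

Let expand x y : U x -> U y -> `|x - y| <= 2 * `|phi x - phi y|.
Proof.
move=> Ux Uy; have := phi_id Ux Uy.
have : `|x - y| <= `|phi x - phi y| + `|phi x - phi y - (x - y)|.
  have {1}-> : x - y = (phi x - phi y) - (phi x - phi y - (x - y)) by rewrite subKr.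
  exact: ler_normB.
lra.
Qed.

(** For small [h] the increment of [phi] differs from [h] by at most [|h| / 2] and from the
    differential by at most [|h| / 4]; a quarter of [|h|] remains. Small multiples of [h] suffice by
    homogeneity. *)
Let jac_lower x h : U x -> `|h| <= 4 * `|h *m jac phi x|.
Proof.
move=> Ux; have [->|h0] := eqVneq h 0; first by rewrite normr0 mulr_ge0.
have e0 : 0 < 4^-1 :> R by rewrite invr_gt0.
have [d d0 Hd] := diff_jac (fun j => dphi j Ux) e0.
have [d' d'0 Hd'] := open_ballP oU Ux.
have hp : 0 < `|h| by rewrite normr_gt0.
pose D := Num.min d d'.
have D0 : 0 < D by rewrite lt_min d0 d'0.
pose s := D / (2 * `|h|).
have s0 : 0 < s by rewrite divr_gt0 // mulr_gt0.
have sh : `|s *: h| < D.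
  rewrite normrZ gtr0_norm // /s invfM mulrA mulfVK ?gt_eqF //.
  by rewrite ltr_pdivrMr // mulr_natr mulr2n ltrDl.
have Ush : U (s *: h + x).
  by apply: Hd'; rewrite addrK; apply: lt_le_trans sh _; rewrite ge_min lexx orbT.
have sd : `|s *: h| < d by apply: lt_le_trans sh _; rewrite ge_min lexx.
have H1 := Hd _ sd; have H2 := phi_id Ush Ux.
rewrite addrK in H2.
have : `|s *: h| <= `|s *: h *m jac phi x| + (4^-1 + 2^-1) * `|s *: h|.
  have {1}-> : s *: h = s *: h *m jac phi x + (phi (s *: h + x) - phi x - s *: h *m jac phi x)
       - (phi (s *: h + x) - phi x - s *: h).
    by apply/rowP => i; rewrite !mxE; ring.
  apply: le_trans (ler_normB _ _) _.
  apply: le_trans (lerD (ler_normD _ _) (lexx _)) _.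
  by rewrite -addrA lerD2l mulrDl; exact: lerD.
rewrite -scalemxAl !(normrZ s) (gtr0_norm s0).
have -> : s * `|h *m jac phi x| + (4^-1 + 2^-1) * (s * `|h|) =
   s * (`|h *m jac phi x| + (4^-1 + 2^-1) * `|h|) by ring.
rewrite ler_pM2l //; lra.
Qed.

Let jac_unit x : U x -> jac phi x \in unitmx.
Proof.
move=> Ux; rewrite unitmxE unitfE; apply/negP => /det0P[v v0 e].
have := jac_lower v Ux; rewrite e normr0 mulr0 normr_le0 => /eqP vz.
by rewrite vz eqxx in v0.
Qed.

Let invjac_entry x i j : U x -> `|invmx (jac phi x) i j| <= 4.
Proof.
move=> Ux; have := jac_lower (delta_mx 0 i *m invmx (jac phi x)) Ux.
rewrite mulmxKV ?jac_unit // => H.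
have <- : (delta_mx (0 : 'I_1) i *m invmx (jac phi x)) 0 j = invmx (jac phi x) i j.
  by rewrite -rowE mxE.
apply: le_trans (ler_coord_norm _ _) (le_trans H _).
rewrite -[leRHS]mulr1 ler_pM2l //; apply: rV_norm_le => // k.
by rewrite mxE normr_nat; case: (_ && _).
Qed.

(** The inverse Jacobian has entries at most 4, hence a determinant bounded in terms of [n]; the two
    determinants have product 1. *)
Let det_lower : exists2 c : R, 0 < c & forall (t : unit) x, U x -> c <= `|\det (jac phi x)|.
Proof.
have [D p0 HD] := @det_bound R n 4 (ler0n _ _).
exists D^-1 => [|_ x Ux]; first by rewrite invr_gt0.
have H : `|\det (invmx (jac phi x))| <= D.
  by apply: HD => i j; exact: invjac_entry.
have E : `|\det (jac phi x)| * `|\det (invmx (jac phi x))| = 1.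
  by rewrite -normrM -det_mulmx mulmxV ?jac_unit // det1 normr1.
have q0 : 0 < `|\det (jac phi x)|.
  by rewrite normr_gt0 -unitfE -unitmxE jac_unit.
rewrite invf_ple ?posrE //.
apply: le_trans _ H; rewrite -(ler_pM2l q0) E mulfV // gt_eqF //.
Qed.

(** The inverse is 2-Lipschitz by [expand], hence differentiable with Jacobian
    [invmx (jac phi (psi y))]; this formula raises its regularity one order at a time. The bound on
    [U] serves as the bound of order zero on the inverse. *)
Lemma near_identity_inverse : exists psi : 'rV[R]_n -> 'rV[R]_n,
  [/\ forall x, U x -> psi (phi x) = x, open (phi @` U) &
    forall j, Fl m.+1 (fun _ : unit => phi @` U) (fun _ _ => 1) (fun _ _ => 1)
      (fun _ y => psi y 0 j)].
Proof.
have [psi0 Hpsi0] : exists psi : 'rV[R]_n -> 'rV[R]_n, forall y, (phi @` U) y ->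
    U (psi y) /\ phi (psi y) = y.
  have /choice[psi H] : forall y, exists x, (phi @` U) y -> U x /\ phi x = y.
    move=> y; have [[x Ux e]|ny] := pselect ((phi @` U) y); first by exists x.
    by exists 0.
  by exists psi.
have psiK x : U x -> psi0 (phi x) = x.
  move=> Ux; have [Up e] := Hpsi0 _ (imageP phi Ux).
  have := expand Up Ux; rewrite e subrr normr0 mulr0 normr_le0 subr_eq0.
  by move/eqP.
have oV : open (phi @` U).
  rewrite openE => _ [x Ux <-].
  have [d d0 Hd] := open_ballP oU Ux.
  apply/nbhs_ballP; exists (d / 4) => /=; first by rewrite divr_gt0.
  move=> y; rewrite -ball_normE /= => xy.
  have d2 : 0 < d / 2 by rewrite divr_gt0.
  have sub z : `|z - x| <= d / 2 -> U z.
    by move=> zx; apply: Hd; apply: le_lt_trans zx _; rewrite ltr_pdivrMr // mulr_natr mulr2n ltrDl.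
  have [||z zx e] := @near_identity_onto R n (fun z => phi z - z) x y (d / 2) d2.
  - move=> z z' /sub Uz /sub Uz'; have := phi_id Uz Uz'.
    rewrite (_ : phi z - z - (phi z' - z') = phi z - phi z' - (z - z')) //.
    by apply/rowP => i; rewrite !mxE; ring.
  - rewrite [x + _]addrC subrK distrC; apply: ltW; apply: lt_le_trans xy _.
    by rewrite -mulrA -invfM -natrM.
  by exists z; [exact: sub|rewrite -e addrC subrK].
exists psi0; split=> //.
have lip y y' : (phi @` U) y -> (phi @` U) y' -> `|psi0 y - psi0 y'| <= 2 * `|y - y'|.
  move=> Vy Vy'; have [Up e] := Hpsi0 _ Vy; have [Up' e'] := Hpsi0 _ Vy'.
  by have := expand Up Up'; rewrite e e'.
have dpsi y : (phi @` U) y -> forall i, differentiable (fun y => psi0 y 0 i) y /\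
    forall j, pd j (fun y => psi0 y 0 i) y = invmx (jac phi (psi0 y)) j i.
  move=> Vy i; apply: eps_pd => e e0.
  have [Ux yE] := Hpsi0 _ Vy; set x := psi0 y in Ux yE *.
  (* The factor collects [4 n] from the inverse Jacobian and 2 from the Lipschitz constant of the
     inverse. *)
  have [e' e'E] : exists e', e' = e / (8 * n.+1%:R) by eexists.
  have e'0 : 0 < e' by rewrite e'E divr_gt0 // mulr_gt0.
  have [d d0 Hd] := diff_jac (fun j => dphi j Ux) e'0.
  have [d' d'0 Hd'] := open_ballP oV Vy.
  exists (Num.min d' (d / 2)) => [|k]; first by rewrite lt_min d'0 divr_gt0.
  rewrite lt_min => /andP[kd' kd].
  have Vk : (phi @` U) (k + y) by apply: Hd'; rewrite addrK.
  have [Uk kE] := Hpsi0 _ Vk.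
  pose h := psi0 (k + y) - x.
  have hk : `|h| <= 2 * `|k| by have := lip _ _ Vk Vy; rewrite addrK.
  have hd : `|h| < d.
    by apply: le_lt_trans hk _; rewrite mulrC -ltr_pdivlMr.
  have := Hd _ hd; rewrite {1}/h subrK kE yE addrK => H.
  have -> : psi0 (k + y) 0 i - x 0 i - \sum_i0 k 0 i0 * invmx (jac phi x) i0 i =
     (h - k *m invmx (jac phi x)) 0 i by rewrite !mxE.
  apply: le_trans (ler_coord_norm _ _) _.
  have -> : h - k *m invmx (jac phi x) = - ((k - h *m jac phi x) *m invmx (jac phi x)).
    by rewrite mulmxBl mulmxK ?jac_unit // opprB.
  rewrite normrN.
  apply: le_trans (mulmx_norm_le _ _ (fun i j => invjac_entry i j Ux)) _ => //.
  apply: le_trans (ler_wpM2l _ H) _; first by rewrite mulr_ge0.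
  have n4 : 0 <= n%:R * 4 :> R by rewrite mulr_ge0.
  apply: le_trans (ler_wpM2l n4 (ler_wpM2l (ltW e'0) hk)) _.
  rewrite !mulrA; apply: ler_wpM2r => //.
  rewrite (_ : n%:R * 4 * e' * 2 = e * (n%:R / n.+1%:R)); last first.
    have N0 : n.+1%:R != 0 :> R by rewrite pnatr_eq0.
    by rewrite e'E; move: (n.+1%:R : R) N0 => N N0; field.
  rewrite ler_piMr ?(ltW e0) // ler_pdivrMr // mul1r ler_nat.
  exact: leqnSn.
have [CU HCU] := bU.
have Hinv p q : Fl m (fun _ : unit => U) (fun _ _ => 1) (fun _ _ => 1)
    (fun _ x => invmx (jac phi x) p q).
  apply: (@Fl_invmx _ _ _ _ (fun _ => oU) _ _ _ (fun _ => jac phi)).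
    exact: det_lower.
  move=> a b; apply: (@Fl_eq _ _ _ _ (fun _ => oU) _ _ _ _ _ _ _ _ (Fl_pd a (phiC b))).
    by move=> _ x Ux; rewrite mxE.
  by move=> _ x _; rewrite divr1.
suff H j : (j <= m.+1)%N -> forall i, Fl j (fun _ : unit => phi @` U) (fun _ _ => 1) (fun _ _ => 1)
      (fun _ y => psi0 y 0 i) by move=> i; exact: H.
elim: j => [|j IH] jm i;
  (split; [exists CU => _ y Vy; rewrite mulr1; have [Uy _] := Hpsi0 _ Vy;
           exact: le_trans (ler_coord_norm _ _) (HCU _ Uy)|]).
  move=> _ y Vy; have [dp _] := dpsi y Vy i.
  exact: differentiable_continuous dp.
split=> [_ y Vy|l]; first by have [] := dpsi y Vy i.
apply: (@Fl_eq _ _ _ _ (fun _ => oV) _ _ (fun _ _ => 1) (fun _ y => invmx (jac phi (psi0 y)) l i)).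
- by move=> _ y Vy; rewrite (dpsi y Vy i).2.
- by move=> _ y Vy; rewrite divr1.
apply: (@Fl_comp _ _ _ _ _ _ (fun _ => U) (fun _ x => invmx (jac phi x) l i) (fun _ => psi0)).
- by move=> _; exact: oV.
- by move=> _ y Vy; have [] := Hpsi0 _ Vy.
- by apply: Fl_leq (Hinv l i).
- by apply: IH; exact: ltnW.
Qed.

End InverseFunction.

(** * Diagonalization of symmetric matrices *)

Section Spectral.
Context {R : realType} {n : nat}.
Implicit Types (x y z : 'rV[R]_n).

Definition dot x y : R := \sum_i x 0 i * y 0 i.

Lemma enorm_dotE x : enorm x = Num.sqrt (dot x x).
Proof. by congr Num.sqrt; apply: eq_bigr => i _; rewrite expr2. Qed.

Lemma dotC x y : dot x y = dot y x.
Proof. by apply: eq_bigr => i _; rewrite mulrC. Qed.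

Lemma dotDl x y z : dot (x + y) z = dot x z + dot y z.
Proof. by rewrite /dot -big_split; apply: eq_bigr => i _; rewrite mxE mulrDl. Qed.

Lemma dotZl (a : R) x y : dot (a *: x) y = a * dot x y.
Proof. by rewrite /dot mulr_sumr; apply: eq_bigr => i _; rewrite mxE mulrA. Qed.

Lemma dotDr x y z : dot z (x + y) = dot z x + dot z y.
Proof. by rewrite dotC dotDl !(dotC z). Qed.

Lemma dotZr (a : R) x y : dot y (a *: x) = a * dot y x.
Proof. by rewrite dotC dotZl (dotC y). Qed.

Lemma dot_ge0 x : 0 <= dot x x.
Proof. by apply: sumr_ge0 => i _; rewrite -expr2 sqr_ge0. Qed.

Lemma dot_eq0 x : dot x x = 0 -> x = 0.
Proof.
move=> /eqP; rewrite psumr_eq0 => [/allP H|i _]; last by rewrite -expr2 sqr_ge0.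
apply/rowP => i; have := H i (mem_index_enum _).
by rewrite /= mulf_eq0 orbb mxE => /eqP.
Qed.

Lemma dot_mulmxl m (A : 'M[R]_(m, n)) (u : 'rV[R]_m) x :
  dot (u *m A) x = \sum_i u 0 i * dot (row i A) x.
Proof.
rewrite /dot (eq_bigr (fun j => \sum_i u 0 i * (A i j * x 0 j))).
  by rewrite exchange_big; apply: eq_bigr => i _ /=; rewrite mulr_sumr;
    apply: eq_bigr => j _; rewrite mxE.
by move=> j _; rewrite mxE mulr_suml; apply: eq_bigr => i _; rewrite mulrA.
Qed.

Variable H : 'M[R]_n.
Hypothesis symH : H^T = H.

Lemma dot_sym x y : dot (x *m H) y = dot x (y *m H).
Proof.
rewrite /dot (eq_bigr (fun j => \sum_i x 0 i * H i j * y 0 j)).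
  rewrite exchange_big; apply: eq_bigr => i _ /=; rewrite mxE mulr_sumr.
  by apply: eq_bigr => j _; rewrite -{1}symH mxE -mulrA (mulrC (H j i)).
by move=> j _; rewrite mxE mulr_suml.
Qed.

Lemma continuous_sum_rV (F : 'I_n -> 'rV[R]_n -> R) :
  (forall i, continuous (F i)) -> continuous (fun x => \sum_i F i x).
Proof.
move=> cF; rewrite (_ : (fun x => _) = \sum_i F i); last first.
  by apply/funext => y; rewrite fct_sumE.
apply: (big_ind (fun g : 'rV[R]_n -> R => continuous g)).
- by move=> x; exact: cst_continuous.
- by move=> g1 g2 c1 c2 x; apply: continuousD; [exact: c1|exact: c2].
- by move=> j _; exact: cF.
Qed.

Lemma dot_continuous (F G : 'rV[R]_n -> 'rV[R]_n) :
  (forall i, continuous (fun x => F x 0 i)) -> (forall i, continuous (fun x => G x 0 i)) ->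
  continuous (fun x => dot (F x) (G x)).
Proof.
move=> cF cG; apply: continuous_sum_rV => i x.
by apply: continuousM; [exact: cF|exact: cG].
Qed.

Lemma coord_mulmx_continuous i : continuous (fun x => (x *m H) 0 i).
Proof.
rewrite (_ : (fun x => _) = fun x => \sum_j x 0 j * H j i); last first.
  by apply/funext => x; rewrite mxE.
apply: continuous_sum_rV => j x; apply: continuousM; last exact: cst_continuous.
exact: coord_continuous.
Qed.

(* One more eigenvector: maximise the Rayleigh quotient on the orthogonal complement. *)
Lemma rayleigh m (a : nat -> 'rV[R]_n) (l : nat -> R) : (m < n)%N ->
  (forall i, (i < m)%N -> a i *m H = l i *: a i) ->
  exists x (lx : R), [/\ dot x x = 1, forall i, (i < m)%N -> dot x (a i) = 0, x *m H = lx *: x &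
    forall y, (forall i, (i < m)%N -> dot y (a i) = 0) -> dot (y *m H) y <= lx * dot y y].
Proof.
move=> mn ea.
pose W := [set x : 'rV[R]_n | forall i, (i < m)%N -> dot x (a i) = 0].
pose S := [set x | W x /\ dot x x = 1].
have WD x y : W x -> W y -> W (x + y).
  by move=> Wx Wy i im; rewrite dotDl Wx // Wy // addr0.
have WZ (c : R) x : W x -> W (c *: x) by move=> Wx i im; rewrite dotZl Wx // mulr0.
have S0 : S !=set0.
  (* Fewer than [n] orthogonality conditions have a nonzero common solution. *)
  pose A := \matrix_(i < n, j < m) a j 0 i.
  have rA : (\rank A < n)%N by exact: leq_ltn_trans (rank_leq_col _) mn.
  have k0 : kermx A != 0.
    by rewrite -mxrank_eq0 mxrank_ker -lt0n subn_gt0.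
  pose v := nz_row (kermx A).
  have v0 : v != 0 by rewrite nz_row_eq0.
  have vA : v *m A = 0 by apply/sub_kermxP; exact: nz_row_sub.
  have Wv : W v.
    move=> i im; have := congr1 (fun M : 'rV[R]_m => M 0 (Ordinal im)) vA.
    by rewrite !mxE => <-; apply: eq_bigr => j _; rewrite mxE.
  have vv : 0 < dot v v.
    by rewrite lt_def dot_ge0 andbT; apply: contra v0 => /eqP/dot_eq0 ->.
  exists ((Num.sqrt (dot v v))^-1 *: v); split; first exact: WZ.
  rewrite dotZl dotZr mulrA -expr2 exprVn sqr_sqrtr ?mulVf ?gt_eqF // ltW //.
have cdot (b : 'rV[R]_n) : continuous (fun x => dot x b).
  apply: (@dot_continuous id (fun _ => b)) => i; first exact: coord_continuous.
  by move=> x; exact: cst_continuous.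
have cid2 : continuous (fun x => dot x x).
  by apply: (@dot_continuous id id) => i; exact: coord_continuous.
have cS : compact S.
  apply: bounded_closed_compact.
    exists 1; split; first exact: num_real.
    move=> r r1 x [_ x1]; apply: le_trans (ltW r1).
    apply: le_trans (ler_norm_enorm x) _.
    by rewrite enorm_dotE x1 sqrtr1.
  have -> : S = (\bigcap_(i in [set i | (i < m)%N]) ((fun x => dot x (a i)) @^-1` [set 0]))
      `&` ((fun x => dot x x) @^-1` [set 1]).
    apply/seteqP; split=> x /=.
      by move=> [Wx x1]; split=> // i im; exact: Wx.
    by move=> [Wx x1]; split=> // i im; exact: Wx.
  apply: closedI; last first.
    by apply: preimage_closed => [x _|]; [exact: cid2|exact: closed_eq].
  apply: closed_bigI => i _.
  by apply: preimage_closed => [x _|]; [exact: cdot|exact: closed_eq].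
have cq : continuous (fun x => dot (x *m H) x).
  apply: (@dot_continuous (fun x => x *m H) id) => i; last exact: coord_continuous.
  exact: coord_mulmx_continuous.
have [x /set_mem[Wx x1] xmax] := EVT_max_rV S0 cS (continuous_subspaceT cq).
pose lx := dot (x *m H) x.
have max y : W y -> dot (y *m H) y <= lx * dot y y.
  move=> Wy; have [->|y0] := eqVneq y 0.
    by rewrite mul0mx /dot !big1 ?mulr0 // => i _; rewrite mxE mul0r.
  have yy : 0 < dot y y.
    by rewrite lt_def dot_ge0 andbT; apply: contra y0 => /eqP/dot_eq0 ->.
  pose c := (Num.sqrt (dot y y))^-1.
  have c2 : c * c = (dot y y)^-1 by rewrite -expr2 exprVn sqr_sqrtr ?ltW.
  have Sy : S (c *: y).
    by split; [exact: WZ|rewrite dotZl dotZr mulrA c2 mulVf // gt_eqF].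
  have := xmax _ (mem_set Sy); rewrite -scalemxAl dotZl dotZr mulrA c2 -/lx.
  by rewrite mulrC ler_pdivrMr.
exists x, lx; split=> //.
(* The residual is again orthogonal to the [a i]. Moving from [x] by [t *: r] changes the form,
   compared with its maximum, by [2 t |r|^2] to first order, so a nonzero [r] would contradict
   maximality for small [t > 0]. *)
have [r rE] : exists r, r = x *m H - lx *: x by eexists.
have Wr : W r.
  move=> i im; rewrite rE dotDl dot_sym ea // dotZr Wx // mulr0 add0r.
  by rewrite -scaleNr dotZl Wx // mulr0.
suff : dot r r = 0 by move=> /dot_eq0/eqP; rewrite rE subr_eq0 => /eqP.
have H2 (t : R) : 2 * t * dot r r + t ^+ 2 * (dot (r *m H) r - lx * dot r r) <= 0.
  have := max _ (WD _ _ Wx (WZ t _ Wr)).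
  rewrite mulmxDl -scalemxAl !(dotDl, dotDr, dotZl, dotZr) x1 -/lx.
  rewrite (dot_sym r x) (dotC r x) (dotC r (x *m H)).
  have -> : dot (x *m H) r = dot r r + lx * dot x r.
    have {1}-> : x *m H = r + lx *: x by rewrite rE subrK.
    by rewrite dotDl dotZl.
  move: (dot (r *m H) r) (dot r r) (dot x r) => A B C; lra.
apply/eqP; apply: contraT => B0.
have Bp : 0 < dot r r by rewrite lt_def B0 dot_ge0.
set B := dot r r in H2 Bp; set A := dot (r *m H) r - lx * B in H2.
pose t := B / (`|A| + B).
have AB : 0 < `|A| + B by rewrite ltr_wpDl.
have t0 : 0 < t by rewrite divr_gt0.
have := H2 t; rewrite leNgt => /negP[].
have -> : 2 * t * B + t ^+ 2 * A = t * (2 * B + t * A) by ring.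
rewrite mulr_gt0 //.
have tA : `|t * A| < 2 * B.
  rewrite normrM (gtr0_norm t0) /t mulrAC ltr_pdivrMr //.
  have : `|A| <= `|A| + B by rewrite lerDl ltW.
  by move: `|A| AB => A' *; nra.
by move: tA; rewrite ltr_norml => /andP[? _]; lra.
Qed.

Lemma orthonormal_eigenbasis : exists (a : nat -> 'rV[R]_n) (l : nat -> R),
  [/\ forall i j, (i < n)%N -> (j < n)%N -> dot (a i) (a j) = (i == j)%:R,
      forall i, (i < n)%N -> a i *m H = l i *: a i &
      forall i j, (i <= j < n)%N -> l j <= l i].
Proof.
(* The induction also records that every eigenvalue found so far bounds the form on the orthogonal
   complement. This makes the eigenvalues decrease, so that positive ones come first. *)
suff G m : (m <= n)%N -> exists (a : nat -> 'rV[R]_n) (l : nat -> R),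
  [/\ forall i j, (i < m)%N -> (j < m)%N -> dot (a i) (a j) = (i == j)%:R,
      forall i, (i < m)%N -> a i *m H = l i *: a i,
      forall i j, (i <= j < m)%N -> l j <= l i &
      forall i y, (i < m)%N -> (forall j, (j < m)%N -> dot y (a j) = 0) ->
        dot (y *m H) y <= l i * dot y y].
  by have [a [l [? ? ? ?]]] := G n (leqnn n); exists a, l.
elim: m => [_|m IH mn].
  by exists (fun=> 0), (fun=> 0); split=> // i j /andP[].
have [a [l [oa ea ml ql]]] := IH (ltnW mn).
have [x [lx [x1 xo ex qx]]] := rayleigh mn ea.
have lxl i : (i < m)%N -> lx <= l i.
  move=> im; have := ql i x im xo; rewrite x1 mulr1 => /(le_trans _); apply.
  by rewrite ex dotZl x1 mulr1.
have ltm i : (i < m.+1)%N -> (i == m) || (i < m)%N by rewrite ltnS leq_eqVlt.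
exists (fun i => if i == m then x else a i), (fun i => if i == m then lx else l i).
split.
- move=> i j /ltm im /ltm jm.
  case: (eqVneq i m) im => [->|im] /= im'; case: (eqVneq j m) jm => [->|jm] /= jm'.
  + by rewrite x1 ?eqxx.
  + by rewrite xo // eq_sym (negbTE jm).
  + by rewrite dotC xo // (negbTE im).
  + by rewrite oa.
- move=> i /ltm; case: (eqVneq i m) => [-> _|im /= im']; first exact: ex.
  exact: ea.
- move=> i j; rewrite ltnS => /andP[ij jm].
  have [jE|jm'] := eqVneq j m; have [iE|im'] := eqVneq i m.
  + by [].
  + by apply: lxl; rewrite ltn_neqAle im' -jE.
  + by move: jm'; rewrite eqn_leq jm -iE ij.
  + by apply: ml; rewrite ij ltn_neqAle jm'.
- move=> i y im Hy.
  have Wy j : (j < m)%N -> dot y (a j) = 0.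
    by move=> jm; have := Hy j (ltnW jm); rewrite ltn_eqF.
  have [_|im'] := eqVneq i m; first exact: qx.
  by apply: ql => //; rewrite ltn_neqAle im' -ltnS.
Qed.

End Spectral.

(** Each coordinate along an eigenvector is scaled by [sqrt (|l i| / 2)], which makes half the form
    a signed sum of squares. The entries of [C] must be bounded in terms of [K] since [C] enters the
    chart: eigenvalues are at most [n ^ 2 K], and [sqrt (L / 2) <= L + 1]. *)
Lemma sylvester (R : realType) n (H : 'M[R]_n) (K : R) : H^T = H -> H \in unitmx ->
  (forall i j, `|H i j| <= K) ->
  exists (C : 'M[R]_n) (l : nat), [/\ C \in unitmx, (l <= n)%N,
    forall i j, `|C i j| <= n%:R * n%:R * K + 1 &
    forall z, dot (z *m H) z / 2 = \sum_(i < n | (i < l)%N) (z *m C) 0 i ^+ 2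
                             - \sum_(i < n | (l <= i)%N) (z *m C) 0 i ^+ 2].
Proof.
move=> symH uH HK.
have [a [l [oa ea ml]]] := orthonormal_eigenbasis symH.
have l0 (i : 'I_n) : l i != 0.
  apply/negP => /eqP li0; have := ea i (ltn_ord i); rewrite li0 scale0r => aH.
  have a0 : a i = 0 by rewrite -[a i](mulmxK uH) aH mul0mx.
  have := oa i i (ltn_ord i) (ltn_ord i); rewrite eqxx a0 /dot big1 => [/eqP|j _].
    by rewrite eq_sym oner_eq0.
  by rewrite mxE mul0r.
pose Q := \matrix_(i < n, j < n) a i 0 j.
have QQ : Q *m Q^T = 1%:M.
  apply/matrixP => i j; rewrite !mxE -(oa i j (ltn_ord i) (ltn_ord j)).
  by apply: eq_bigr => s _; rewrite !mxE.
have QtQ : Q^T *m Q = 1%:M by exact: (mulmx1C QQ).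
pose d := \row_(i < n) Num.sqrt (`|l i| / 2).
pose C := Q^T *m diag_mx d.
have d0 i : 0 < d 0 i by rewrite mxE sqrtr_gt0 divr_gt0 // normr_gt0.
have uC : C \in unitmx.
  rewrite unitmx_mul; apply/andP; split.
    by have /mulmx1_unit[] := QtQ.
  by rewrite unitmxE det_diag unitfE; apply/prodf_neq0 => i _; rewrite gt_eqF.
have a1 (i j : 'I_n) : `|a i 0 j| <= 1.
  have := oa i i (ltn_ord i) (ltn_ord i); rewrite eqxx => aa.
  apply: le_trans (ler_coord_enorm _ _) _.
  by rewrite enorm_dotE aa sqrtr1.
have CE (z : 'rV[R]_n) i : (z *m C) 0 i = d 0 i * dot z (a i).
  rewrite mulmxA mul_mx_diag mxE mulrC; congr (_ * _).
  by rewrite mxE; apply: eq_bigr => j _; rewrite !mxE.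
pose p := [pred i : 'I_n | 0 < l i].
exists C, #|p|; split=> //.
- by apply: leq_trans (max_card _) _; rewrite card_ord.
- move=> i j; rewrite /C mul_mx_diag !mxE normrM -[leRHS]mul1r.
  have K0 : 0 <= K by apply: le_trans (HK i j).
  have lj : `|l j| <= n%:R * n%:R * K.
    have -> : l j = dot (a j *m H) (a j).
      by rewrite ea // dotZl oa // eqxx mulr1.
    rewrite -mulrA -[n%:R * K]mulr1; apply: sum_norm_le => [|s|s].
    - by rewrite mulr_ge0.
    - rewrite mxE -[K]mul1r; apply: sum_norm_le => // s'; exact: a1.
    - exact: a1.
  apply: (ler_pM (normr_ge0 _) (normr_ge0 _) (a1 j i)).
  rewrite ger0_norm ?sqrtr_ge0 //.
  have X0 : 0 <= n%:R * n%:R * K by rewrite !mulr_ge0.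
  move: (n%:R * n%:R * K) lj X0 => X lX X0.
  rewrite -(@ler_pXn2r _ 2) ?nnegrE ?sqrtr_ge0 ?addr_ge0 //.
  rewrite sqr_sqrtr ?divr_ge0 //.
  have L0 : 0 <= `|l j| by [].
  move: `|l j| lX L0 => L LX L0; rewrite sqrrD1; nra.
move=> z.
have zE : z = \sum_(i < n) dot z (a i) *: a i.
  rewrite -[LHS]mulmx1 -QtQ mulmxA; apply/rowP => j; rewrite mxE summxE.
  apply: eq_bigr => i _; rewrite !mxE; congr (_ * _).
  by apply: eq_bigr => s _; rewrite !mxE.
have qE : dot (z *m H) z = \sum_(i < n) l i * dot z (a i) ^+ 2.
  rewrite {1}zE mulmx_suml.
  transitivity (\sum_(i < n) dot (l i * dot z (a i) *: a i) z).
    rewrite /dot; under eq_bigr do rewrite summxE mulr_suml.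
    rewrite exchange_big; apply: eq_bigr => i _; apply: eq_bigr => j _ /=.
    by rewrite -scalemxAl ea // scalerA (mulrC (dot _ _)).
  by apply: eq_bigr => i _; rewrite dotZl (dotC (a i)) expr2 mulrA.
(* As the eigenvalues decrease, the positive ones form an initial segment, whose length is their
   number. *)
have pl (i : 'I_n) : (i < #|p|)%N = (0 < l i).
  have cE k : (k <= n)%N -> #|[pred j : 'I_n | (j < k)%N]| = k.
    move=> kn; rewrite -sum1_card -(big_ord_widen n (fun=> 1%N) kn).
    by rewrite sum_nat_const card_ord muln1.
  have [li|li] := ltP 0 (l i).
    rewrite -[X in (X <= _)%N](cE i.+1) //; apply: subset_leq_card.
    apply/fintype.subsetP => j; rewrite !inE ltnS => ji.
    by apply: lt_le_trans li _; apply: ml; rewrite ji ltn_ord.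
  apply/negbTE; rewrite -leqNgt -[X in (_ <= X)%N](cE i) ?(ltnW (ltn_ord i)) //.
  apply: subset_leq_card; apply/fintype.subsetP => j; rewrite !inE => lj.
  rewrite ltnNge; apply/negP => ij; move: lj; rewrite ltNge => /negP[].
  by apply: le_trans li; apply: ml; rewrite ij ltn_ord.
rewrite qE (bigID (fun i : 'I_n => (i < #|p|)%N)) /= mulrDl; congr (_ + _).
  rewrite mulr_suml; apply: eq_bigr => i; rewrite pl CE exprMn => li.
  rewrite mxE sqr_sqrtr ?divr_ge0 // gtr0_norm //; ring.
rewrite mulr_suml -sumrN; apply: eq_big => i; first by rewrite -leqNgt.
rewrite pl -leNgt CE exprMn => li.
rewrite mxE sqr_sqrtr ?divr_ge0 // ler0_norm //; ring.
Qed.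

(** * A quantitative Sard lemma *)

Section Cells.
Context {R : realType}.
Implicit Types (r s : R) (m c : nat).

Definition incell m c r := c%:R <= (r + 1) * m%:R < c.+1%:R.

(** The cells have width [1 / m]; the last of the [2 m + 1] is there for [r = 1]. *)
Lemma incell_ex m r : (0 < m)%N -> `|r| <= 1 -> exists c : 'I_(2 * m).+1, incell m c r.
Proof.
move=> m0; rewrite ler_norml => /andP[r1 r2].
have mp : 0 < m%:R :> R by rewrite ltr0n.
have p0 : 0 <= (r + 1) * m%:R by apply: mulr_ge0 (ltW mp); lra.
have /andP[l u] := truncn_itv p0.
have cm : (Num.truncn ((r + 1) * m%:R) < (2 * m).+1)%N.
  rewrite ltnS -(ler_nat R); apply: le_trans l _.
  by rewrite natrM ler_pM2r //; lra.
by exists (Ordinal cm); rewrite /incell /= l u.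
Qed.

Lemma incell_dist m c r s : (0 < m)%N -> incell m c r -> incell m c s -> `|r - s| <= m%:R^-1.
Proof.
move=> m0 /andP[l1 u1] /andP[l2 u2].
have mp : 0 < m%:R :> R by rewrite ltr0n.
rewrite -(ler_pM2r mp) mulVf ?gt_eqF // -{1}(gtr0_norm mp) -normrM ler_norml.
move: l1 u1 l2 u2; rewrite -addn1 natrD => l1 u1 l2 u2.
by apply/andP; split; nra.
Qed.

Lemma ord_dist_lt p (a a' : 'I_p) (s B : R) : 0 < s -> `|s * a%:R - s * a'%:R| <= s * B ->
  `|(a%:R : R) - a'%:R| <= B.
Proof.
by move=> s0; rewrite -mulrBr normrM (gtr0_norm s0) ler_pM2l.
Qed.

Lemma modn_dist_inj b (a a' : nat) : (0 < b)%N -> `|(a%:R : R) - a'%:R| < b%:R ->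
  a = a' %[mod b] -> a = a'.
Proof.
move=> b0; wlog aa' : a a' / (a' <= a)%N => [H|].
  have [|/ltnW] := leqP a' a; first exact: H.
  by move=> h d e; apply/esym/H => //; rewrite distrC.
rewrite -natrB // normr_nat ltr_nat => d /eqP e.
have : (b %| a - a')%N by rewrite -eqn_mod_dvd // eq_sym.
by rewrite /dvdn modn_small // subn_eq0 => a'a; apply/eqP; rewrite eqn_leq a'a aa'.
Qed.

(** A cube of side [1 / m < d] contains at most one point of a separated set, so the number of cubes
    bounds the cardinality of all such sets. *)
Lemma separated_finite n (d : R) : 0 < d -> exists N : nat,
  forall A : set 'rV[R]_n, (forall x, A x -> enorm x <= 1) ->
  (forall x y, A x -> A y -> x <> y -> d <= `|x - y|) ->
  exists2 m : nat, (m <= N)%N & A #= `I_m.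
Proof.
move=> d0; pose m := (Num.bound d^-1).+1.
exists #|{ffun 'I_n -> 'I_(2 * m).+1}| => {}A A1 Ad.
have dm : m%:R^-1 < d.
  rewrite invf_plt ?posrE ?ltr0n //; apply: lt_trans (archi_boundP _) _.
    by rewrite invr_ge0 ltW.
  by rewrite ltr_nat.
have /choice[cl Hcl] : forall x, exists c : {ffun 'I_n -> 'I_(2 * m).+1},
    A x -> forall j, incell m (c j) (x 0 j).
  move=> x; have [Ax|nAx] := pselect (A x); last by exists [ffun=> ord0].
  have H j : exists c : 'I_(2 * m).+1, incell m c (x 0 j).
    by apply: incell_ex => //; apply: le_trans (ler_coord_enorm _ _) (A1 _ Ax).
  have [c Hc] := choice H.
  by exists (finfun c) => _ j; rewrite ffunE.
have inj : {in A &, injective (fun x => enum_rank (cl x) : nat)}.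
  move=> x y; rewrite !inE => Ax Ay /ord_inj/enum_rank_inj e; apply: contrapT => xy.
  have := Ad _ _ Ax Ay xy; apply/negP; rewrite -ltNge.
  apply: le_lt_trans dm; apply: rV_norm_le => [|j]; first by rewrite invr_ge0.
  rewrite !mxE; apply: (@incell_dist m (cl x j)) => //; first exact: Hcl.
  by rewrite e; exact: Hcl.
have AN : A #<= `I_(#|{ffun 'I_n -> 'I_(2 * m).+1}|).
  rewrite -(card_le_eql (inj_card_eq inj)); apply: subset_card_le.
  by move=> _ [x _ <-] /=.
have /finite_setP[p Ap] : finite_set A by apply/finite_set_leP; eexists; exact: AN.
exists p => //.
by rewrite -card_le_II -(card_le_eql Ap).
Qed.

End Cells.

Section Pigeonhole.
Context {R : realType} {n' : nat}.
Let n := n'.+1.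
Variables (L eps : R).
Hypothesis (L0 : 0 <= L) (eps0 : 0 < eps).

(** Points with the same key are at most [D * mi] apart, and [s] is the grid step, so that the grid
    extends up to [eps]. Divided by [s], the gradient distances [(L D + 2) mi] and
    [N (L + 3) mi ^ 2] become less than [b] and [c1]: these are the moduli of the residues. *)
Variables (N D mi s : R) (B1 c1 m b : nat).
Hypothesis (NE : N = n%:R) (DE : D = N * (2 * N + 2)) (miE : mi = m%:R^-1).
Hypothesis (sE : s = eps * mi ^+ 2) (bE : b = (B1 * m)%N) (m2 : (1 < m)%N).
Hypothesis (B1E : (L * D + 2) / eps < B1%:R) (c1E : N * (L + 3) / eps < c1%:R).
Hypothesis (b0 : (0 < b)%N) (c0 : (0 < c1)%N).

Let N1 : 1 <= N. Proof. by rewrite NE ler1n. Qed.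
Let m0 : (0 < m)%N. Proof. exact: ltnW. Qed.
Let mp : 0 < m%:R :> R. Proof. by rewrite ltr0n. Qed.
Let mi0 : 0 < mi. Proof. by rewrite miE invr_gt0. Qed.
Let mi2 : mi <= 2^-1.
Proof. by rewrite miE lef_pV2 ?posrE // (ler_nat R 2). Qed.
Let s0 : 0 < s. Proof. by rewrite sE mulr_gt0 // exprn_gt0. Qed.
Let D1 : 1 <= D.
Proof. by rewrite DE; have := N1; nra. Qed.
Let D0 : 0 <= D. Proof. exact: le_trans D1. Qed.
Let miD : mi <= D * mi. Proof. by rewrite ler_peMl // ltW. Qed.

(** [g] stands for the gradient and [h] for the Hessian of the function to be perturbed; a linear
    form shifts [g] by a constant and leaves [h] unchanged. *)
Variables (g : 'I_n -> 'rV[R]_n -> R) (h : 'rV[R]_n -> 'M[R]_n).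
Hypothesis gL : forall x y j, enorm x <= 1 -> enorm y <= 1 -> `|g j y - g j x| <= L * `|y - x|.
Hypothesis gT : forall x y j, enorm x <= 1 -> enorm y <= 1 ->
  `|g j y - g j x - ((y - x) *m h x) 0 j| <= L * `|y - x| ^+ 2.
Hypothesis hS : forall x, enorm x <= 1 -> (h x)^T = h x.

Let near (a : {ffun 'I_n -> 'I_(m * m)}) x :=
  enorm x <= 1 /\ forall j, `|g j x + s * (a j)%:R| <= mi ^+ 2.

(* A vector [v = s *: a], for [a] in an n-dimensional grid of side [m * m], is bad if some point
   where [g + v] is small is close to the sphere ([near_sphere]) or has an almost singular Hessian
   ([near_singular]). A key consists of the cell of that point and of just enough residues of [a] to
   recover [a]: neighbouring points have gradients at distance [O(mi)], which determines [a]
   up to its residues modulo [b = O(m)]; along an almost singular direction [xi] the gradient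
   only moves by [O(mi ^+ 2)], so that boundedly many residues suffice for one more coordinate.
   In both cases one dimension is gained, and there are fewer keys than grid points. *)
Let near_sphere (a : {ffun 'I_n -> 'I_(m * m)})
    (k : 'I_n * bool * {ffun 'I_n' -> 'I_(2 * m).+1} * {ffun 'I_n -> 'I_b}) :=
  let: (i, sg, cl, res) := k in exists x, [/\ near a x, 1 - mi < enorm x,
     (2 * N)^-1 <= (-1) ^+ sg * x 0 i, forall j, incell m (cl j) (x 0 (lift i j)) &
     forall j, res j = (a j %% b)%N :> nat].

Let near_singular (a : {ffun 'I_n -> 'I_(m * m)})
    (k : {ffun 'I_n -> 'I_(2 * m).+1} * 'I_n * {ffun 'I_n' -> 'I_b} * 'I_c1) :=
  let: (cl, i, res, q) := k in exists x (xi : 'rV[R]_n), [/\ near a x, `|xi *m h x| <= mi * `|xi|,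
     0 < `|xi| /\ `|xi| = `|xi 0 i|,
     forall j, incell m (cl j) (x 0 j) &
     (forall j, res j = (a (lift i j) %% b)%N :> nat) /\ q = (a i %% c1)%N :> nat].

Definition Pkey : finType :=
  (('I_n * bool * {ffun 'I_n' -> 'I_(2 * m).+1} * {ffun 'I_n -> 'I_b}) +
  ({ffun 'I_n -> 'I_(2 * m).+1} * 'I_n * {ffun 'I_n' -> 'I_b} * 'I_c1))%type.

Let near_dist a a' x x' j : near a x -> near a' x' -> `|x - x'| <= D * mi ->
  `|((a j)%:R : R) - (a' j)%:R| < b%:R.
Proof.
move=> [x1 nx] [x1' nx'] dx.
apply: (@le_lt_trans _ _ ((L * D + 2) / eps * m%:R)).
  apply: (ord_dist_lt s0).
  have -> : s * ((L * D + 2) / eps * m%:R) = (L * D + 2) * mi.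
    by rewrite sE miE; field; rewrite !gt_eqF.
  have -> : s * (a j)%:R - s * (a' j)%:R = (g j x + s * (a j)%:R) - (g j x' + s * (a' j)%:R) +
      (g j x' - g j x) by ring.
  apply: le_trans (ler_normD _ _) _.
  apply: le_trans (lerD (ler_normB _ _) (gL j x1 x1')) _.
  have := nx j; have := nx' j; rewrite distrC in dx; have := ler_wpM2l L0 dx.
  have : mi ^+ 2 <= mi by have := mi2; have := mi0; nra.
  move: (mi ^+ 2) => mm; rewrite mulrA.
  move: `|g j x + _| `|g j x' + _| (L * `|x' - x|) (L * D) => p1 p2 p3 p4 *; lra.
by rewrite bE natrM ltr_pM2r.
Qed.

(** The norms and all coordinates but the [i]-th agree up to O(mi), hence so do the squares of the
    [i]-th coordinates. These have a common sign and size at least [1 / (2 N)], so dividing by their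
    sum leaves at most [D * mi]. *)
Let near_sphere_inj a a' k : near_sphere a k -> near_sphere a' k -> a = a'.
Proof.
case: k => [[[i sg] cl] res] [x [nx ex sx cx rx]] [x' [nx' ex' sx' cx' rx']].
suff dx : `|x - x'| <= D * mi.
  apply/ffunP => j; apply/val_inj/(modn_dist_inj b0); last by rewrite -rx -rx'.
  exact: near_dist nx nx' dx.
have dj (j : 'I_n') : `|x 0 (lift i j) - x' 0 (lift i j)| <= mi.
  by rewrite miE; apply: (incell_dist _ (cx j) (cx' j)).
have [[x1 _] [x1' _]] := (nx, nx').
have x1i j : `|x 0 j| <= 1 by apply: le_trans (ler_coord_enorm _ _) x1.
have x1i' j : `|x' 0 j| <= 1 by apply: le_trans (ler_coord_enorm _ _) x1'.
have sq (y : 'rV[R]_n) : enorm y ^+ 2 = y 0 i ^+ 2 + \sum_(j < n') y 0 (lift i j) ^+ 2.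
  rewrite sqr_enorm (bigD1 i) //=; congr (_ + _).
  rewrite (reindex_omap (lift i) (unlift i)) /=; last first.
    by move=> j; rewrite eq_sym => /unlift_some[l -> ->].
  by apply: eq_bigl => j; rewrite liftK eqxx eq_sym neq_lift.
have S : `|\sum_(j < n') (x 0 (lift i j) ^+ 2 - x' 0 (lift i j) ^+ 2)| <= N * (2 * mi).
  apply: le_trans (ler_norm_sum _ _ _) _.
  apply: (@le_trans _ _ (\sum_(j < n') (2 * mi))).
    apply: ler_sum => j _; rewrite subr_sqr normrM mulrC.
    apply: (ler_pM (normr_ge0 _) (normr_ge0 _) _ (dj j)).
    by apply: le_trans (ler_normD _ _) _; rewrite -[leRHS]/(1 + 1) lerD.
  rewrite sumr_const card_ord -[X in X <= _]mulr_natl.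
  apply: ler_wpM2r; first by rewrite mulr_ge0 // (ltW mi0).
  by rewrite NE ler_nat.
have E : enorm x ^+ 2 - enorm x' ^+ 2 = x 0 i ^+ 2 - x' 0 i ^+ 2 +
   \sum_(j < n') (x 0 (lift i j) ^+ 2 - x' 0 (lift i j) ^+ 2).
  by rewrite !sq sumrB; ring.
have E2 : `|enorm x ^+ 2 - enorm x' ^+ 2| <= 2 * mi.
  have := enorm_ge0 x; have := enorm_ge0 x'; move: x1 x1' ex ex' mi2 mi0.
  move: (enorm x) (enorm x') => p q *; rewrite ler_norml; apply/andP; split; nra.
have P : N^-1 <= `|x 0 i + x' 0 i|.
  have : N^-1 <= (-1) ^+ sg * (x 0 i + x' 0 i).
    rewrite mulrDr; apply: le_trans (lerD sx sx').
    have N0 : N != 0 by rewrite gt_eqF // (lt_le_trans ltr01).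
    by have -> : N^-1 = (2 * N)^-1 + (2 * N)^-1 by field.
  move/le_trans; apply; apply: le_trans (ler_norm _) _.
  by rewrite normrM normrX normrN1 expr1n mul1r.
have di : `|x 0 i - x' 0 i| <= D * mi.
  have h2 : `|x 0 i - x' 0 i| * `|x 0 i + x' 0 i| <= (2 + 2 * N) * mi.
    rewrite -normrM -subr_sqr.
    have -> : x 0 i ^+ 2 - x' 0 i ^+ 2 = (enorm x ^+ 2 - enorm x' ^+ 2) -
       \sum_(j < n') (x 0 (lift i j) ^+ 2 - x' 0 (lift i j) ^+ 2) by rewrite E addrK.
    apply: le_trans (ler_normB _ _) _.
    by apply: le_trans (lerD E2 S) _; rewrite le_eqVlt; apply/orP; left; apply/eqP; ring.
  have h1 : `|x 0 i - x' 0 i| * N^-1 <= `|x 0 i - x' 0 i| * `|x 0 i + x' 0 i|.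
    by rewrite ler_wpM2l.
  have Np : 0 < N by apply: lt_le_trans N1.
  have := le_trans h1 h2; rewrite ler_pdivrMr // DE.
  by move/le_trans; apply; rewrite le_eqVlt; apply/orP; left; apply/eqP; ring.
apply: rV_norm_le => [|j]; first by rewrite mulr_ge0 // (ltW mi0).
rewrite !mxE; case: (unliftP i j) => [l ->|-> //].
exact: le_trans (dj l) miD.
Qed.

(** The gradient difference is tested against [xi]. By symmetry the Hessian can be moved onto [xi],
    where it has size at most [mi |xi|], so everything is O(mi ^ 2 |xi|). All coordinates of [a] and
    [a'] but the [i]-th agree already, and [|xi 0 i|] is the norm of [xi]. *)
Let near_singular_inj a a' k : near_singular a k -> near_singular a' k -> a = a'.
Proof.
case: k => [[[cl i] res] q] [x [xi [nx hx [xi0 xiE] cx [rx qx]]]]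
  [x' [xi' [nx' hx' [xi0' xiE'] cx' [rx' qx']]]].
have dx : `|x - x'| <= mi.
  apply: rV_norm_le => [|j]; first exact: (ltW mi0).
  by rewrite !mxE miE; apply: (incell_dist _ (cx j) (cx' j)).
have dxD : `|x - x'| <= D * mi by apply: le_trans dx miD.
have aj j : j != i -> a j = a' j.
  rewrite eq_sym => /unlift_some[l -> _]; apply/val_inj/(modn_dist_inj b0).
    exact: near_dist nx nx' dxD.
  by rewrite -rx -rx'.
have [[x1 gx] [x1' gx']] := (nx, nx').
suff ai : `|((a i)%:R : R) - (a' i)%:R| < c1%:R.
  apply/ffunP => j; have [->|/aj //] := eqVneq j i.
  by apply/val_inj/(modn_dist_inj c0 ai); rewrite -qx -qx'.
apply: (@le_lt_trans _ _ (N * (L + 3) / eps)); last exact: c1E.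
apply: (ord_dist_lt s0); rewrite -(ler_pM2l xi0) {1}xiE -normrM.
have -> : s * (N * (L + 3) / eps) = N * (L + 3) * mi ^+ 2 by rewrite sE; field; rewrite gt_eqF.
have -> : xi 0 i * (s * (a i)%:R - s * (a' i)%:R) = \sum_j xi 0 j * (s * (a j)%:R - s * (a' j)%:R).
  rewrite (bigD1 i) //= big1 ?addr0 // => j ji.
  by rewrite aj // subrr mulr0.
have -> : \sum_j xi 0 j * (s * (a j)%:R - s * (a' j)%:R) =
   \sum_j xi 0 j * ((g j x + s * (a j)%:R) - (g j x' + s * (a' j)%:R) +
                (g j x' - g j x - ((x' - x) *m h x) 0 j)) +
   \sum_j xi 0 j * ((x' - x) *m h x) 0 j.
  by rewrite -big_split /=; apply: eq_bigr => j _; ring.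
have -> : \sum_j xi 0 j * ((x' - x) *m h x) 0 j = \sum_j (x' - x) 0 j * (xi *m h x) 0 j.
  by have := dot_sym (hS x1) (x' - x) xi; rewrite dotC.
apply: le_trans (ler_normD _ _) _.
have l1 : `|\sum_j xi 0 j * ((g j x + s * (a j)%:R) - (g j x' + s * (a' j)%:R) +
                (g j x' - g j x - ((x' - x) *m h x) 0 j))| <= N * (`|xi| * ((2 + L) * mi ^+ 2)).
  rewrite NE; apply: sum_norm_le => // j; first exact: ler_coord_norm.
  apply: le_trans (ler_normD _ _) _.
  apply: le_trans (lerD (ler_normB _ _) (gT j x1 x1')) _.
  have := gx j; have := gx' j; rewrite distrC in dx.
  have : L * `|x' - x| ^+ 2 <= L * mi ^+ 2.
    by apply: (ler_wpM2l L0); rewrite ler_pXn2r ?nnegrE ?(ltW mi0).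
  rewrite mulrDl; move: `|g j x + _| `|g j x' + _| => *; lra.
have l2 : `|\sum_j (x' - x) 0 j * (xi *m h x) 0 j| <= N * (mi * (mi * `|xi|)).
  rewrite NE; apply: sum_norm_le => [|j|j]; first exact: (ltW mi0).
    by apply: le_trans (ler_coord_norm _ _) _; rewrite distrC.
  by apply: le_trans (ler_coord_norm _ _) hx.
apply: le_trans (lerD l1 l2) _; rewrite le_eqVlt; apply/orP; left; apply/eqP; ring.
Qed.

Lemma pigeonhole : (#|{: Pkey}| < #|{ffun 'I_n -> 'I_(m * m)}|)%N ->
  exists v : 'rV[R]_n, (forall j, 0 <= v 0 j <= eps) /\
  forall x, enorm x <= 1 -> (forall j, `|g j x + v 0 j| <= mi ^+ 2) ->
    enorm x <= 1 - mi /\ forall xi : 'rV[R]_n, mi * `|xi| <= `|xi *m h x|.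
Proof.
move=> card_key; apply: contrapT => H.
have bad (a : {ffun 'I_n -> 'I_(m * m)}) : exists k : Pkey,
    match k with inl k => near_sphere a k | inr k => near_singular a k end.
  apply: contrapT => Ha; apply: H.
  exists (\row_j (s * (a j)%:R)); split=> [j|x x1 gx].
    rewrite mxE mulr_ge0 ?(ltW s0) //= sE miE -mulrA ler_piMr ?(ltW eps0) //.
    rewrite exprVn -natrX mulrC ler_pdivrMr ?ltr0n ?expn_gt0 ?m0 // mul1r ler_nat.
    exact: (ltnW (ltn_ord (a j))).
  have nx : near a x by split=> // j; have := gx j; rewrite mxE.
  have x1i j : `|x 0 j| <= 1 by apply: le_trans (ler_coord_enorm _ _) x1.
  split.
    rewrite leNgt; apply/negP => ex; apply: Ha.
    have [i xi] := rV_norm_argmax x (ltn0Sn n').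
    have Hc (j : 'I_n') : exists c : 'I_(2 * m).+1, incell m c (x 0 (lift i j)) by exact: incell_ex.
    have [cl Hcl] := choice Hc.
    exists (inl (i, x 0 i < 0, finfun cl, [ffun j : 'I_n => Ordinal (ltn_pmod (a j) b0)])).
    exists x; split=> // [|j|j]; rewrite ?ffunE //.
    have -> : (-1) ^+ (x 0 i < 0)%R * x 0 i = `|x|.
      by rewrite -xi [RHS]normrEsign.
    have Np : 0 < N by apply: lt_le_trans N1.
    rewrite invfM -(ler_pM2l Np).
    have := enorm_le_norm x; rewrite -NE; apply: le_trans.
    rewrite mulrCA mulfV ?mulr1; last by rewrite gt_eqF.
    by apply: le_trans (ltW ex); have := mi2; lra.
  move=> xi; rewrite leNgt; apply/negP => hxi; apply: Ha.
  have [i xE] := rV_norm_argmax xi (ltn0Sn n').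
  have Hc j : exists c : 'I_(2 * m).+1, incell m c (x 0 j) by exact: incell_ex.
  have [cl Hcl] := choice Hc.
  exists (inr (finfun cl, i, [ffun j : 'I_n' => Ordinal (ltn_pmod (a (lift i j)) b0)],
     Ordinal (ltn_pmod (a i) c0))).
  exists x, xi; split=> // [|||].
  - exact: ltW.
  - split=> //; rewrite -(pmulr_rgt0 _ mi0).
    by apply: le_lt_trans hxi.
  - by move=> j; rewrite ffunE.
  - by split=> // j; rewrite ffunE.
have [key Hkey] := choice bad.
have inj : injective key.
  move=> a a' e; have := Hkey a; have := Hkey a'; rewrite -e.
  by case: (key a) => k p p'; [exact: near_sphere_inj p' p|exact: near_singular_inj p' p].
by have := leq_card key inj; rewrite leqNgt card_key.
Qed.

End Pigeonhole.

(** Keys of both kinds number O(m^(2n-1)) with total constant [Q] independent of [m], against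
    [m^(2n)] grid points; any [m > Q] works. *)
Lemma card_Pkey n' B1 c1 : exists2 m : nat, (1 < m)%N &
  (#|{: @Pkey n' c1 m (B1 * m)}| < #|{ffun 'I_n'.+1 -> 'I_(m * m)}|)%N.
Proof.
pose n := n'.+1.
pose Q := (2 * n * 3 ^ n' * B1 ^ n'.+1 + 3 ^ n'.+1 * n * B1 ^ n' * c1)%N.
pose m := Q.+2; exists m => //.
rewrite card_sum !card_prod !card_ffun !card_ord card_bool -/n.
have l3 : ((2 * m).+1 <= 3 * m)%N by rewrite [(3 * m)%N]mulSn addnC -addn1 leq_add.
have l4 p : ((2 * m).+1 ^ p <= 3 ^ p * m ^ p)%N.
  by case: p => // p; rewrite -expnMn leq_exp2r.
apply: (@leq_ltn_trans (Q * m ^ (n' + n'.+1))).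
  rewrite /Q mulnDl !expnMn expnD; apply: leq_add.
    apply: (@leq_trans (n * 2 * (3 ^ n' * m ^ n') * (B1 ^ n * m ^ n))).
      by rewrite leq_mul2r leq_mul2l l4 !orbT.
    by apply: eq_leq; rewrite /n; ring.
  apply: (@leq_trans ((3 ^ n * m ^ n) * n * (B1 ^ n' * m ^ n') * c1)).
    by rewrite !leq_mul2r l4 !orbT.
  by apply: eq_leq; rewrite /n; ring.
rewrite -[(m * m)%N]/(m ^ 2)%N -expnM.
have -> : (2 * n = (n' + n'.+1).+1)%N by rewrite /n mul2n -addnn addSn.
by rewrite expnS ltn_pmul2r ?expn_gt0 // /m ltnS leqnSn.
Qed.

Lemma good_linear_perturbation (R : realType) n (L eps : R) : (0 < n)%N -> 0 <= L -> 0 < eps ->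
  exists2 mi : R, 0 < mi <= 2^-1 & forall (g : 'I_n -> 'rV[R]_n -> R) (h : 'rV[R]_n -> 'M[R]_n),
  (forall x y j, enorm x <= 1 -> enorm y <= 1 -> `|g j y - g j x| <= L * `|y - x|) ->
  (forall x y j, enorm x <= 1 -> enorm y <= 1 ->
    `|g j y - g j x - ((y - x) *m h x) 0 j| <= L * `|y - x| ^+ 2) ->
  (forall x, enorm x <= 1 -> (h x)^T = h x) ->
  exists v : 'rV[R]_n, (forall j, 0 <= v 0 j <= eps) /\
  forall x, enorm x <= 1 -> (forall j, `|g j x + v 0 j| <= mi ^+ 2) ->
    enorm x <= 1 - mi /\ forall xi : 'rV[R]_n, mi * `|xi| <= `|xi *m h x|.
Proof.
case: n => // n' _ L0 eps0.
pose N : R := n'.+1%:R; pose D := N * (2 * N + 2).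
have N1 : 1 <= N by rewrite /N ler1n.
pose B1 := (Num.bound ((L * D + 2) / eps)).+1; pose c1 := (Num.bound (N * (L + 3) / eps)).+1.
have H1 : (L * D + 2) / eps < B1%:R.
  apply: lt_trans (archi_boundP _) _; last by rewrite ltr_nat.
  by rewrite divr_ge0 ?(ltW eps0) // addr_ge0 // mulr_ge0 // mulr_ge0 //; lra.
have H2 : N * (L + 3) / eps < c1%:R.
  apply: lt_trans (archi_boundP _) _; last by rewrite ltr_nat.
  by rewrite divr_ge0 ?(ltW eps0) // mulr_ge0 //; lra.
have [m m1 cm] := @card_Pkey n' B1 c1.
have m0 : (0 < m)%N by exact: ltnW.
exists m%:R^-1 => [|g h gL gT hS].
  by rewrite invr_gt0 ltr0n m0 lef_pV2 ?posrE ?ltr0n // (ler_nat R 2).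
apply: (@pigeonhole R n' L eps L0 eps0 N D m%:R^-1 (eps * m%:R^-1 ^+ 2) B1 c1 m (B1 * m)) => //.
by rewrite muln_gt0 m0.
Qed.

(** * Taylor polynomials and flat functions *)

Section Taylor.
Context {R : realType} {n : nat}.
Implicit Types (f g : 'rV[R]_n -> R) (x : 'rV[R]_n).

Lemma pdZ i (c : R) g x : differentiable g x -> pd i (fun y => c * g y) x = c * pd i g x.
Proof.
move=> dg; rewrite (@pdM _ _ i (fun=> c) g x (differentiable_cst _ _) dg) pd_cst.
by rewrite mul0r add0r.
Qed.



(* The homogeneous component of degree m of the Taylor polynomial, by Euler's identity. *)
Fixpoint tay (x0 : 'rV[R]_n) (m : nat) g x : R :=
  match m with
  | 0 => g x0
  | m'.+1 => m'.+1%:R^-1 * \sum_i (x 0 i - x0 0 i) * tay x0 m' (pd i g) x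
  end.

Lemma tay_eq (U : set 'rV[R]_n) x0 m f g : open U -> U x0 -> (forall x, U x -> f x = g x) ->
  tay x0 m f = tay x0 m g.
Proof.
move=> oU Ux; elim: m f g => [|m IH] f g fg.
  by apply/funext => x /=; exact: fg.
apply/funext => x /=; congr (_ * _); apply: eq_bigr => i _.
by rewrite (IH (pd i f) (pd i g)) // => y Uy; exact: (pd_eq i oU fg Uy).
Qed.

Lemma differentiable_tay x0 m g x : differentiable (tay x0 m g) x.
Proof.
elim: m g => [|m IH] g; first exact: differentiable_cst.
apply: differentiableM; first exact: differentiable_cst.
apply: (@differentiable_sumr _ _ _ _ _ (fun i y => (y 0 i - x0 0 i) * tay x0 m (pd i g) y)).
by move=> i _; apply: differentiableM; [exact: differentiable_coordB|exact: IH].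
Qed.

Lemma tay_center x0 m g : tay x0 m.+1 g x0 = 0.
Proof. by rewrite /= big1 ?mulr0 // => i _; rewrite subrr mul0r. Qed.

Lemma classC_schwarz (U : set 'rV[R]_n) g i j x : open U -> classC 2 U g -> U x ->
  pd i (pd j g) x = pd j (pd i g) x.
Proof.
move=> oU [dg cg] Ux; refine (@schwarz R n g U i j x oU Ux dg _ _).
  by move=> l y Uy; have [d _] := cg (delta_mx 0 l); exact: d.
by move=> l m; have [_ H] := cg (delta_mx 0 m); exact: (H (delta_mx 0 l) x Ux).
Qed.

Lemma pd_coordM (a : 'rV[R]_n) i j g x : differentiable g x ->
  pd j (fun y => (y 0 i - a 0 i) * g y) x = (j == i)%:R * g x + (x 0 i - a 0 i) * pd j g x.
Proof.
move=> dg; rewrite (@pdM _ _ j (fun y => y 0 i - a 0 i)) ?pd_coordB //.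
exact: differentiable_coordB.
Qed.

(** The product rule in the recursion gives the component of [pd j g] once directly and, by
    Schwarz's theorem and induction, [m + 1] more times; the total [m + 2] cancels the
    denominator. *)
Lemma pd_tay (U : set 'rV[R]_n) x0 m g j x : open U -> U x0 -> classC m.+1 U g ->
  pd j (tay x0 m.+1 g) x = tay x0 m (pd j g) x.
Proof.
move=> oU Ux0; elim: m g => [|m IH] g cg.
  rewrite (_ : tay x0 1 g = fun x => 1%:R^-1 * \sum_i (x 0 i - x0 0 i) * pd i g x0) //.
  have dF i : differentiable (fun y : 'rV[R]_n => (y 0 i - x0 0 i) * pd i g x0) x.
    by apply: differentiableM; [exact: differentiable_coordB|exact: differentiable_cst].
  rewrite pdZ; last first.
    by apply: (@differentiable_sumr _ _ _ _ _ (fun i y => (y 0 i - x0 0 i) * pd i g x0)).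
  rewrite (@pd_sum _ _ _ _ _ (fun i y => (y 0 i - x0 0 i) * pd i g x0)) //.
  have E i : pd j (fun y => (y 0 i - x0 0 i) * pd i g x0) x = (j == i)%:R * pd i g x0.
    by rewrite (@pd_coordM x0 i j (fun=> pd i g x0)) ?pd_cst ?mulr0 ?addr0.
  rewrite (eq_bigr _ (fun i _ => E i)) invr1 mul1r (bigD1 j) //= big1 => [|i ij].
    by rewrite eqxx mul1r addr0.
  by rewrite eq_sym (negbTE ij) mul0r.
have dF i : differentiable (fun y : 'rV[R]_n => (y 0 i - x0 0 i) * tay x0 m.+1 (pd i g) y) x.
  by apply: differentiableM; [exact: differentiable_coordB|exact: differentiable_tay].
rewrite (_ : tay x0 m.+2 g = fun x => m.+2%:R^-1 *
   \sum_i (x 0 i - x0 0 i) * tay x0 m.+1 (pd i g) x) //.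
rewrite pdZ; last first.
  by apply: (@differentiable_sumr _ _ _ _ _ (fun i y => (y 0 i - x0 0 i) * tay x0 m.+1 (pd i g) y)).
rewrite (@pd_sum _ _ _ _ _ (fun i y => (y 0 i - x0 0 i) * tay x0 m.+1 (pd i g) y)) //.
have E i : pd j (fun y => (y 0 i - x0 0 i) * tay x0 m.+1 (pd i g) y) x =
    (j == i)%:R * tay x0 m.+1 (pd i g) x + (x 0 i - x0 0 i) * tay x0 m (pd i (pd j g)) x.
  rewrite pd_coordM; last exact: differentiable_tay.
  rewrite IH; last exact: (pd_classC i cg).
  have E2 : tay x0 m (pd j (pd i g)) = tay x0 m (pd i (pd j g)).
    apply: (tay_eq _ oU Ux0) => y Uy; apply: (classC_schwarz _ _ oU _ Uy).
    by apply: classC_leq cg.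
  apply: (f_equal2 +%R erefl); apply: (f_equal2 *%R erefl).
  exact: (congr1 (@^~ x) E2).
have m1 : m.+1%:R != 0 :> R by rewrite pnatr_eq0.
have m2 : m.+2%:R != 0 :> R by rewrite pnatr_eq0.
have [F FE] : exists F : 'I_n -> R, forall i, F i = tay x0 m.+1 (pd i g) x by eexists.
have [G GE] : exists G : 'I_n -> R, forall i, G i = tay x0 m (pd i (pd j g)) x by eexists.
have FG : F j = m.+1%:R^-1 * \sum_i (x 0 i - x0 0 i) * G i.
  by rewrite FE /=; apply: (f_equal2 *%R erefl); apply: eq_bigr => i _; rewrite GE.
have -> : tay x0 m.+1 (pd j g) x = F j by rewrite FE.
have {}E i : pd j (fun y => (y 0 i - x0 0 i) * tay x0 m.+1 (pd i g) y) x =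
    (j == i)%:R * F i + (x 0 i - x0 0 i) * G i by rewrite FE GE; exact: E.
rewrite (eq_bigr _ (fun i _ => E i)) big_split /= (bigD1 j) //= big1 => [|i ij]; last first.
  by rewrite eq_sym (negbTE ij) mul0r.
rewrite eqxx mul1r addr0; apply: (mulfI m2); rewrite mulrA mulfV // mul1r.
have -> : \sum_i (x 0 i - x0 0 i) * G i = m.+1%:R * F j by rewrite FG mulrA mulfV // mul1r.
by rewrite -[m.+2%:R]natr1 mulrDl mul1r addrC.
Qed.

Definition taylor x0 k g x := \sum_(m < k.+1) tay x0 m g x.

Lemma taylor_center x0 k g : taylor x0 k g x0 = g x0.
Proof.
by rewrite /taylor big_ord_recl big1 ?addr0 // => i _; rewrite lift0 tay_center.
Qed.

Lemma differentiable_taylor x0 k g x : differentiable (taylor x0 k g) x.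
Proof.
apply: (@differentiable_sumr _ _ _ _ _ (fun (m : 'I_k.+1) y => tay x0 m g y)).
by move=> i _; exact: differentiable_tay.
Qed.

Lemma pd_taylor (U : set 'rV[R]_n) x0 k g j x : open U -> U x0 -> classC k.+1 U g ->
  pd j (taylor x0 k.+1 g) x = taylor x0 k (pd j g) x.
Proof.
move=> oU Ux0 cg.
rewrite (@pd_sum _ _ _ _ _ (fun (m : 'I_k.+2) y => tay x0 m g y)); last first.
  by move=> i _; exact: differentiable_tay.
rewrite big_ord_recl (_ : tay x0 (@ord0 k.+1) g = fun=> g x0) // pd_cst add0r.
apply: eq_bigr => i _; rewrite lift0 (pd_tay _ _ oU Ux0) //.
by apply: classC_leq cg; exact: ltn_ord.
Qed.

End Taylor.

Section FlatFunctions.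
Context {R : realType} {n : nat}.

(** The centre is removed because [|x - x0|] serves as a length scale and must be positive. *)
Definition punct (x0 : 'rV[R]_n) (r : R) := eball x0 r `\ x0.

Lemma open_punct x0 r : open (punct x0 r).
Proof.
rewrite openE => x [/ball_sub_eball[d d0 Hd] /eqP xx0].
have x0' : 0 < `|x - x0| by rewrite normr_gt0 subr_eq0.
apply/nbhs_ballP; exists (Num.min d `|x - x0|) => /=; first by rewrite lt_min d0.
move=> y; rewrite -ball_normE /= lt_min distrC => /andP[yd yx]; split.
  by apply: Hd; exact: ltW.
by move=> yx0; move: yx; rewrite yx0 distrC ltxx.
Qed.

Lemma punct_gt0 x0 r x : punct x0 r x -> 0 < `|x - x0|.
Proof. by move=> [_ /eqP xx0]; rewrite normr_gt0 subr_eq0. Qed.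

Section Family.
Context {T : Type}.
Variables (x0 : T -> 'rV[R]_n) (tau e : T -> R).
Hypothesis tau0 : forall t, 0 < tau t.
Let B t := eball (x0 t) (tau t).
Let U t := punct (x0 t) (tau t).
Let w t x := `|x - x0 t|.
Hypothesis e0 : forall t, 0 <= e t.

Lemma flat_primitive (h : T -> 'rV[R]_n -> R) k :
  (forall t x, B t x -> differentiable (h t) x) -> (forall t, h t (x0 t) = 0) ->
  (forall t i, pd i (h t) (x0 t) = 0) ->
  (forall i, fbound U (fun t x => e t * w t x ^+ k) (fun t => pd i (h t))) ->
  fbound U (fun t x => e t * w t x ^+ k.+1) h.
Proof.
move=> dh h0 ph0 Hb.
have /choice[C HC] : forall i, exists C : R, 0 <= C /\
    forall t x, U t x -> `|pd i (h t) x| <= C * (e t * w t x ^+ k).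
  move=> i; have [|C C0 HC] := fbound_ge0 (Hb i); last by exists C.
  by move=> t x _; rewrite mulr_ge0 // exprn_ge0 // normr_ge0.
exists (n%:R * \sum_i C i) => t x Ux.
(* On this set the bound on the derivatives is at most its value at [x]; at the centre, which the
   bound does not cover, they vanish by assumption. *)
pose D := B t `&` [set z | `|z - x0 t| <= w t x].
have := @lipschitz_pd R n (h t) D ((\sum_i C i) * (e t * w t x ^+ k)) (x0 t) x.
rewrite h0 subr0 => H.
suff : n%:R * ((\sum_i C i) * (e t * w t x ^+ k)) * `|x - x0 t| <=
    n%:R * (\sum_i C i) * (e t * w t x ^+ k.+1).
  apply: le_trans; apply: H.
- move=> s s01; split.
    by apply: eball_convex => //; [exact: eball_center|case: Ux].
  rewrite /= addrAC subrr add0r normrZ; move: s01 => /andP[s0 s1].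
  by rewrite (ger0_norm s0) ler_piMl.
- by move=> z [Bz _]; exact: dh.
- move=> i z [Bz zw]; have [->|/eqP zx0] := eqVneq z (x0 t).
    rewrite ph0 normr0 !mulr_ge0 ?sumr_ge0 // => [j _|]; first by have [] := HC j.
    by rewrite exprn_ge0 // normr_ge0.
  apply: le_trans ((HC i).2 t z _) _; first by split.
  apply: ler_pM => //.
  - by have [] := HC i.
  - by rewrite mulr_ge0 // exprn_ge0 // normr_ge0.
  - by rewrite (bigD1 i) //= lerDl sumr_ge0 // => j _; have [] := HC j.
  - by apply: ler_wpM2l => //; apply: lerXn2r; rewrite ?nnegrE ?normr_ge0.
by rewrite -!mulrA exprSr.

Qed.

(** Derivatives of Taylor polynomials are Taylor polynomials of derivatives, so the claim descends
    to order [k], where it is the oscillation bound [e]; [flat_primitive] integrates it back. No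
    derivative of order [k + 1] enters. *)
Lemma taylor_flat k (g : T -> 'rV[R]_n -> R) : (forall t, classC k (B t) (g t)) ->
  (forall s : seq 'I_n, size s = k -> forall t x, B t x ->
     `|iterpd s (g t) x - iterpd s (g t) (x0 t)| <= e t) ->
  Fl k U w (fun t x => e t * w t x ^+ k) (fun t x => g t x - taylor (x0 t) k (g t) x).
Proof.
have BU t x : U t x -> B t x by case.
have Bx0 t : B t (x0 t) by exact: eball_center.
have oB t : open (B t) by exact: open_eball.
have oU t : open (U t) by exact: open_punct.
elim: k g => [|k IH] g cg Hg.
  split.
    exists 1 => t x Ux; rewrite /taylor big_ord_recl big_ord0 addr0 /= expr0 mulr1 mul1r.
    by apply: (Hg [::]) => //; exact: BU.
  move=> t x Ux; apply: continuousB; first by apply: (cg t); exact: BU.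
  exact: differentiable_continuous (differentiable_taylor _ _ _ _).
have dg t x : B t x -> differentiable (g t) x by move=> Bx; have [d _] := cg t; exact: d.
have pdE t i x : B t x -> pd i (fun y => g t y - taylor (x0 t) k.+1 (g t) y) x =
    pd i (g t) x - taylor (x0 t) k (pd i (g t)) x.
  move=> Bx; rewrite pdB; [|exact: dg|exact: differentiable_taylor].
  by rewrite (pd_taylor _ _ (oB t) (Bx0 t)).
have FH i : Fl k U w (fun t x => e t * w t x ^+ k)
    (fun t x => pd i (g t) x - taylor (x0 t) k (pd i (g t)) x).
  apply: IH => [t|s sk t x Bx]; first exact: pd_classC (cg t).
  by rewrite -!iterpd_rcons; apply: Hg => //; rewrite size_rcons sk.
split.
  apply: (@flat_primitive (fun t x => g t x - taylor (x0 t) k.+1 (g t) x)).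
  - move=> t x Bx; apply: differentiableB; first exact: dg.
    exact: differentiable_taylor.
  - by move=> t; rewrite taylor_center subrr.
  - by move=> t i; rewrite pdE // taylor_center subrr.
  - move=> i; have [C HC] := Fl_bound (FH i); exists C => t x Ux.
    by rewrite pdE; [exact: HC|exact: BU].
split=> [t x Ux|i].
  apply: differentiableB; first by apply: dg; exact: BU.
  exact: differentiable_taylor.
apply: (@Fl_eq _ _ _ _ oU _ _ _ _ _ _ _ _ (FH i)) => t x Ux.
  by rewrite pdE //; exact: BU.
by rewrite exprSr mulrA mulfK // gt_eqF // (punct_gt0 Ux).
Qed.

End Family.

Lemma Fl_iterpd_w (T : Type) (U : T -> set 'rV[R]_n) (rho w f : T -> 'rV[R]_n -> R) j :
  (forall t x, U t x -> 0 < rho t x) -> (forall t x, U t x -> 0 <= w t x) ->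
  Fl j U rho w f -> exists2 C : R, 0 < C & forall s : seq 'I_n, (size s <= j)%N ->
     forall t x, U t x -> `|iterpd s (f t) x| <= C * (w t x / rho t x ^+ size s).
Proof.
move=> rho0; elim: j w f => [|j IH] w f w0 Hf; have [C C0 HC] := fbound_ge0 (Fl_bound Hf) w0.
  exists (C + 1) => [|s]; first by rewrite ltr_wpDl.
  rewrite leqn0 size_eq0 => /eqP-> t x Ux; rewrite expr0 divr1.
  by apply: le_trans (HC t x Ux) _; rewrite ler_wpM2r ?w0 // lerDl.
have H i : exists D : R, 0 < D /\ forall s : seq 'I_n, (size s <= j)%N ->
     forall t x, U t x -> `|iterpd s (pd i (f t)) x| <= D * (w t x / rho t x / rho t x ^+ size s).
  have := IH _ _ _ (Fl_pd i Hf); case=> [t x Ux|D D0 HD]; last by exists D.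
  by rewrite divr_ge0 ?w0 // ltW // rho0.
have [D HD] := choice H.
have D0 i : 0 <= D i by rewrite ltW // (HD i).1.
exists (C + 1 + \sum_i D i) => [|s].
  by rewrite ltr_wpDr ?sumr_ge0 // ltr_wpDl.
case/lastP: s => [_|s i] /=.
  move=> t x Ux; rewrite expr0 divr1; apply: le_trans (HC t x Ux) _.
  by rewrite ler_wpM2r ?w0 // -addrA lerDl addr_ge0 // sumr_ge0.
rewrite size_rcons ltnS => sj t x Ux; rewrite iterpd_rcons.
apply: le_trans ((HD i).2 s sj t x Ux) _.
have -> : w t x / rho t x / rho t x ^+ size s = w t x / rho t x ^+ (size s).+1.
  by rewrite exprS invfM mulrA.
rewrite ler_wpM2r //.
  by rewrite divr_ge0 ?w0 // exprn_ge0 // ltW // rho0.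
by rewrite (bigD1 i) //= addrCA lerDl !addr_ge0 // sumr_ge0.
Qed.

(** A removable singularity: the decay of [u] makes its first derivatives exist and vanish at [x0],
    and these satisfy the same hypothesis with [j] lowered by one. *)
Lemma flat_extension j (u : 'rV[R]_n -> R) x0 r : u x0 = 0 -> classC j (punct x0 r) u ->
  (forall e : R, 0 < e -> exists2 d : R, 0 < d & forall s : seq 'I_n, (size s <= j)%N ->
     forall x, 0 < `|x - x0| -> `|x - x0| < d -> `|iterpd s u x| <= e * `|x - x0| ^+ (j - size s)) ->
  classC j (eball x0 r) u /\ forall s : seq 'I_n, (size s <= j)%N -> iterpd s u x0 = 0.
Proof.
elim: j u => [|j IH] u ux0 cu Hu.
  split=> [x Bx|s]; last by rewrite leqn0 size_eq0 => /eqP->.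
  have [->|/eqP xx0] := eqVneq x x0; last by apply: cu; split.
  apply/continuous_eps => e e0; have [d d0 Hd] := Hu e e0; exists d => // y yx.
  have [->|yx0] := eqVneq y x0; first by rewrite subrr normr0 ltW.
  have y0 : 0 < `|y - x0| by rewrite normr_gt0 subr_eq0.
  by have := Hd [::] isT y y0 yx; rewrite ux0 subr0 expr0 mulr1.
have [du0 pu0] : differentiable u x0 /\ forall i, pd i u x0 = 0.
  apply: eps_pd => e e0; have [d d0 Hd] := Hu e e0.
  exists (Num.min d 1) => [|h]; first by rewrite lt_min d0 ltr01.
  rewrite lt_min => /andP[hd h1]; rewrite ux0 subr0 big1 ?subr0 => [|i _]; last by rewrite mulr0.
  have [->|hn0] := eqVneq h 0; first by rewrite add0r ux0 normr0 mulr_ge0 // ltW.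
  have := Hd [::] isT (h + x0); rewrite addrK => /(_ _ hd) H.
  apply: le_trans (H _) _; first by rewrite normr_gt0.
  rewrite subn0 ler_pM2l // exprS ler_piMr //.
  by apply: exprn_ile1 => //; exact: ltW.
have Hi i := IH (pd i u) (pu0 i) (pd_classC i cu) _.
have {}Hi i : classC j (eball x0 r) (pd i u) /\
    forall s : seq 'I_n, (size s <= j)%N -> iterpd s (pd i u) x0 = 0.
  apply: (Hi _ i) => {}i e /Hu[d d0 Hd]; exists d => // s sj x x1 x2.
  rewrite -iterpd_rcons; have := Hd (rcons s i) _ x x1 x2.
  by rewrite size_rcons subSS; exact.
split.
  apply: classC_pd => [|x Bx|i]; [exact: open_eball| |by have [] := Hi i].
  have [->//|/eqP xx0] := eqVneq x x0.
  by have [d _] := cu; apply: d; split.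
case/lastP => [//|s i]; rewrite size_rcons ltnS iterpd_rcons => sj.
by have [_] := Hi i; exact.
Qed.

End FlatFunctions.

(** * Morse coordinates *)

Arguments tay : simpl never.

(** One coefficient at a time: as [S.[0] = 1], adding [c X^(N+1)] to [S] changes the lowest
    coefficient of the error by [2 c], and [c = - T.[0] / 2] cancels it. A polynomial can be
    evaluated at any matrix without questions of convergence. *)
Lemma sqrt_poly (R : realType) N : exists S T : {poly R}, S ^+ 2 = 1 + 'X + 'X^(N.+1) * T /\ S.[0] = 1.
Proof.
elim: N => [|N [S [T [e S0]]]].
  by exists 1, (- 1); rewrite hornerC; split=> //; rewrite expr1n expr1; ring.
have [c cE] : exists c : R, T.[0] = - (2 * c) by exists (- T.[0] / 2); field.
have /factor_theorem[T' TE] : root (T + (2 * c)%:P * S) 0.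
  by rewrite rootE !hornerE S0 cE; apply/eqP; ring.
exists (S + c%:P * 'X^(N.+1)), (T' + (c ^+ 2)%:P * 'X^N).
split; last by rewrite !hornerE S0 exprS mul0r mulr0 addr0.
rewrite sqrrD e exprMn -exprM.
have -> : S * (c%:P * 'X^(N.+1)) *+ 2 = 'X^(N.+1) * ((2 * c)%:P * S).
  by rewrite -mulr_natl polyCM polyC_natr; ring.
have -> : 1 + 'X + 'X^(N.+1) * T + 'X^(N.+1) * ((2 * c)%:P * S) + c%:P ^+ 2 * 'X^(N.+1 * 2) =
   1 + 'X + 'X^(N.+1) * (T + (2 * c)%:P * S) + c%:P ^+ 2 * 'X^(N.+1 * 2) by ring.
rewrite TE subr0 polyC_exp.
have -> : (N.+1 * 2 = N.+2 + N)%N by rewrite muln2 -addnn addSn addnS addSn.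
by rewrite exprD !exprSr; ring.
Qed.

(** * Families of matrix-valued functions *)

Section MatrixFamilies.
Context {R : realType} {n' : nat} {T : Type}.
Local Notation n := n'.+1.
Variables (x0 : T -> 'rV[R]_n) (U : T -> set 'rV[R]_n) (rho w : T -> 'rV[R]_n -> R).
Hypothesis oU : forall t, open (U t).
Hypothesis rho0 : forall t x, U t x -> 0 < rho t x.
Hypothesis w01 : forall t x, U t x -> 0 <= w t x <= 1.
Hypothesis yF : forall j i, Fl j U rho w (fun t x => x 0 i - x0 t 0 i).

Definition FlMx j (v : T -> 'rV[R]_n -> R) a b (A : T -> 'rV[R]_n -> 'M[R]_(a, b)) :=
  forall i l, Fl j U rho v (fun t x => A t x i l).

Let one : T -> 'rV[R]_n -> R := fun _ _ => 1.
Let w0 t x : U t x -> 0 <= w t x. Proof. by move=> /w01/andP[]. Qed.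

Lemma FlMx_mul j v1 v2 a b c (A : T -> 'rV[R]_n -> 'M[R]_(a, b)) (B : T -> 'rV[R]_n -> 'M[R]_(b, c)) :
  FlMx j v1 A -> FlMx j v2 B -> FlMx j (fun t x => v1 t x * v2 t x) (fun t x => A t x *m B t x).
Proof.
move=> HA HB i l.
apply: (Fl_eqf oU (f := fun t x => \sum_s A t x i s * B t x s l)).
  by move=> t x _; rewrite mxE.
by apply: (Fl_sum oU) => s _; apply: (FlM oU).
Qed.

Lemma FlMx_mul1 j v a b c (A : T -> 'rV[R]_n -> 'M[R]_(a, b)) (B : T -> 'rV[R]_n -> 'M[R]_(b, c)) :
  FlMx j v A -> FlMx j one B -> FlMx j v (fun t x => A t x *m B t x).
Proof.
move=> HA HB i l; have := FlMx_mul HA HB i l.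
by apply: (Fl_eq oU) => // t x _; rewrite mulr1.
Qed.

Lemma FlMx_add j v a b (A B : T -> 'rV[R]_n -> 'M[R]_(a, b)) :
  FlMx j v A -> FlMx j v B -> FlMx j v (fun t x => A t x + B t x).
Proof.
move=> HA HB i l; apply: (Fl_eqf oU (f := fun t x => A t x i l + B t x i l)).
  by move=> t x _; rewrite mxE.
exact: (FlD oU).
Qed.

Lemma FlMx_cst j a b (A : T -> 'M[R]_(a, b)) :
  (exists C : R, forall t i l, `|A t i l| <= C) -> FlMx j one (fun t _ => A t).
Proof.
move=> [C HC] i l; apply: (@Fl_cst _ _ _ _ oU _ _ _ (fun t => A t i l)).
by exists C => t x _; rewrite mulr1.
Qed.

Lemma FlMx_mono j v v' a b (A : T -> 'rV[R]_n -> 'M[R]_(a, b)) :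
  (forall t x, U t x -> 0 <= v t x <= v' t x) -> FlMx j v A -> FlMx j v' A.
Proof.
move=> vv HA i l; apply: (Fl_mono rho0 _ _ (HA i l)) => [t x /vv/andP[]//|].
by exists 1 => t x /vv/andP[_]; rewrite mul1r.
Qed.

Lemma FlMx_eq j v v' a b (A B : T -> 'rV[R]_n -> 'M[R]_(a, b)) :
  (forall t x, U t x -> A t x = B t x) -> (forall t x, U t x -> v t x = v' t x) ->
  FlMx j v A -> FlMx j v' B.
Proof.
move=> AB vv HA i l; apply: (Fl_eq oU _ _ (HA i l)) => t x Ux; last exact: vv.
by rewrite AB.
Qed.

Lemma Fl_dot j v1 v2 (p q : T -> 'rV[R]_n -> 'rV[R]_n) : FlMx j v1 p -> FlMx j v2 q ->
  Fl j U rho (fun t x => v1 t x * v2 t x) (fun t x => dot (p t x) (q t x)).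
Proof. by move=> Hp Hq; apply: (Fl_sum oU) => s _; apply: (FlM oU). Qed.

Lemma FlMx_horner j (A : T -> 'rV[R]_n -> 'M[R]_n) (p : {poly R}) : FlMx j w A ->
  FlMx j one (fun t x => horner_mx (A t x) p).
Proof.
move=> HA; have HA1 : FlMx j one A by apply: FlMx_mono HA.
elim/poly_ind: p => [|p c IH].
  apply: (@FlMx_eq _ one _ _ _ (fun _ _ => 0)) => // [t x _|]; first by rewrite rmorph0.
  by apply: (@FlMx_cst _ _ _ (fun _ => 0)); exists 0 => t i l; rewrite mxE normr0.
apply: (@FlMx_eq _ one _ _ _ (fun t x => horner_mx (A t x) p *m A t x + c%:M)) => //.
  by move=> t x _; rewrite rmorphD rmorphM /= horner_mx_X horner_mx_C.
apply: FlMx_add; first exact: FlMx_mul1.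
apply: (@FlMx_cst _ _ _ (fun _ => c%:M)); exists `|c| => t i l.
by rewrite mxE; case: (i == l); rewrite ?mulr1n // mulr0n normr0.
Qed.

Lemma FlMx_exp j (A : T -> 'rV[R]_n -> 'M[R]_n) m : FlMx j w A ->
  FlMx j (fun t x => w t x ^+ m) (fun t x => A t x ^+ m).
Proof.
move=> HA; elim: m => [|m IH].
  apply: (@FlMx_eq _ one _ _ _ (fun _ _ => 1%:M)) => //.
  apply: (@FlMx_cst _ _ _ (fun _ => 1%:M)); exists 1 => t i l.
  by rewrite mxE normr_nat; case: (i == l).
apply: (FlMx_eq _ _ (FlMx_mul HA IH)) => t x _; first by rewrite exprS mulmxE.
by rewrite exprS.
Qed.

Lemma Fl_tay j m (g : T -> 'rV[R]_n -> R) :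
  (forall s : seq 'I_n, size s = m -> exists C : R, forall t, `|iterpd s (g t) (x0 t)| <= C) ->
  Fl j U rho (fun t x => w t x ^+ m) (fun t => tay (x0 t) m (g t)).
Proof.
elim: m g => [|m IH] g Hg.
  have [C HC] := Hg [::] erefl.
  apply: (@Fl_cst _ _ _ _ oU _ _ _ (fun t => g t (x0 t))).
  by exists C => t x _; rewrite expr0 mulr1; exact: HC.
apply: (Fl_eqf oU (f := fun t x => m.+1%:R^-1 *
   \sum_i (x 0 i - x0 t 0 i) * tay (x0 t) m (pd i (g t)) x)) => //.
apply: (FlZ oU); apply: (Fl_sum oU) => i _.
have H : Fl j U rho (fun t x => w t x ^+ m) (fun t => tay (x0 t) m (pd i (g t))).
  apply: IH => s sm; have [C HC] := Hg (rcons s i) (etrans (size_rcons _ _) (congr1 S sm)).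
  by exists C => t; rewrite -iterpd_rcons.
by apply: (Fl_eq oU _ _ (FlM oU (yF j i) H)) => // t x _; rewrite exprS.
Qed.

End MatrixFamilies.

(** * The explicit Morse map at a critical point *)

Section MorseFunctions.
Context {R : realType} {n' : nat}.
Local Notation n := n'.+1.
Variables (k : nat) (S T : {poly R}).
Hypothesis ST : S ^+ 2 = 1 + 'X + 'X^(k.+1) * T.
Hypothesis S0 : S.[0] = 1.
Variables (f : 'rV[R]_n -> R) (x0 : 'rV[R]_n).

(* Put [y = x - x0] and [H = hess]. The Taylor polynomial of [f] of order [k + 2] at a critical
   point is [f x0 + y A y^T / 2] with [A = mA x], and [E = A H^-1 - 1] vanishes at [x0]. The
   polynomial [S] is a truncated square root of [1 + 'X], so for [R = S(E)] and [p = y R] the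
   forms [p H p^T] and [y A y^T] agree up to order [k + 3]. The remaining error [g] is absorbed
   by [phi = p + s z] with [z = p H]: the equation [phi H phi^T / 2 = f x - f x0] amounts to
   [s + b s^2 = a] with [a = g / |z|^2] and [b = z H z^T / (2 |z|^2)]. *)
Definition hess : 'M[R]_n := \matrix_(i, j) pd i (pd j f) x0.

(** The recursion of [tay], unfolded twice, puts [1 / ((m + 1) (m + 2))] before the component of
    degree [m + 2]; the 2 compensates the half in [y A y^T / 2]. *)
Definition mA x : 'M[R]_n := \matrix_(l, j)
  \sum_(m < k.+1) (2 / (m.+1%:R * m.+2%:R)) * tay x0 m (pd j (pd l f)) x.

Definition mE x := mA x *m invmx hess - 1%:M.
Definition mR x := horner_mx (mE x) S.
Definition mp x : 'rV[R]_n := (x - x0) *m mR x.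
Definition mz x : 'rV[R]_n := mp x *m hess.
Definition mg x : R := f x - f x0 - dot (mp x *m hess) (mp x) / 2.
Definition ma x : R := mg x / dot (mz x) (mz x).
Definition mb x : R := dot (mz x *m hess) (mz x) / 2 / dot (mz x) (mz x).
(** The root of [s + b s^2 = a] that is small with [a], written so as not to divide by [b], which
    may vanish. *)
Definition ms x : R := 2 * ma x * (1 + Num.sqrt (1 + 4 * (ma x * mb x)))^-1.
Definition mu x : 'rV[R]_n := ms x *: mz x.
Definition mphi x : 'rV[R]_n := mp x + mu x.

Lemma mp_center : mp x0 = 0.
Proof. by rewrite /mp subrr mul0mx. Qed.

Lemma mu_center : mu x0 = 0.
Proof. by rewrite /mu /mz mp_center mul0mx scaler0. Qed.

Variable U : set 'rV[R]_n.
Hypothesis (oU : open U) (Ux0 : U x0) (cf : classC k.+2 U f).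
Hypothesis uH : hess \in unitmx.

Lemma hess_sym : hess^T = hess.
Proof.
apply/matrixP => i j; rewrite !mxE; apply: (classC_schwarz _ _ oU _ Ux0).
exact: classC_leq cf.
Qed.

Lemma mA_sym x : (mA x)^T = mA x.
Proof.
apply/matrixP => i j; rewrite !mxE; apply: eq_bigr => m _.
apply: (f_equal2 *%R erefl).
have E : tay x0 m (pd i (pd j f)) = tay x0 m (pd j (pd i f)).
  apply: (tay_eq _ oU Ux0) => y Uy; apply: (classC_schwarz _ _ oU _ Uy).
  exact: classC_leq cf.
exact: (congr1 (@^~ x) E).
Qed.

Lemma mE_hess x : mE x *m hess = mA x - hess.
Proof. by rewrite mulmxBl mul1mx mulmxKV. Qed.

Lemma mE_hess_sym x : mE x *m hess = hess *m (mE x)^T.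
Proof.
have := congr1 trmx (mE_hess x); rewrite trmx_mul hess_sym => ->.
by rewrite mE_hess linearB /= mA_sym hess_sym.
Qed.

(** [E *m hess] is a difference of symmetric matrices, that is, [E] is self-adjoint for the form
    [hess], and so is every polynomial in [E]. This turns [R H R^T] into [S(E) ^ 2 H], to which the
    polynomial identity applies. *)
Lemma horner_hess_sym x (p : {poly R}) :
  horner_mx (mE x) p *m hess = hess *m (horner_mx (mE x) p)^T.
Proof.
elim/poly_ind: p => [|p c IH]; first by rewrite rmorph0 mul0mx trmx0 mulmx0.
have -> : horner_mx (mE x) (p * 'X + c%:P) = horner_mx (mE x) p *m mE x + c%:M.
  by rewrite rmorphD rmorphM /= horner_mx_X horner_mx_C.
have C : horner_mx (mE x) p *m mE x = mE x *m horner_mx (mE x) p.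
  have := congr1 (horner_mx (mE x)) (mulrC p 'X).
  by rewrite !rmorphM /= horner_mx_X.
rewrite {1}C mulmxDl -mulmxA IH mulmxA mE_hess_sym -mulmxA.
have -> : (horner_mx (mE x) p *m mE x + c%:M)^T = (mE x)^T *m (horner_mx (mE x) p)^T + c%:M.
  by rewrite -trmx_mul -[in RHS](tr_scalar_mx n c) -linearD.
by rewrite mulmxDr scalar_mxC.
Qed.

Lemma mR_hess x : mR x *m hess *m (mR x)^T =
  mA x + mE x ^+ k.+1 *m horner_mx (mE x) T *m hess.
Proof.
rewrite /mR -mulmxA -horner_hess_sym mulmxA.
have -> : horner_mx (mE x) S *m horner_mx (mE x) S =
    1%:M + mE x + mE x ^+ k.+1 *m horner_mx (mE x) T.
  have := congr1 (horner_mx (mE x)) ST.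
  by rewrite !rmorphD !rmorphM rmorph1 rmorphXn /= horner_mx_X => <-.
by rewrite 2!mulmxDl mul1mx mE_hess [hess + _]addrC subrK.
Qed.

Lemma dot_trmx (u v : 'rV[R]_n) (M : 'M[R]_n) : dot (u *m M) v = dot u (v *m M^T).
Proof.
rewrite dot_mulmxl; apply: eq_bigr => i _; congr (_ * _).
by rewrite mxE; apply: eq_bigr => j _; rewrite !mxE mulrC.
Qed.

Lemma quad_mp x : dot (mp x *m hess) (mp x) = dot ((x - x0) *m mA x) (x - x0) +
  dot ((x - x0) *m (mE x ^+ k.+1 *m horner_mx (mE x) T *m hess)) (x - x0).
Proof.
rewrite -dotDl -mulmxDr -mR_hess /mp -[in RHS]mulmxA.
by rewrite !mulmxA [RHS]dot_trmx trmxK.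
Qed.

Lemma taylor_quad x : taylor x0 k.+2 f x =
  f x0 + \sum_i (x 0 i - x0 0 i) * pd i f x0 + dot ((x - x0) *m mA x) (x - x0) / 2.
Proof.
rewrite /taylor big_ord_recl big_ord_recl addrA; apply: (f_equal2 +%R).
  apply: (f_equal2 +%R erefl); rewrite lift0 /tay /= invr1 mul1r.
  by [].
rewrite dot_mulmxl mulr_suml.
transitivity (\sum_(m < k.+1) \sum_l (x 0 l - x0 0 l) * \sum_j (x 0 j - x0 0 j) *
   (m.+2%:R^-1 * m.+1%:R^-1 * tay x0 m (pd j (pd l f)) x)).
  apply: eq_bigr => m _; rewrite !lift0.
  rewrite -[LHS]/(m.+2%:R^-1 * \sum_l (x 0 l - x0 0 l) * (m.+1%:R^-1 * \sum_j (x 0 j - x0 0 j) *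
     tay x0 m (pd j (pd l f)) x)).
  rewrite mulr_sumr; apply: eq_bigr => l _; rewrite mulrCA; apply: (f_equal2 *%R erefl).
  rewrite mulrA mulr_sumr; apply: eq_bigr => j _.
  by rewrite mulrCA.
rewrite exchange_big; apply: eq_bigr => l _ /=.
have yE i : (x - x0) 0 i = x 0 i - x0 0 i by rewrite !mxE.
rewrite -mulr_sumr -mulrA yE; apply: (f_equal2 *%R erefl).
rewrite exchange_big /dot mulr_suml; apply: eq_bigr => j _.
rewrite -mulr_sumr yE [RHS]mulrAC [RHS]mulrC; apply: (f_equal2 *%R erefl).
rewrite [row _ _ _ _]mxE mxE mulr_suml.
apply: eq_bigr => m _; rewrite [RHS]mulrAC; apply: (f_equal2 *%R _ erefl).
have m1 : m.+1%:R != 0 :> R by rewrite pnatr_eq0.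
have m2 : m.+2%:R != 0 :> R by rewrite pnatr_eq0.
by move: (m.+1%:R : R) (m.+2%:R : R) m1 m2 => a b a0 b0; field; rewrite a0 b0.
Qed.

Lemma morse_identity x : dot (mz x) (mz x) != 0 -> 0 <= 1 + 4 * (ma x * mb x) ->
  dot (mphi x *m hess) (mphi x) / 2 = f x - f x0.
Proof.
move=> r0 D0; rewrite /mphi mulmxDl !(dotDl, dotDr).
have zE : mp x *m hess = mz x by [].
rewrite zE /mu -scalemxAl !(dotZl, dotZr).
rewrite (dot_sym hess_sym (mz x) (mp x)) zE.
set r := dot (mz x) (mz x) in r0 *.
have gE : mg x = ma x * r by rewrite /ma mulfVK.
have qE : dot (mz x *m hess) (mz x) = 2 * (mb x * r) by rewrite /mb -/r; field.
have fE : f x - f x0 = mg x + dot (mz x) (mp x) / 2 by rewrite /mg subrK.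
rewrite fE gE qE.
set q := Num.sqrt (1 + 4 * (ma x * mb x)).
have q0 : 0 <= q by exact: sqrtr_ge0.
have q2 : q ^+ 2 = 1 + 4 * (ma x * mb x) by rewrite sqr_sqrtr.
have q1 : 1 + q != 0 by rewrite gt_eqF // ltr_wpDr.
have sE : ms x + mb x * ms x ^+ 2 = ma x.
  rewrite /ms -/q.
  have -> : 2 * ma x * (1 + q)^-1 + mb x * (2 * ma x * (1 + q)^-1) ^+ 2 =
     ma x * (2 * (1 + q) + 4 * (ma x * mb x)) / (1 + q) ^+ 2 by field.
  have -> : 4 * (ma x * mb x) = q ^+ 2 - 1 by rewrite q2; ring.
  by field.
rewrite -{1}sE; move: (ms x) (mb x) (dot (mz x) (mp x)) => s b zp; by field.
Qed.

End MorseFunctions.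

Lemma classC_iterpd (R : realType) n j (U : set 'rV[R]_n) (f : 'rV[R]_n -> R) (s : seq 'I_n) :
  (size s <= j)%N -> classC j U f -> classC (j - size s) U (iterpd s f).
Proof.
elim/last_ind: s j f => [|s i IH] j f; first by rewrite subn0.
rewrite size_rcons iterpd_rcons; case: j => // j sj cf.
by rewrite subSS; apply: IH; last exact: pd_classC.
Qed.

(** * Uniform estimates for the Morse map *)

Section MorseData.
Context {R : realType} {n' : nat}.
Local Notation n := n'.+1.

(** [tau] is a radius and [e] bounds the oscillation of the top derivatives. By [tau <= e], errors
    of order [|x - x0|^(k+3)] count as [e |x - x0|^(k+2)]; [e <= Eb] keeps the constants uniform
    while [e] itself may be made small. *)
Definition morse_data (k : nat) (K gam Eb : R) (f : 'rV[R]_n -> R) (x0 : 'rV[R]_n) (tau e : R) :=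
  [/\ 0 < tau <= 1, tau <= e <= Eb, classC k.+2 (eball x0 tau) f,
    forall i, pd i f x0 = 0 & forall xi : 'rV[R]_n, gam * `|xi| <= `|xi *m hess f x0|] /\
  (forall s : seq 'I_n, (1 < size s <= k.+2)%N -> `|iterpd s f x0| <= K) /\
  (forall s : seq 'I_n, size s = k.+2 -> forall x, eball x0 tau x ->
     `|iterpd s f x - iterpd s f x0| <= e).

Lemma lower_bound_unit (H : 'M[R]_n) (gam : R) : 0 < gam ->
  (forall xi : 'rV[R]_n, gam * `|xi| <= `|xi *m H|) -> H \in unitmx.
Proof.
move=> g0 Hg; rewrite unitmxE unitfE; apply/negP => /det0P[v v0 e].
have := Hg v; rewrite e normr0 pmulr_rle0 // normr_le0 => /eqP vz.
by rewrite vz eqxx in v0.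
Qed.

Lemma lower_bound_inv (H : 'M[R]_n) (gam : R) i j : 0 < gam ->
  (forall xi : 'rV[R]_n, gam * `|xi| <= `|xi *m H|) -> `|invmx H i j| <= gam^-1.
Proof.
move=> g0 Hg; have uH := lower_bound_unit g0 Hg.
have := Hg (delta_mx 0 i *m invmx H); rewrite mulmxKV // => h.
have <- : (delta_mx (0 : 'I_1) i *m invmx H) 0 j = invmx H i j by rewrite -rowE mxE.
apply: le_trans (ler_coord_norm _ _) _.
rewrite -(ler_pM2l g0) mulfV ?gt_eqF //; apply: le_trans h _.
by apply: rV_norm_le => // l; rewrite mxE normr_nat; case: (_ && _).
Qed.

Lemma Fl_coordB (T : Type) (U : T -> set 'rV[R]_n) (rho w : T -> 'rV[R]_n -> R)
    (a : T -> 'rV[R]_n) j i : (forall t, open (U t)) ->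
  fbound U w (fun t x => x 0 i - a t 0 i) ->
  (exists C : R, forall t x, U t x -> 1 <= C * (w t x / rho t x)) ->
  Fl j U rho w (fun t x => x 0 i - a t 0 i).
Proof.
move=> oU b1 [C HC]; case: j => [|j]; split=> //.
  by move=> t x _; exact: differentiable_continuous (differentiable_coordB _ _ _).
split=> [t x _|l]; first exact: differentiable_coordB.
apply: (@Fl_eqf _ _ _ _ oU _ _ _ (fun _ _ => (l == i)%:R)).
  by move=> t x _; rewrite pd_coordB.
apply: (@Fl_cst _ _ _ _ oU _ _ _ (fun _ => (l == i)%:R)); exists C => t x Ux.
by apply: le_trans (HC t x Ux); rewrite normr_nat lern1 leq_b1.
Qed.

Section Family.
Context {T : Type}.
Variables (k : nat) (S TT : {poly R}) (K gam Eb : R).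
Hypothesis ST : S ^+ 2 = 1 + 'X + 'X^(k.+1) * TT.
Hypothesis S0 : S.[0] = 1.
Hypothesis g0 : 0 < gam.
Variables (f : T -> 'rV[R]_n -> R) (x0 : T -> 'rV[R]_n) (tau e : T -> R).
Hypothesis hG : forall t, morse_data k K gam Eb (f t) (x0 t) (tau t) (e t).

Let one : T -> 'rV[R]_n -> R := fun _ _ => 1.
Let H t := hess (f t) (x0 t).
Let oB t : open (eball (x0 t) (tau t)). Proof. exact: open_eball. Qed.
Let tau0 t : 0 < tau t. Proof. by have [[/andP[]]] := hG t. Qed.
Let Bx0 t : eball (x0 t) (tau t) (x0 t). Proof. exact: eball_center. Qed.
Let cf t : classC k.+2 (eball (x0 t) (tau t)) (f t). Proof. by have [[]] := hG t. Qed.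
Let uH t : H t \in unitmx.
Proof. by apply: (lower_bound_unit g0); have [[]] := hG t. Qed.
Let symH t : (H t)^T = H t. Proof. exact: (hess_sym (@oB t) (@Bx0 t) (@cf t)). Qed.

(** * Ingredients of the Morse map for arbitrary weights *)

Section Frame.
Variables (U : T -> set 'rV[R]_n) (rho w : T -> 'rV[R]_n -> R).
Hypothesis oU : forall t, open (U t).
Hypothesis rho0 : forall t x, U t x -> 0 < rho t x.
Hypothesis w01 : forall t x, U t x -> 0 <= w t x <= 1.
Hypothesis yF : forall j i, Fl j U rho w (fun t x => x 0 i - x0 t 0 i).

Let FlMx := @FlMx R n' T U rho.

Lemma FlMx_hess j : FlMx j one (fun t _ => H t).
Proof.
apply: FlMx_cst => //; exists K => t i l; rewrite mxE.
by have [_ [HK _]] := hG t; apply: (HK [:: i; l]).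
Qed.

Lemma FlMx_invhess j : FlMx j one (fun t _ => invmx (H t)).
Proof.
apply: FlMx_cst => //; exists gam^-1 => t i l.
by apply: lower_bound_inv => //; have [[]] := hG t.
Qed.

Lemma FlMx_y j : FlMx j w (fun t x => x - x0 t).
Proof.
move=> i l; apply: (Fl_eqf oU _ (yF j l)) => t x _.
by rewrite ord1 !mxE.
Qed.

Lemma FlMx_mE j : FlMx j w (fun t => mE k (f t) (x0 t)).
Proof.
have HAH : FlMx j w (fun t x => mA k (f t) (x0 t) x - H t).
  move=> l i.
  (* The terms of degree 0 in [mA] form [hess], up to the order of the two derivatives, and cancel;
     what remains vanishes at the centre. *)
  apply: (Fl_eqf oU (f := fun t x => \sum_(m < k) (2 / (m.+2%:R * m.+3%:R)) *
     tay (x0 t) m.+1 (pd i (pd l (f t))) x)).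
    move=> t x _; rewrite !mxE big_ord_recl.
    rewrite (_ : 2 / (_ * _) = 1); last by rewrite mul1r mulfV.
    rewrite mul1r (_ : tay (x0 t) (@ord0 k) (pd i (pd l (f t))) x = pd i (pd l (f t)) (x0 t)) //.
    rewrite (classC_schwarz i l (@oB t) (classC_leq _ (@cf t)) (@Bx0 t)) //.
    by rewrite addrAC subrr add0r; apply: eq_bigr => m _; rewrite lift0.
  apply: (Fl_sum oU) => m _; apply: (FlZ oU).
  have Ht : Fl j U rho (fun t x => w t x ^+ m.+1) (fun t => tay (x0 t) m.+1 (pd i (pd l (f t)))).
    apply: (Fl_tay oU yF) => s sm; exists K => t.
    have [_ [HK _]] := hG t.
    have := HK (rcons (rcons s i) l); rewrite !iterpd_rcons !size_rcons sm; apply.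
    by rewrite /= !ltnS ltn_ord.
  apply: (Fl_mono rho0 _ _ Ht) => [t x /w01/andP[? _]|]; first exact: exprn_ge0.
  exists 1 => t x /w01/andP[? ?]; rewrite mul1r exprS ler_piMr //.
  exact: exprn_ile1.
apply: (FlMx_eq oU _ _ (FlMx_mul1 oU HAH (FlMx_invhess j))) => // t x _.
by rewrite mulmxBl mulmxV.
Qed.

Lemma FlMx_mR j : FlMx j one (fun t => mR k S (f t) (x0 t)).
Proof. exact: (FlMx_horner oU rho0 w01 S (FlMx_mE j)). Qed.

Lemma FlMx_mR1 j : FlMx j w (fun t x => mR k S (f t) (x0 t) x - 1%:M).
Proof.
have /factor_theorem[S' SE] : root (S - 1) 0 by rewrite rootE !hornerE S0 subrr.
apply: (FlMx_eq oU _ _ (FlMx_mul oU (FlMx_horner oU rho0 w01 S' (FlMx_mE j)) (FlMx_mE j))).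
  move=> t x _; have := congr1 (horner_mx (mE k (f t) (x0 t) x)) SE.
  by rewrite polyC0 subr0 rmorphB rmorph1 rmorphM /= horner_mx_X => ->.
by move=> t x _; rewrite mul1r.
Qed.

Lemma FlMx_mp j : FlMx j w (fun t => mp k S (f t) (x0 t)).
Proof. exact: (FlMx_mul1 oU (FlMx_y j) (FlMx_mR j)). Qed.

Lemma FlMx_mp_y j : FlMx j (fun t x => w t x * w t x)
  (fun t x => mp k S (f t) (x0 t) x - (x - x0 t)).
Proof.
apply: (FlMx_eq oU _ _ (FlMx_mul oU (FlMx_y j) (FlMx_mR1 j))) => // t x _.
by rewrite mulmxBr mulmx1.
Qed.

Lemma FlMx_mz j : FlMx j w (fun t => mz k S (f t) (x0 t)).
Proof. exact: (FlMx_mul1 oU (FlMx_mp j) (FlMx_hess j)). Qed.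

Lemma Fl_remainder j : Fl j U rho (fun t x => w t x ^+ k.+3)
  (fun t x => dot ((x - x0 t) *m (mE k (f t) (x0 t) x ^+ k.+1 *m
      horner_mx (mE k (f t) (x0 t) x) TT *m H t)) (x - x0 t)).
Proof.
have H1 := FlMx_mul1 oU (FlMx_mul1 oU (FlMx_exp oU k.+1 (FlMx_mE j))
   (FlMx_horner oU rho0 w01 TT (FlMx_mE j))) (FlMx_hess j).
apply: (Fl_eq oU _ _ (Fl_dot oU (FlMx_mul oU (FlMx_y j) H1) (FlMx_y j))) => // t x _.
by rewrite -exprS -exprSr.
Qed.

End Frame.

Let B t := eball (x0 t) (tau t).
Let U t := punct (x0 t) (tau t).
Let w t x := `|x - x0 t|.

Let oU t : open (U t). Proof. exact: open_punct. Qed.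
Let w0 t x : U t x -> 0 < w t x. Proof. exact: punct_gt0. Qed.
Let wtau t x : U t x -> w t x <= tau t.
Proof. by move=> [/eball_norm/ltW]. Qed.
Let w01 t x : U t x -> 0 <= w t x <= 1.
Proof.
move=> Ux; rewrite (ltW (w0 Ux)) /=; apply: le_trans (wtau Ux) _.
by have [[/andP[]]] := hG t.
Qed.
Let e_ge0 t : 0 <= e t.
Proof. by have [[/andP[t0 _] /andP[te _] _ _ _] _] := hG t; apply: le_trans te; exact: ltW. Qed.
Let e_Eb t : e t <= Eb. Proof. by have [[_ /andP[]]] := hG t. Qed.
Let tau_e t : tau t <= e t. Proof. by have [[_ /andP[]]] := hG t. Qed.

(** Here [|x - x0|] is both weight and length scale, so that a bound of order [|x - x0|^p] loses one
    power per derivative. *)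
Lemma punct_frame j i : Fl j U w w (fun t x => x 0 i - x0 t 0 i).
Proof.
apply: (Fl_coordB _ oU); exists 1 => t x Ux; rewrite mul1r.
  by have := ler_coord_norm (x - x0 t) i; rewrite !mxE.
by rewrite mulfV // gt_eqF // w0.
Qed.

(** With weight and scale 1 the centre is included; this gives plain bounds on [mp], which is
    polynomial in [x]. *)
Lemma ball_frame j i : Fl j B one one (fun t x => x 0 i - x0 t 0 i).
Proof.
apply: (Fl_coordB _ oB); exists 1 => t x Bx; rewrite mul1r; last by rewrite /one divr1.
have := ler_coord_norm (x - x0 t) i; rewrite !mxE => /le_trans; apply.
by apply: le_trans (ltW (eball_norm Bx)) _; have [[/andP[]]] := hG t.
Qed.

(** Two errors add up: the Taylor remainder, and the defect of the truncated square root, of order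
    [|x - x0|^(k+3)], which is absorbed because [|x - x0| <= tau <= e]. *)
Lemma Fl_mg : Fl k.+2 U w (fun t x => e t * w t x ^+ k.+2) (fun t => mg k S (f t) (x0 t)).
Proof.
have F1 : Fl k.+2 U w (fun t x => e t * w t x ^+ k.+2)
    (fun t x => f t x - taylor (x0 t) k.+2 (f t) x).
  apply: taylor_flat => // s sk t x Bx.
  by have [_ [_]] := hG t; apply.
have F2 : Fl k.+2 U w (fun t x => e t * w t x ^+ k.+2)
   (fun t x => dot ((x - x0 t) *m (mE k (f t) (x0 t) x ^+ k.+1 *m
      horner_mx (mE k (f t) (x0 t) x) TT *m H t)) (x - x0 t)).
  apply: (Fl_mono w0 _ _ (Fl_remainder oU w0 w01 punct_frame k.+2)).
    by move=> t x _; rewrite exprn_ge0 // normr_ge0.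
  exists 1 => t x Ux; rewrite mul1r exprS ler_wpM2r ?exprn_ge0 ?(ltW (w0 Ux)) //.
  exact: le_trans (wtau Ux) (tau_e t).
apply: (Fl_eqf oU _ (FlD oU F1 (FlZ oU (- 2^-1) F2))) => t x Ux.
rewrite /mg (quad_mp ST (@oB t) (@Bx0 t) (@cf t) (@uH t)) taylor_quad.
rewrite [\sum_i _]big1 ?addr0; last by move=> i _; have [[_ _ _ -> _] _] := hG t; rewrite mulr0.
by rewrite /H; move: (dot _ _) (dot _ _) => a b; field.
Qed.

Hypothesis S1 : forall t x, U t x -> `|mp k S (f t) (x0 t) x - (x - x0 t)| <= 2^-1 * `|x - x0 t|.

(** [S1] gives [|p| >= |y| / 2], and the Hessian expands by at least [gam]; this justifies dividing
    by the square of [z]. *)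
Lemma dot_mz_lower t x : U t x -> (gam / 2) ^+ 2 * (w t x * w t x) <=
  dot (mz k S (f t) (x0 t) x) (mz k S (f t) (x0 t) x).
Proof.
move=> Ux; set p := mp k S (f t) (x0 t) x; set z := mz k S (f t) (x0 t) x.
have pw : 2^-1 * w t x <= `|p|.
  have : w t x <= `|p| + `|p - (x - x0 t)|.
    by rewrite /w -{1}(subKr p (x - x0 t)); exact: ler_normB.
  have := S1 Ux; rewrite -/p -/(w t x); lra.
have zp : gam * `|p| <= `|z| by have [[_ _ _ _ Hg] _] := hG t; exact: Hg.
have zw : gam / 2 * w t x <= `|z|.
  by apply: le_trans zp; rewrite -mulrA ler_pM2l.
have [i zi] := rV_norm_argmax z (ltn0Sn n').
have zz : `|z| ^+ 2 <= dot z z.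
  rewrite -zi real_normK ?num_real // /dot (bigD1 i) //= -expr2 lerDl sumr_ge0 // => l _.
  by rewrite -expr2 sqr_ge0.
apply: le_trans zz; rewrite -expr2 -exprMn ler_pXn2r // nnegrE ?normr_ge0 //.
by rewrite mulr_ge0 ?(ltW (w0 Ux)) // divr_ge0 // ltW.
Qed.

Let r0 t x : U t x -> dot (mz k S (f t) (x0 t) x) (mz k S (f t) (x0 t) x) != 0.
Proof.
move=> Ux; rewrite gt_eqF //; apply: lt_le_trans (dot_mz_lower Ux).
by rewrite mulr_gt0 ?exprn_gt0 ?divr_gt0 // mulr_gt0 ?w0.
Qed.

Lemma Fl_rinv j : Fl j U w (fun t x => (w t x * w t x)^-1)
  (fun t x => (dot (mz k S (f t) (x0 t) x) (mz k S (f t) (x0 t) x))^-1).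
Proof.
have Hz := FlMx_mz oU w0 w01 punct_frame j.
apply: (FlV oU _ _ (Fl_dot oU Hz Hz)); first by move=> t x Ux; rewrite mulr_gt0 ?w0.
exists ((gam / 2) ^+ 2) => [|t x Ux]; first by rewrite exprn_gt0 // divr_gt0.
by apply: le_trans (dot_mz_lower Ux) _; exact: ler_norm.
Qed.

Lemma Fl_ma : Fl k.+2 U w (fun t x => e t * w t x ^+ k) (fun t => ma k S (f t) (x0 t)).
Proof.
apply: (Fl_eq oU _ _ (FlM oU Fl_mg (Fl_rinv k.+2))) => // t x Ux.
by have w1 := lt0r_neq0 (w0 Ux); rewrite !exprSr; field.
Qed.

Lemma Fl_mb j : Fl j U w one (fun t => mb k S (f t) (x0 t)).
Proof.
have Hz := FlMx_mz oU w0 w01 punct_frame j.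
have HH : FlMx U w j one (fun t _ => H t) by exact: FlMx_hess.
have H1 := FlM oU (FlZ oU 2^-1 (Fl_dot oU (FlMx_mul1 oU Hz HH) Hz)) (Fl_rinv j).
apply: (Fl_eq oU _ _ H1) => t x Ux; first by rewrite /mb [2^-1 * _]mulrC.
by rewrite mulfV // mulf_neq0 // gt_eqF // w0.
Qed.

Lemma Fl_ma_one : Fl k.+2 U w one (fun t => ma k S (f t) (x0 t)).
Proof.
apply: (Fl_mono w0 _ _ Fl_ma) => [t x Ux|].
  by rewrite mulr_ge0 // exprn_ge0 // ltW // w0.
exists Eb => t x Ux; rewrite /one mulr1 -[leRHS]mulr1.
have /andP[? ?] := w01 Ux.
by apply: ler_pM => //; [exact: exprn_ge0|exact: exprn_ile1].
Qed.

Hypothesis S2 : forall t x, U t x ->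
  `|4 * (ma k S (f t) (x0 t) x * mb k S (f t) (x0 t) x)| <= 3 / 4.

Let ab t x := 1 + 4 * (ma k S (f t) (x0 t) x * mb k S (f t) (x0 t) x).

Let ab_lower t x : U t x -> 4^-1 <= ab t x.
Proof. by move=> /S2; rewrite ler_norml /ab => /andP[? _]; lra. Qed.

(** Dividing [mg] by the square of [z] and multiplying by [z] costs one power of [|x - x0|]. The
    remaining power [k + 1] is the order up to which derivatives will extend continuously by 0 to
    the centre. *)
Lemma FlMx_mu : FlMx U w k.+2 (fun t x => e t * w t x ^+ k.+1) (fun t => mu k S (f t) (x0 t)).
Proof.
have H1 : Fl k.+2 U w one (fun _ _ => 1).
  by apply: (@Fl_cst _ _ _ _ oU _ _ _ (fun _ => 1)); exists 1 => t x _; rewrite normr1 mulr1.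
have Hab : Fl k.+2 U w one ab.
  apply: (FlD oU H1); apply: (FlZ oU); apply: (FlM1 oU Fl_ma_one); exact: Fl_mb.
have Hs : Fl k.+2 U w one (fun t x => Num.sqrt (ab t x)).
  have HV : Fl k.+2 U w one (fun t x => (Num.sqrt (ab t x))^-1).
    by apply: (Fl_Vsqrt oU _ Hab); exists 4^-1 => [|t x Ux]; [rewrite invr_gt0|exact: ab_lower].
  apply: (Fl_eqf oU _ (FlM1 oU Hab HV)) => t x Ux.
  have p0 : 0 < ab t x by apply: lt_le_trans (ab_lower Ux); rewrite invr_gt0.
  by rewrite -{1}(sqr_sqrtr (ltW p0)) expr2 mulfK // gt_eqF // sqrtr_gt0.
have Hq : Fl k.+2 U w one (fun t x => (1 + Num.sqrt (ab t x))^-1).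
  apply: (Fl_eq oU _ _ (FlV oU (w := one) _ _ (FlD oU H1 Hs))) => //.
  - by move=> t x _; rewrite /one invr1.
  - exists 1 => // t x Ux; rewrite mulr1; apply: le_trans (ler_norm _).
    by rewrite lerDl sqrtr_ge0.
have Hms : Fl k.+2 U w (fun t x => e t * w t x ^+ k) (fun t => ms k S (f t) (x0 t)).
  apply: (Fl_eqf oU _ (FlM1 oU Hq (FlZ oU 2 Fl_ma))) => t x Ux.
  by rewrite /ms mulrC.
move=> i l; have Hz := FlMx_mz oU w0 w01 punct_frame k.+2 i l.
apply: (Fl_eq oU _ _ (FlM oU Hms Hz)) => t x Ux; first by rewrite /mu [RHS]mxE.
by rewrite -mulrA -exprSr.
Qed.

Lemma mphi_quad t x : B t x ->
  dot (mphi k S (f t) (x0 t) x *m H t) (mphi k S (f t) (x0 t) x) / 2 = f t x - f t (x0 t).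
Proof.
move=> Bx; have [->|/eqP xx0] := eqVneq x (x0 t).
  by rewrite /mphi mp_center mu_center addr0 mul0mx /dot big1 ?mul0r ?subrr // => i _; rewrite mxE mul0r.
have Ux : U t x by split.
rewrite (morse_identity (@oB t) (@Bx0 t) (@cf t)) //; first exact: r0.
by apply: le_trans (ab_lower Ux); rewrite invr_ge0.
Qed.

End Family.

End MorseData.

(** * Charts of uniform size *)

Section Charts.
Context {R : realType} {n' : nat}.
Local Notation n := n'.+1.

Lemma FlMx_iterpd_w (T : Type) (U : T -> set 'rV[R]_n) (rho w : T -> 'rV[R]_n -> R) j b
    (A : T -> 'rV[R]_n -> 'rV[R]_b) :
  (forall t x, U t x -> 0 < rho t x) -> (forall t x, U t x -> 0 <= w t x) ->
  FlMx U rho j w A -> exists2 C : R, 0 < C & forall l (s : seq 'I_n), (size s <= j)%N ->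
     forall t x, U t x -> `|iterpd s (fun y => A t y 0 l) x| <= C * (w t x / rho t x ^+ size s).
Proof.
move=> rho0 w0 HA; have H l : exists C : R, 0 < C /\ forall s : seq 'I_n, (size s <= j)%N ->
     forall t x, U t x -> `|iterpd s (fun y => A t y 0 l) x| <= C * (w t x / rho t x ^+ size s).
  by have [C C0 HC] := Fl_iterpd_w rho0 w0 (HA 0 l); exists C.
have [C HC] := choice H.
have C0 l : 0 <= C l by apply: ltW; exact: (HC l).1.
exists (1 + \sum_l C l) => [|l s sj t x Ux]; first by rewrite ltr_pwDl // sumr_ge0.
apply: le_trans ((HC l).2 s sj t x Ux) _; rewrite ler_wpM2r //.
  by rewrite divr_ge0 ?w0 // exprn_ge0 // ltW // rho0.
by rewrite (bigD1 l) //= addrCA lerDl addr_ge0 // sumr_ge0.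
Qed.

Lemma FlMx_norm_bound (T : Type) (U : T -> set 'rV[R]_n) (rho w : T -> 'rV[R]_n -> R) j b
    (A : T -> 'rV[R]_n -> 'rV[R]_b) :
  (forall t x, U t x -> 0 < rho t x) -> (forall t x, U t x -> 0 <= w t x) ->
  FlMx U rho j w A -> exists2 C : R, 0 < C & forall t x, U t x -> `|A t x| <= C * w t x.
Proof.
move=> rho0 w0 /(FlMx_iterpd_w rho0 w0)[C C0 HC]; exists C => // t x Ux.
apply: rV_norm_le => [|l]; first by rewrite mulr_ge0 ?w0 // ltW.
by have := HC l [::] isT t x Ux; rewrite expr0 divr1.
Qed.

Lemma finite_min (F : finType) (d : F -> R) : (forall s, 0 < d s) ->
  exists2 d0 : R, 0 < d0 & forall s, d0 <= d s.
Proof.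
move=> d0; have P0 : 0 < 1 + \sum_s (d s)^-1.
  by rewrite ltr_pwDl // sumr_ge0 // => s _; rewrite invr_ge0 ltW.
exists (1 + \sum_s (d s)^-1)^-1 => [|s]; first by rewrite invr_gt0.
rewrite -[leRHS]invrK lef_pV2 ?posrE ?invr_gt0 // (bigD1 s) //= addrCA lerDl.
by rewrite addr_ge0 // sumr_ge0 // => l _; rewrite invr_ge0 ltW.
Qed.

(** Continuity of the top derivatives at [x0] makes their oscillation as small as desired on a
    smaller ball. The new radius depends on [f], so this serves regularity at the centre and not the
    uniform bounds. *)
Lemma morse_data_shrink k K gam Eb (f : 'rV[R]_n -> R) x0 tau e e' : morse_data k K gam Eb f x0 tau e ->
  0 < e' <= Eb -> exists2 tau', 0 < tau' <= tau & morse_data k K gam Eb f x0 tau' e'.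
Proof.
move=> [[/andP[t0 t1] te cf cr Hg] [HK He]] /andP[e0 eE].
have Bx0 : eball x0 tau x0 by exact: eball_center.
have H (s : k.+2.-tuple 'I_n) : exists d : R, 0 < d /\
    forall y, `|y - x0| < d -> `|iterpd s f y - iterpd s f x0| <= e'.
  have /classC_cont/(_ x0 Bx0)/continuous_eps/(_ e' e0)[d d0 Hd] :
    classC (k.+2 - size s) (eball x0 tau) (iterpd s f).
    by apply: classC_iterpd => //; rewrite size_tuple.
  by exists d.
have [d Hd] := choice H.
have [d0 d00 Hd0] := finite_min (fun s => (Hd s).1).
exists (Num.min tau (Num.min e' d0)); first by rewrite !lt_min t0 e0 d00 ge_min lexx.
split; first split=> //.
- by rewrite !lt_min t0 e0 d00 /= ge_min t1.
- by rewrite eE !ge_min lexx orbT.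
- by apply: classC_sub cf => x; rewrite /eball /= !lt_min => /andP[].
split=> // s sk x Bx.
have sk' : size s == k.+2 by rewrite sk.
apply: ((Hd (Tuple sk')).2 x); apply: lt_le_trans (Hd0 _).
by apply: lt_le_trans (eball_norm Bx) _; rewrite !ge_min lexx !orbT.
Qed.

Lemma Fl_coord (T : Type) (U : T -> set 'rV[R]_n) j i : (forall t, open (U t)) ->
  fbound U (fun _ _ => 1) (fun _ x => x 0 i) ->
  Fl j U (fun _ _ => 1) (fun _ _ => 1) (fun _ x => x 0 i).
Proof.
move=> oU [C HC]; apply: (Fl_eqf oU (f := fun _ x => x 0 i - (0 : 'rV[R]_n) 0 i)).
  by move=> t x _; rewrite mxE subr0.
apply: (@Fl_coordB _ _ _ _ _ _ (fun=> 0) _ _ oU).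
  by exists C => t x Ux; rewrite mxE subr0; exact: (HC t).
by exists 1 => t x Ux; rewrite mul1r divr1.
Qed.

Lemma coord_transf_mulmx m (U : set 'rV[R]_n) (phi psi : 'rV[R]_n -> 'rV[R]_n) (M : 'M[R]_n) :
  open U -> M \in unitmx ->
  (forall j, Fl m (fun _ : unit => U) (fun _ _ => 1) (fun _ _ => 1) (fun _ x => phi x 0 j)) ->
  (forall x, U x -> psi (phi x) = x) -> open (phi @` U) ->
  (forall j, Fl m (fun _ : unit => phi @` U) (fun _ _ => 1) (fun _ _ => 1) (fun _ y => psi y 0 j)) ->
  coord_transf m U (fun x => phi x *m M) (fun y => psi (y *m invmx M)).
Proof.
move=> oU uM Hphi psiK oV Hpsi.
have VE : (fun x => phi x *m M) @` U = (fun y => y *m invmx M) @^-1` (phi @` U).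
  apply/seteqP; split=> [y [x Ux <-]|y [x Ux xy]]; first by exists x => //=; rewrite mulmxK.
  by exists x => //; rewrite xy mulmxKV.
have cM : continuous (fun y : 'rV[R]_n => y *m invmx M).
  by move=> y; apply: continuous_rV => j; exact: coord_mulmx_continuous.
have oV' : open ((fun x => phi x *m M) @` U).
  by rewrite VE; apply: open_comp => // y _; exact: cM.
split=> //.
- have -> : (fun x => phi x *m M) = (fun x => \sum_i phi x 0 i *: row i M).
    by apply/funext => x; rewrite mulmx_sum_row.
  by apply: (classC_lincomb (f := fun i x => phi x 0 i)) => // i; exact: (Fl_classC _ (Hphi i) tt).
- have -> : (fun y => psi (y *m invmx M)) =
     (fun y => \sum_i psi (y *m invmx M) 0 i *: (delta_mx 0 i : 'rV[R]_n)).
    by apply/funext => y; rewrite -rV_sum_delta.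
  apply: (classC_lincomb (f := fun i y => psi (y *m invmx M) 0 i)) => // i.
  have oV1 (t : unit) : open ((fun x => phi x *m M) @` U) by [].
  apply: (Fl_classC oV1 (f := fun _ y => psi (y *m invmx M) 0 i) _ tt).
  apply: (Fl_comp oV1 _ (Hpsi i)) => [t y|l]; first by rewrite VE.
  apply: (Fl_eqf oV1 (f := fun _ y => \sum_s invmx M s l * y 0 s)).
    by move=> t y _; rewrite mxE; apply: eq_bigr => s _; rewrite mulrC.
  apply: (Fl_sum oV1) => s _; apply: (FlZ oV1); apply: (Fl_coord _ oV1).
  have [C HC] : exists C : 'I_n -> R, forall i x, U x -> `|phi x 0 i| <= C i.
    have H a : exists c : R, forall x, U x -> `|phi x 0 a| <= c.
      have [c Hc] := Fl_bound (Hphi a); exists c => x Ux.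
      by have := Hc tt x Ux; rewrite mulr1.
    by have [C HC] := choice H; exists C.
  exists (\sum_a C a * `|M a s|) => _ _ [x Ux <-]; rewrite mulr1 mxE.
  apply: le_trans (ler_norm_sum _ _ _) _; apply: ler_sum => a _.
  by rewrite normrM ler_wpM2r // HC.
- by move=> x Ux; rewrite mulmxK // psiK.
Qed.

Section Scales.
Variables (k : nat) (S TT : {poly R}) (K gam Eb : R).
Hypothesis ST : S ^+ 2 = 1 + 'X + 'X^(k.+1) * TT.
Hypothesis S0 : S.[0] = 1.
Hypothesis g0 : 0 < gam.
Hypothesis k0 : (0 < k)%N.
Hypothesis Eb0 : 0 < Eb.

Lemma mp_scale : exists2 tau1, 0 < tau1 & forall (f : 'rV[R]_n -> R) x0 tau e,
  morse_data k K gam Eb f x0 tau e -> tau <= tau1 -> forall x, punct x0 tau x ->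
  `|mp k S f x0 x - (x - x0)| <= 2^-1 * `|x - x0|.
Proof.
(* All admissible data form one family; its single constant is the uniform one. The radius
   [1 / (2 C)] then turns [C |x - x0|^2] into half of [|x - x0|]. *)
pose T := {p : ('rV[R]_n -> R) * 'rV[R]_n * R * R | morse_data k K gam Eb p.1.1.1 p.1.1.2 p.1.2 p.2}.
have hG (t : T) := svalP t.
have HF := FlMx_mp_y S0 g0 hG (fun t => @open_punct _ _ _ _) (fun t => @punct_gt0 _ _ _ _)
  _ (punct_frame (fun t : T => (sval t).1.1.2) (fun t => (sval t).1.2)) 0.
have w01 (t : T) x : punct (sval t).1.1.2 (sval t).1.2 x -> 0 <= `|x - (sval t).1.1.2| <= 1.
  move=> Ux; rewrite normr_ge0 /=; apply: le_trans (ltW (eball_norm Ux.1)) _.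
  by have [[/andP[]]] := hG t.
have [t x Ux|t x Ux|C C0 HC] := FlMx_norm_bound _ _ (HF w01).
- exact: punct_gt0 Ux.
- by rewrite mulr_ge0.
exists (2 * C)^-1 => [|f x0 tau e G tt x Ux]; first by rewrite invr_gt0 mulr_gt0.
apply: le_trans (HC (exist _ (f, x0, tau, e) G) x Ux) _ => /=.
rewrite mulrA ler_wpM2r //.
have -> : 2^-1 = C * (2 * C)^-1 by rewrite invfM mulrCA mulfV ?mulr1 // gt_eqF.
by rewrite ler_pM2l //; apply: le_trans tt; exact: ltW (eball_norm Ux.1).
Qed.

(** [ma] has weight [e |x - x0|^k] with [k > 0] and [mb] is bounded, so their product is small on a
    small ball although [e] is only known to be at most [Eb]. The bound 3/4 keeps the radicand at
    least 1/4. *)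
Lemma ab_scale : exists2 tau2, 0 < tau2 & forall (f : 'rV[R]_n -> R) x0 tau e,
  morse_data k K gam Eb f x0 tau e -> tau <= tau2 -> forall x, punct x0 tau x ->
  `|mp k S f x0 x - (x - x0)| <= 2^-1 * `|x - x0| /\
  `|4 * (ma k S f x0 x * mb k S f x0 x)| <= 3 / 4.
Proof.
have [tau1 t10 H1] := mp_scale.
pose T := {p : ('rV[R]_n -> R) * 'rV[R]_n * R * R |
  morse_data k K gam Eb p.1.1.1 p.1.1.2 p.1.2 p.2 /\ p.1.2 <= tau1}.
have hG (t : T) : morse_data k K gam Eb (sval t).1.1.1 (sval t).1.1.2 (sval t).1.2 (sval t).2.
  by have [] := svalP t.
have S1 (t : T) := H1 _ _ _ _ (svalP t).1 (svalP t).2.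
have [C HC] := Fl_bound (Fl_ma ST g0 hG S1).
have [D HD] := Fl_bound (Fl_mb g0 hG S1 0).
pose Q := 4 * (`|C| * Eb * `|D|) + 1.
have Q0 : 0 < Q by rewrite /Q ltr_wpDl // !mulr_ge0 // ltW.
exists (Num.min tau1 (3 / 4 / Q)) => [|f x0 tau e G tt x Ux].
  by rewrite lt_min t10 !divr_gt0.
have tt1 : tau <= tau1 by apply: le_trans tt _; rewrite ge_min lexx.
split; first exact: (H1 _ _ _ _ G).
have Ha := HC (exist _ (f, x0, tau, e) (conj G tt1)) x Ux.
have Hb := HD (exist _ (f, x0, tau, e) (conj G tt1)) x Ux.
rewrite /= mulr1 in Ha Hb.
have [[/andP[_ tl1] /andP[te eE] _ _ _] _] := G.
have wt : `|x - x0| <= tau by exact: ltW (eball_norm Ux.1).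
have Ha' : `|ma k S f x0 x| <= `|C| * (Eb * `|x - x0|).
  apply: le_trans Ha _; apply: le_trans (ler_norm _) _; rewrite normrM ler_wpM2l //.
  rewrite ger0_norm; last first.
    by rewrite mulr_ge0 ?exprn_ge0 //; apply: le_trans te; apply: le_trans wt.
  apply: ler_pM; rewrite ?exprn_ge0 //.
    by apply: le_trans te; apply: le_trans wt.
  by case: (k) k0 => // q _; rewrite exprS ler_piMr // exprn_ile1 // (le_trans wt).
have Hb' : `|mb k S f x0 x| <= `|D| by apply: le_trans Hb (ler_norm _).
move: (ma k S f x0 x) (mb k S f x0 x) Ha' Hb' {Ha Hb} => a b Ha' Hb'.
rewrite !normrM ger0_norm //.
apply: (@le_trans _ _ (Q * `|x - x0|)).
  apply: (@le_trans _ _ (4 * (`|C| * (Eb * `|x - x0|) * `|D|))).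
    by rewrite ler_pM2l //; apply: ler_pM.
  rewrite -subr_ge0 /Q (_ : _ - _ = `|x - x0|) //; by ring.
rewrite mulrC -ler_pdivlMr //; apply: le_trans wt (le_trans tt _).
by rewrite ge_min lexx orbT.
Qed.

Lemma mu_scale : exists2 C : R, 0 < C & exists2 tau2, 0 < tau2 &
  forall (f : 'rV[R]_n -> R) x0 tau e, morse_data k K gam Eb f x0 tau e -> tau <= tau2 ->
  (forall x, punct x0 tau x -> `|mp k S f x0 x - (x - x0)| <= 2^-1 * `|x - x0|) /\
  (forall x, punct x0 tau x -> `|4 * (ma k S f x0 x * mb k S f x0 x)| <= 3 / 4) /\
  forall l, classC k.+1 (punct x0 tau) (fun x => mu k S f x0 x 0 l) /\
    forall s : seq 'I_n, (size s <= k.+1)%N -> forall x, punct x0 tau x ->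
    `|iterpd s (fun y => mu k S f x0 y 0 l) x| <= C * (e * `|x - x0| ^+ (k.+1 - size s)).
Proof.
have [tau2 t20 H2] := ab_scale.
pose T := {p : ('rV[R]_n -> R) * 'rV[R]_n * R * R |
  morse_data k K gam Eb p.1.1.1 p.1.1.2 p.1.2 p.2 /\ p.1.2 <= tau2}.
have hG (t : T) : morse_data k K gam Eb (sval t).1.1.1 (sval t).1.1.2 (sval t).1.2 (sval t).2.
  by have [] := svalP t.
have S1 (t : T) x Ux := (H2 _ _ _ _ (svalP t).1 (svalP t).2 x Ux).1.
have S2 (t : T) x Ux := (H2 _ _ _ _ (svalP t).1 (svalP t).2 x Ux).2.
have HF := FlMx_mu ST g0 hG S1 S2.
have oU (t : T) : open (punct (sval t).1.1.2 (sval t).1.2) by exact: open_punct.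
have rho0 (t : T) x : punct (sval t).1.1.2 (sval t).1.2 x -> 0 < `|x - (sval t).1.1.2|.
  exact: punct_gt0.
have w0 (t : T) x : punct (sval t).1.1.2 (sval t).1.2 x ->
    0 <= (sval t).2 * `|x - (sval t).1.1.2| ^+ k.+1.
  move=> Ux; rewrite mulr_ge0 ?exprn_ge0 ?normr_ge0 //.
  by have [[/andP[t0 _] /andP[te _] _ _ _] _] := hG t; apply: le_trans te; exact: ltW.
have HF1 : FlMx (fun t : T => punct (sval t).1.1.2 (sval t).1.2) (fun t x => `|x - (sval t).1.1.2|)
    k.+1 _ _ := fun i l => FlW (HF i l).
have [C C0 HC] := FlMx_iterpd_w rho0 w0 HF1.
exists C => //; exists tau2 => // f x0 tau e G tt.
split; first by move=> x Ux; exact: (H2 _ _ _ _ G tt x Ux).1.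
split; first by move=> x Ux; exact: (H2 _ _ _ _ G tt x Ux).2.
move=> l; split; first exact: (Fl_classC oU (HF1 0 l) (exist _ (f, x0, tau, e) (conj G tt))).
move=> s sk x Ux.
have := HC l s sk (exist _ (f, x0, tau, e) (conj G tt)) x Ux.
have w1 : `|x - x0| != 0 by rewrite gt_eqF // (punct_gt0 Ux).
rewrite /= -mulrA -{1}(subnK sk) exprD mulfK //.
by rewrite expf_neq0.
Qed.

Lemma mu_extension : exists2 C : R, 0 < C & exists2 tau2, 0 < tau2 &
  forall (f : 'rV[R]_n -> R) x0 tau e, morse_data k K gam Eb f x0 tau e -> tau <= tau2 ->
  (forall x, punct x0 tau x -> `|mp k S f x0 x - (x - x0)| <= 2^-1 * `|x - x0|) /\
  (forall x, punct x0 tau x -> `|4 * (ma k S f x0 x * mb k S f x0 x)| <= 3 / 4) /\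
  forall l, classC k.+1 (eball x0 tau) (fun x => mu k S f x0 x 0 l) /\
    forall s : seq 'I_n, (size s <= k.+1)%N -> forall x, eball x0 tau x ->
    `|iterpd s (fun y => mu k S f x0 y 0 l) x| <= C * (e * `|x - x0| ^+ (k.+1 - size s)).
Proof.
have [C C0 [tau2 t20 H2]] := mu_scale.
exists C => //; exists tau2 => // f x0 tau e G tt.
have [S1 [S2 H]] := H2 _ _ _ _ G tt; split=> //; split=> // l.
have [cl Hl] := H l.
have [||cb z] := @flat_extension _ _ k.+1 (fun x => mu k S f x0 x 0 l) x0 tau _ cl.
- by rewrite mu_center mxE.
(* The same [C] is valid for the shrunken data, so the oscillation [d / C] turns the uniform bound
   into the little-o that [flat_extension] asks for. *)
- move=> d d0; have [|tau' /andP[t'0 t't] G'] := @morse_data_shrink _ _ _ _ _ _ _ _ (Num.min (d / C) Eb) G.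
    by rewrite lt_min Eb0 divr_gt0 //= ge_min lexx orbT.
  have [_ [_ /(_ l)[_ Hl']]] := H2 _ _ _ _ G' (le_trans t't tt).
  exists (tau' / n.+1%:R) => [|s sk x x1 x2]; first by rewrite divr_gt0.
  have Ux : punct x0 tau' x.
    split; first by apply: norm_eball; rewrite -ltr_pdivlMr.
    by move=> xx; rewrite xx subrr normr0 ltxx in x1.
  apply: le_trans (Hl' s sk x Ux) _; rewrite mulrA ler_wpM2r ?exprn_ge0 //.
  by rewrite mulrC -ler_pdivlMr // ge_min lexx.
split=> // s sk x Bx; have [->|/eqP xx0] := eqVneq x x0; last exact: Hl.
rewrite z // normr0 mulr_ge0 ?(ltW C0) // mulr_ge0 ?exprn_ge0 //.
by have [[/andP[t0 _] /andP[te _] _ _ _] _] := G; apply: le_trans te; exact: ltW.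
Qed.

(** [p - y] is of second order at the centre, so its first derivatives are O(|x - x0|);
    [flat_extension] with [j = 1] supplies their value 0 at the centre itself. *)
Lemma pd_mp_scale : exists2 C : R, 0 < C & forall (f : 'rV[R]_n -> R) x0 tau e,
  morse_data k K gam Eb f x0 tau e -> forall l i x, eball x0 tau x ->
  `|pd i (fun y => mp k S f x0 y 0 l - (y 0 l - x0 0 l)) x| <= C * `|x - x0|.
Proof.
pose T := {p : ('rV[R]_n -> R) * 'rV[R]_n * R * R | morse_data k K gam Eb p.1.1.1 p.1.1.2 p.1.2 p.2}.
have hG (t : T) := svalP t.
have oU (t : T) : open (punct (sval t).1.1.2 (sval t).1.2) by exact: open_punct.
have HF := FlMx_mp_y S0 g0 hG (fun t => @open_punct _ _ _ _) (fun t => @punct_gt0 _ _ _ _)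
  _ (punct_frame (fun t : T => (sval t).1.1.2) (fun t => (sval t).1.2)) 1.
have w01 (t : T) x : punct (sval t).1.1.2 (sval t).1.2 x -> 0 <= `|x - (sval t).1.1.2| <= 1.
  move=> Ux; rewrite normr_ge0 /=; apply: le_trans (ltW (eball_norm Ux.1)) _.
  by have [[/andP[]]] := hG t.
have rho0 (t : T) x : punct (sval t).1.1.2 (sval t).1.2 x -> 0 < `|x - (sval t).1.1.2|.
  exact: punct_gt0.
have w0 (t : T) x : punct (sval t).1.1.2 (sval t).1.2 x ->
    0 <= `|x - (sval t).1.1.2| * `|x - (sval t).1.1.2|.
  by move=> _; rewrite mulr_ge0.
have [C C0 HC] := FlMx_iterpd_w rho0 w0 (HF w01).
exists C => // f x0 tau e G l i x.
have uE : (fun y => mp k S f x0 y 0 l - (y 0 l - x0 0 l)) =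
    (fun y => (mp k S f x0 y - (y - x0)) 0 l).
  by apply/funext => y; rewrite !mxE.
rewrite uE.
have cl := Fl_classC oU (HF w01 0 l) (exist _ (f, x0, tau, e) G).
have bd s (s1 : (size s <= 1)%N) y (Uy : punct x0 tau y) :
    `|iterpd s (fun y => (mp k S f x0 y - (y - x0)) 0 l) y| <= C * `|y - x0| * `|y - x0| ^+ (1 - size s).
  have := HC l s s1 (exist _ (f, x0, tau, e) G) y Uy.
  rewrite /= -mulrA; case: s s1 => [|a []] //= _; first by rewrite invr1 mulr1.
  by rewrite expr1 expr0 mulr1 mulfK //; apply: lt0r_neq0; exact: punct_gt0 Uy.
have [||_ z] := @flat_extension _ _ 1 _ x0 tau _ cl.
- by rewrite mp_center !subrr mxE.
- move=> d d0; exists (Num.min (d / C) (tau / n.+1%:R)) => [|s s1 y y0].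
    rewrite lt_min !divr_gt0 //.
    by have [[/andP[]]] := G.
  rewrite lt_min => /andP[y1 y2].
  have Uy : punct x0 tau y.
    split; first by apply: norm_eball; rewrite -ltr_pdivlMr.
    by move=> xx; rewrite xx subrr normr0 ltxx in y0.
  apply: le_trans (bd s s1 y Uy) _; rewrite ler_wpM2r ?exprn_ge0 //.
  by rewrite mulrC -ler_pdivlMr // ltW.
have [->|/eqP xx0 Bx] := eqVneq x x0.
  by move=> _; have /= -> := z [:: i] isT; rewrite normr0 mulr_ge0 // ltW.
have := bd [:: i] isT x; rewrite subnn expr0 mulr1; apply.
by split.
Qed.

Lemma morse_chart : exists2 delta : R, 0 < delta & exists2 M : R, 0 < M &
  forall (f : 'rV[R]_n -> R) x0 tau e, morse_data k K gam Eb f x0 tau e -> tau <= delta ->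
  exists phi psi : 'rV[R]_n -> 'rV[R]_n, [/\ coord_transf k.+1 (eball x0 tau) phi psi,
    (exists (l : nat) (c : R), (l <= n)%N /\ forall y, (phi @` eball x0 tau) y ->
       f (psi y) = \sum_(i < n | (i < l)%N) y 0 i ^+ 2 - \sum_(i < n | (l <= i)%N) y 0 i ^+ 2 + c) &
    forall j (s : seq 'I_n), (size s <= k.+1)%N -> forall x, eball x0 tau x ->
      `|iterpd s (fun y => phi y 0 j) x| <= M].
Proof.
have [C C0 [tau2 t20 H2]] := mu_extension.
have [D D0 HD] := pd_mp_scale.
have Q0 : 0 < n%:R * (D + C * Eb) :> R by rewrite mulr_gt0 ?ltr0n // addr_gt0 // mulr_gt0.
(* On this scale [phi - id] has Lipschitz constant at most 1/2: [D] controls the derivatives of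
   [p - y] and [C * Eb] those of the displacement, both relative to [|x - x0|]. *)
pose delta := Num.min tau2 (2^-1 / (n%:R * (D + C * Eb))).
exists delta; first by rewrite lt_min t20 divr_gt0.
have dt2 : delta <= tau2 by rewrite ge_min lexx.
have dQ : n%:R * (D + C * Eb) * delta <= 2^-1.
  by rewrite mulrC -ler_pdivlMr // ge_min lexx orbT.
pose T := {p : ('rV[R]_n -> R) * 'rV[R]_n * R * R |
  morse_data k K gam Eb p.1.1.1 p.1.1.2 p.1.2 p.2 /\ p.1.2 <= delta}.
have [tf tfE] : exists tf : T -> 'rV[R]_n -> R, tf = fun t => (sval t).1.1.1 by eexists.
have [tx txE] : exists tx : T -> 'rV[R]_n, tx = fun t => (sval t).1.1.2 by eexists.
have [tt ttE] : exists tt : T -> R, tt = fun t => (sval t).1.2 by eexists.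
have [te teE] : exists te : T -> R, te = fun t => (sval t).2 by eexists.
have hG t : morse_data k K gam Eb (tf t) (tx t) (tt t) (te t).
  by rewrite tfE txE ttE teE; exact: (svalP t).1.
have hd t : tt t <= delta by rewrite ttE; exact: (svalP t).2.
have HH t := H2 _ _ _ _ (hG t) (le_trans (hd t) dt2).
have S1 t := (HH t).1.
have S2 t := (HH t).2.1.
pose B t := eball (tx t) (tt t).
have oB t : open (B t) by exact: open_eball.
have t01 t : 0 < tt t <= 1 by have [[]] := hG t.
have eE t : 0 <= te t <= Eb.
  have [[/andP[t0 _] /andP[et ->] _ _ _] _] := hG t; rewrite andbT.
  by apply: le_trans et; exact: ltW.
have w1 t x : B t x -> `|x - tx t| <= 1.
  by move=> Bx; apply: le_trans (ltW (eball_norm Bx)) _; have /andP[] := t01 t.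
have hp : FlMx B (fun _ _ => 1) k.+1 (fun _ _ => 1) (fun t => mp k S (tf t) (tx t)).
  apply: (FlMx_mp S g0 hG oB) => //; last exact: (ball_frame hG).
  by move=> t x _; rewrite ler01 lexx.
have hu : FlMx B (fun _ _ => 1) k.+1 (fun _ _ => 1) (fun t => mu k S (tf t) (tx t)).
  move=> a l; rewrite ord1; apply: classC_Fl => [t|s sk].
    by have [_ [_ /(_ l)[]]] := HH t.
  exists (C * Eb) => t x Bx; rewrite mulr1.
  have [_ [_ /(_ l)[_ Hs]]] := HH t; apply: le_trans (Hs s sk x Bx) _.
  rewrite ler_pM2l // -[leRHS]mulr1; have /andP[e0 eEb] := eE t.
  by apply: ler_pM; rewrite ?exprn_ge0 // exprn_ile1 // (w1 t).
have hphi := FlMx_add oB hp hu.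
have sy t : exists Cl : 'M[R]_n * nat, [/\ Cl.1 \in unitmx, (Cl.2 <= n)%N,
    forall i j, `|Cl.1 i j| <= n%:R * n%:R * K + 1 &
    forall z, dot (z *m hess (tf t) (tx t)) z / 2 = \sum_(i < n | (i < Cl.2)%N) (z *m Cl.1) 0 i ^+ 2
                             - \sum_(i < n | (Cl.2 <= i)%N) (z *m Cl.1) 0 i ^+ 2].
  have [[/andP[t0 _] _ cf _ Hg] [HK _]] := hG t.
  have [||i j|Cm [l [? ? ? ?]]] := @sylvester R n (hess (tf t) (tx t)) K.
  - by apply: (hess_sym (@oB t) _ cf); exact: eball_center.
  - exact: lower_bound_unit Hg.
  - by rewrite mxE; apply: (HK [:: i; j]).
  by exists (Cm, l).
have [Cl HCl] := choice sy.
have hC : FlMx B (fun _ _ => 1) k.+1 (fun _ _ => 1) (fun t _ => (Cl t).1).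
  apply: (FlMx_cst _ oB); exists (n%:R * n%:R * K + 1) => t i j.
  by have [_ _ ->] := HCl t.
have hall := FlMx_mul1 oB hphi hC.
have [M M0 HM] := FlMx_iterpd_w (fun _ _ _ => ltr01) (fun _ _ _ => ler01) hall.
exists M => // f x0 tau e G td.
have [t [<- <- <-]] : exists t, [/\ tf t = f, tx t = x0 & tt t = tau].
  by exists (exist _ (f, x0, tau, e) (conj G td)); rewrite tfE txE ttE.
have [uC ln _ HQ] := HCl t.
have rx : forall j, Fl k.+1 (fun _ : unit => B t) (fun _ _ => 1) (fun _ _ => 1)
    (fun _ x => mphi k S (tf t) (tx t) x 0 j).
  move=> j; have hh := hphi 0 j.
  exact: (@Fl_reindex _ _ _ _ (fun _ : unit => t) _ B (fun=> B t) _ _ _ (fun _ _ h => h) hh).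
have half x y : B t x -> B t y ->
    `|(mphi k S (tf t) (tx t) x - mphi k S (tf t) (tx t) y) - (x - y)| <= 2^-1 * `|x - y|.
  move=> Bx By; apply: rV_norm_le => [|j]; first by rewrite mulr_ge0.
  pose F z := (mp k S (tf t) (tx t) z 0 j - (z 0 j - tx t 0 j)) + mu k S (tf t) (tx t) z 0 j.
  have -> : ((mphi k S (tf t) (tx t) x - mphi k S (tf t) (tx t) y) - (x - y)) 0 j = F x - F y.
    by rewrite /F /mphi !mxE; ring.
  have dp z : B t z -> differentiable (fun z => mp k S (tf t) (tx t) z 0 j - (z 0 j - tx t 0 j)) z.
    by move=> Bz; apply: differentiableB;
      [exact: Fl_diff (hp 0 j) _ _ Bz|exact: differentiable_coordB].
  have du z : B t z -> differentiable (fun z => mu k S (tf t) (tx t) z 0 j) z.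
    by move=> Bz; exact: Fl_diff (hu 0 j) _ _ Bz.
  apply: (@le_trans _ _ (n%:R * ((D + C * Eb) * tt t) * `|x - y|)).
    apply: (@lipschitz_pd _ _ F (B t)) => [s s01|z Bz|i z Bz].
    - exact: eball_convex.
    - by apply: differentiableD; [exact: dp|exact: du].
    rewrite /F (pdD _ (dp z Bz) (du z Bz)); apply: le_trans (ler_normD _ _) _.
    have wz : `|z - tx t| <= tt t by exact: ltW (eball_norm Bz).
    rewrite mulrDl; apply: lerD.
      by apply: le_trans (HD _ _ _ _ (hG t) j i z Bz) _; rewrite ler_pM2l.
    have [_ [_ /(_ j)[_ Hs]]] := HH t; apply: le_trans (Hs [:: i] isT z Bz) _.
    rewrite -mulrA ler_pM2l // subSS subn0; have /andP[e0 eEb] := eE t.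
    apply: ler_pM; rewrite ?exprn_ge0 //.
    apply: le_trans wz; case: (k) k0 => // q _; rewrite exprS ler_piMr // exprn_ile1 //.
    exact: w1 Bz.
  rewrite ler_wpM2r //; apply: le_trans dQ; rewrite mulrA ler_pM2l //.
have bU : exists c : R, forall x, B t x -> `|x| <= c.
  exists (`|tx t| + 1) => x Bx; rewrite -(subrK (tx t) x) addrC.
  by apply: le_trans (ler_normD _ _) _; rewrite lerD2l; exact: w1.
have [psi [psiK oV Hpsi]] := near_identity_inverse (@oB t) bU half rx.
exists (fun x => mphi k S (tf t) (tx t) x *m (Cl t).1), (fun y => psi (y *m invmx (Cl t).1)).
split.
- exact: (coord_transf_mulmx (@oB t) uC rx psiK oV Hpsi).
- exists (Cl t).2, (tf t (tx t)); split=> // _ [x Bx <-].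
  rewrite mulmxK // psiK // -HQ (mphi_quad g0 hG S1 S2 Bx).
  by rewrite subrK.
- move=> j s sk x Bx; apply: le_trans (HM j s sk t x Bx) _.
  by rewrite expr1n divr1 mulr1.
Qed.

End Scales.

End Charts.

(** * Operator norms of derivatives *)

(* [iterD] alone denotes a lemma of [ssrnat]. *)
Local Notation iterD := Defs.iterD.

Section Multilinear.
Context {R : realType} {n : nat}.
Implicit Types (f : 'rV[R]_n -> R) (U : set 'rV[R]_n) (v : seq 'rV[R]_n) (s : seq 'I_n).

Lemma iterD_rcons (W : normedModType R) v u (f : 'rV[R]_n -> W) :
  iterD (rcons v u) f = iterD v ('D_u f).
Proof. exact: foldr_rcons. Qed.

Lemma classC_iterD (W : normedModType R) j U (f : 'rV[R]_n -> W) v :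
  (size v <= j)%N -> classC j U f -> classC (j - size v) U (iterD v f).
Proof.
elim/last_ind: v j f => [|v u IH] j f; first by rewrite subn0.
rewrite size_rcons iterD_rcons; case: j => // j vj [_ cf].
by rewrite subSS; apply: IH; last exact: cf.
Qed.

Lemma iterpd_iterD s f : iterpd s f = iterD [seq delta_mx 0 i | i <- s] f.
Proof. by rewrite /iterD foldr_map. Qed.

Lemma enorm_delta i : enorm (delta_mx 0 i : 'rV[R]_n) = 1.
Proof.
rewrite /enorm (bigD1 i) //= mxE !eqxx expr1n big1 ?addr0 ?sqrtr1 // => j ji.
by rewrite mxE (negPf ji) andbF expr0n.
Qed.

Lemma Dnorm_iterpd s f x (K : R) :
  (Dnorm (fun t : R => `|t|%R) (size s) f x <= K%:E)%E -> `|iterpd s f x| <= K.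
Proof.
move=> H; rewrite -lee_fin; apply: le_trans H; apply: ereal_sup_ubound.
exists (map_tuple (fun i => delta_mx 0 i) (in_tuple s)) => [i|].
  by rewrite tnth_map enorm_delta.
by rewrite iterpd_iterD.
Qed.

(** Multilinearity in coordinates. The coefficients do not depend on [x], so the identity can be
    differentiated in the induction; they are products of coordinates of size at most 1, whence the
    bound by the number of multi-indices. *)
Lemma iterD_expansion f U j v : open U -> classC j U f -> (size v <= j)%N ->
  (forall u, u \in v -> enorm u <= 1) ->
  exists L : seq (R * seq 'I_n), [/\ forall p, p \in L -> size p.2 = size v,
    \sum_(p <- L) `|p.1| <= n%:R ^+ size v &
    forall x, U x -> iterD v f x = \sum_(p <- L) p.1 * iterpd p.2 f x].
Proof.
move=> oU cf; elim: v => [|u v IH] vj v1.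
  exists [:: (1, [::])]; split=> [p|/=|x Ux]; first by rewrite inE => /eqP->.
    by rewrite big_seq1 normr1 expr0.
  by rewrite big_seq1 mul1r.
have [|w wv|L [sL bL eL]] := IH; [exact: ltnW|by apply: v1; rewrite inE wv orbT|].
have ds p x : p \in L -> U x -> differentiable (iterpd p.2 f) x.
  move=> pL Ux; have := @classC_iterpd _ _ _ _ _ p.2 _ cf; rewrite sL // => /(_ (ltnW vj)).
  by rewrite -subnSK // => -[+ _]; exact.
exists [seq (u 0 i * p.1, i :: p.2) | i <- index_enum 'I_n, p <- L]; split.
- by move=> p /allpairsP[[i q] /= [_ qL ->]] /=; rewrite sL.
- rewrite big_allpairs_dep exprS; apply: (@le_trans _ _ (\sum_(i < n) n%:R ^+ size v)); last first.
    by rewrite sumr_const card_ord mulr_natl.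
  apply: ler_sum => i _; apply: le_trans bL; apply: ler_sum => p _ /=.
  rewrite normrM ler_piMl //; apply: le_trans (ler_coord_enorm _ _) (v1 _ _).
  by rewrite inE eqxx.
move=> x Ux; have d1 : differentiable (iterD v f) x.
  have := classC_iterD (ltnW vj) cf; rewrite -subnSK // => -[+ _]; exact.
rewrite /= derive_pd // big_allpairs_dep; apply: eq_bigr => i _.
rewrite (pd_eq i oU eL Ux) big_seq.
transitivity (u 0 i * pd i (fun y => \sum_(p <- L | p \in L) p.1 * iterpd p.2 f y) x).
  by apply: (f_equal2 *%R erefl); apply: (pd_eq i oU _ Ux) => y _; rewrite big_seq.
rewrite pd_sum => [|p pL]; last by apply: differentiableM => //; exact: ds.
rewrite mulr_sumr; apply: eq_bigr => p pL /=.
by rewrite pdZ ?mulrA //; exact: ds.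
Qed.

Lemma iterD_bound f U j v (c : R) x : open U -> classC j U f -> (size v <= j)%N ->
  (forall u, u \in v -> enorm u <= 1) -> U x -> 0 <= c ->
  (forall s, size s = size v -> `|iterpd s f x| <= c) -> `|iterD v f x| <= n%:R ^+ size v * c.
Proof.
move=> oU cf vj v1 Ux c0 H; have [L [sL bL ->]] // := iterD_expansion oU cf vj v1.
apply: le_trans (ler_norm_sum _ _ _) _; apply: le_trans (ler_wpM2r c0 bL).
rewrite mulr_suml big_seq [leRHS]big_seq; apply: ler_sum => p pL.
by rewrite normrM ler_wpM2l // H // sL.
Qed.

Lemma iterD_coord m U j v (g : 'rV[R]_n -> 'rV[R]_m) l x : open U -> classC j U g ->
  (size v <= j)%N -> U x -> (iterD v g x) 0 l = iterD v (fun y => g y 0 l) x.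
Proof.
move=> oU cg; elim: v x => //= u v IH x vj Ux.
have dv : differentiable (iterD v g) x.
  have := classC_iterD (ltnW vj) cg; rewrite -subnSK // => -[+ _]; exact.
rewrite -derive_coord //.
have E y : U y -> iterD v g y 0 l = iterD v (fun y => g y 0 l) y by move=> Uy; exact: IH (ltnW vj) Uy.
have d1 := differentiable_coordf l dv.
have d2 := differentiable_eq oU E Ux d1.
rewrite !derive_pd //; apply: eq_bigr => i _.
by rewrite (pd_eq i oU E Ux).
Qed.

Lemma classC_coord m k U (g : 'rV[R]_n -> 'rV[R]_m) l : open U -> classC k U g ->
  classC k U (fun y => g y 0 l).
Proof.
move=> oU; elim: k g => [|k IH] g.
  by move=> cg x Ux; apply: (@continuous_comp _ _ _ g (fun y : 'rV[R]_m => y 0 l) x (cg x Ux));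
    exact: coord_continuous.
move=> [dg cg]; split=> [x Ux|v]; first exact: differentiable_coordf (dg x Ux).
apply: (classC_eq oU _ (IH _ (cg v))) => x Ux.
by rewrite derive_coord //; exact: dg.
Qed.

Lemma Cnorm_le (W : normedModType R) (nrm : W -> R) k (A : set 'rV[R]_n) (f : 'rV[R]_n -> W) c :
  (forall v x, (1 <= size v <= k)%N -> (forall u, u \in v -> enorm u <= 1) -> A x ->
     nrm (iterD v f x) <= c) -> (Cnorm nrm k A f <= (k%:R * c)%:E)%E.
Proof.
move=> H; apply: (@le_trans _ _ (\sum_(1 <= j < k.+1) c%:E)%E); last first.
  by rewrite sumEFin sumr_const_nat subn1 mulr_natl.
rewrite /Cnorm big_seq [leRHS]big_seq; apply: lee_sum => j; rewrite mem_index_iota => jk.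
apply: ge_ereal_sup => _ [x Ax <-]; apply: ge_ereal_sup => _ [v v1 <-].
rewrite lee_fin; apply: H => //; first by rewrite size_tuple.
by move=> u /tnthP[i ->]; exact: v1.
Qed.

End Multilinear.

Lemma Cnorm_scalar_le (R : realType) n' k (U A : set 'rV[R]_n'.+1) (f : 'rV[R]_n'.+1 -> R) (c : R) :
  open U -> A `<=` U -> classC k U f -> 0 <= c ->
  (forall s : seq 'I_n'.+1, (1 <= size s <= k)%N -> forall x, A x -> `|iterpd s f x| <= c) ->
  (Cnorm (fun t : R => `|t|%R) k A f <= (k%:R * (n'.+1%:R ^+ k * c))%:E)%E.
Proof.
move=> oU AU cf c0 H; apply: Cnorm_le => v x /andP[v0 vk] v1 Ax.
apply: le_trans (iterD_bound oU cf vk v1 (AU _ Ax) c0 _) _.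
  by move=> s sv; apply: H => //; rewrite sv v0.
by rewrite ler_wpM2r // ler_weXn2l // ler1n.
Qed.

Lemma Cnorm_vector_le (R : realType) n' m k (U : set 'rV[R]_n'.+1) (g : 'rV[R]_n'.+1 -> 'rV[R]_m) (c : R) :
  open U -> classC k U g -> 0 <= c ->
  (forall l (s : seq 'I_n'.+1), (size s <= k)%N -> forall x, U x ->
     `|iterpd s (fun y => g y 0 l) x| <= c) ->
  (Cnorm (@enorm R m) k U g <= (k%:R * (m%:R * (n'.+1%:R ^+ k * c)))%:E)%E.
Proof.
move=> oU cg c0 H; apply: Cnorm_le => v x /andP[v0 vk] v1 Ux.
apply: le_trans (enorm_le_sum _) _; apply: (@le_trans _ _ (\sum_(l < m) n'.+1%:R ^+ k * c)); last first.
  by rewrite sumr_const card_ord mulr_natl.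
apply: ler_sum => l _; rewrite (iterD_coord _ oU cg) //.
have cl : classC k U (fun y => g y 0 l) by exact: classC_coord.
apply: le_trans (iterD_bound oU cl vk v1 Ux c0 _) _.
  by move=> s sv; apply: H => //; rewrite sv.
by rewrite ler_wpM2r // ler_weXn2l // ler1n.
Qed.

(** * Separation of critical values *)

Section Interpolation.
Context {R : realType} {n' : nat}.
Local Notation n := n'.+1.

(** [g] is the sum of [i (1 - (1 - q_i / Q_i) ^ 2)], where [q_i] is the product of the squared
    distances to the other nodes and [Q_i] its value at node [i]. The separation of the nodes bounds
    the inverse of [Q_i], hence [g], uniformly. *)
Lemma interpolation k m (d : R) : 0 < d -> exists2 G : R, 0 < G &
  forall a : 'I_m -> 'rV[R]_n, (forall i, enorm (a i) <= 1) ->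
  (forall i j, i != j -> d <= enorm (a i - a j)) ->
  exists g : 'rV[R]_n -> R, [/\ classC k (eball 0 2) g,
    forall s : seq 'I_n, (size s <= k)%N -> forall x, eball 0 2 x -> `|iterpd s g x| <= G,
    forall i, g (a i) = i%:R & forall i l, pd l g (a i) = 0].
Proof.
move=> d0.
pose T := {a : 'I_m -> 'rV[R]_n | (forall i, enorm (a i) <= 1) /\
  (forall i j, i != j -> d <= enorm (a i - a j))}.
have [b bE] : exists b : T -> 'I_m -> 'rV[R]_n, b = fun t => sval t by eexists.
have b1 t i : enorm (b t i) <= 1 by rewrite bE; exact: (svalP t).1.
have bd t i j : i != j -> d <= enorm (b t i - b t j) by rewrite bE; exact: (svalP t).2.
pose U (_ : T) : set 'rV[R]_n := eball 0 2.
have oU t : open (U t) by exact: open_eball.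
pose one (_ : T) (_ : 'rV[R]_n) : R := 1.
pose F (t : T) (j : 'I_m) (x : 'rV[R]_n) : R := \sum_l (x 0 l - b t j 0 l) ^+ 2.
have FE t j x : F t j x = enorm (x - b t j) ^+ 2.
  by rewrite sqr_enorm; apply: eq_bigr => l _; rewrite !mxE.
pose q (t : T) (i : 'I_m) (x : 'rV[R]_n) : R := \prod_(j | j != i) F t j x.
pose Q (t : T) (i : 'I_m) : R := q t i (b t i).
(* [q t i - Q t i] vanishes at [b t i], [q t i] vanishes to second order at the other points. *)
pose g (t : T) (x : 'rV[R]_n) : R :=
  \sum_(i < m) (i%:R * ((Q t i)^-1 * (Q t i)^-1)) * (2 * Q t i * q t i x - q t i x * q t i x).
have Q0 t i : Q t i != 0.
  apply/prodf_neq0 => j ji; rewrite FE sqrf_eq0 gt_eqF // (lt_le_trans d0) // bd //.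
  by rewrite eq_sym.
(* One order more than asked for, so that [g] is differentiable also when [k = 0]. *)
have hF j : Fl k.+1 U one one (fun t => F t j).
  apply: (Fl_sum oU) => l _.
  have hl : Fl k.+1 U one one (fun t x => x 0 l - b t j 0 l).
    apply: (FlB oU).
      apply: (Fl_coord _ oU); exists 2 => t x; rewrite mulr1 /U /eball /= subr0 => /ltW.
      exact: le_trans (ler_coord_enorm _ _).
    apply: (@Fl_cst _ _ _ _ oU _ _ _ (fun t => b t j 0 l)); exists 1 => t x _.
    by rewrite mulr1; apply: le_trans (ler_coord_enorm _ _) (b1 t j).
  by apply: (Fl_eq oU _ _ (FlX oU 2 hl)) => // t x _; rewrite expr1n.
have hq i : Fl k.+1 U one one (fun t => q t i) by apply: (Fl_prod oU) => j _.
have hQi i : Fl k.+1 U one one (fun t _ => (Q t i)^-1).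
  apply: (Fl_eqf oU (f := fun t _ => \prod_(j | j != i) (F t j (b t i))^-1)).
    by move=> t x _; rewrite /Q /q prodfV.
  apply: (Fl_prod oU) => j ji.
  apply: (@Fl_cst _ _ _ _ oU _ _ _ (fun t => (F t j (b t i))^-1)); exists (d ^+ 2)^-1 => t x _.
  have dd : 0 < d ^+ 2 by rewrite exprn_gt0.
  have dF : d ^+ 2 <= F t j (b t i).
    by rewrite FE lerXn2r ?nnegrE ?enorm_ge0 ?(ltW d0) // bd // eq_sym.
  rewrite mulr1 ger0_norm ?invr_ge0; last by rewrite (le_trans (ltW dd)).
  by rewrite lef_pV2 ?posrE // (lt_le_trans dd).
have hQ i : Fl k.+1 U one one (fun t _ => Q t i).
  have [C HC] := Fl_bound (hq i).
  apply: (@Fl_cst _ _ _ _ oU _ _ _ (fun t => Q t i)); exists C => t x _; apply: HC.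
  by rewrite /U /eball /= subr0; apply: le_lt_trans (b1 t i) _; rewrite ltr1n.
have hg : Fl k.+1 U one one g.
  apply: (Fl_sum oU) => i _; apply: (FlM1 oU).
    by apply: (FlZ oU); apply: (FlM1 oU).
  apply: (FlB oU); last exact: (FlM1 oU).
  by apply: (FlM1 oU) => //; apply: (FlZ oU).
have [G G0 HG] : exists2 G : R, 0 < G & forall s : seq 'I_n, (size s <= k.+1)%N ->
    forall t x, U t x -> `|iterpd s (g t) x| <= G.
  have [G G0 HG] := Fl_iterpd_w (fun _ _ _ => ltr01) (fun _ _ _ => ler01) hg.
  by exists G => // s sk t x Ux; have := HG s sk t x Ux; rewrite expr1n divr1 mulr1.
exists G => // a a1 ad.
have [t tE] : exists t, b t = a by exists (exist _ a (conj a1 ad)); rewrite bE.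
have Ub i : U t (b t i).
  by rewrite /U /eball /= subr0; apply: le_lt_trans (b1 t i) _; rewrite ltr1n.
have F0 i : F t i (b t i) = 0 by rewrite FE subrr /enorm big1 ?sqrtr0 ?expr0n // => l _; rewrite mxE expr0n.
have q0 i j : i != j -> q t i (b t j) = 0.
  by move=> ij; rewrite /q (bigD1 j) 1?eq_sym //= F0 mul0r.
have dF j x : U t x -> differentiable (F t j) x by exact: Fl_diff (hF j) _ _.
have dq j x : U t x -> differentiable (q t j) x by exact: Fl_diff (hq j) _ _.
exists (g t); split.
- exact: classCW (Fl_classC oU hg t).
- by move=> s sk x Ux; apply: (HG s _ t x Ux); exact: leqW.
- move=> i; rewrite -tE /g (bigD1 i) //= big1 ?addr0 => [|j ji].
    by rewrite -/(Q t i); field; rewrite Q0.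
  by rewrite q0 // !mulr0 subrr mulr0.
move=> i l; rewrite -tE /g.
rewrite pd_sum => [|j _]; last first.
  apply: differentiableM; first exact: differentiable_cst.
  by apply: differentiableB; apply: differentiableM => //; exact: dq.
rewrite big1 // => j _.
have d1 : differentiable (fun x => 2 * Q t j * q t j x) (b t i).
  by apply: differentiableM => //; exact: dq.
have d2 : differentiable (fun x => q t j x * q t j x) (b t i).
  by apply: differentiableM => //; exact: dq.
rewrite pdZ; last exact: differentiableB.
rewrite (pdB _ d1 d2) pdZ ?pdM; try exact: dq.
have [->|ij] := eqVneq j i; first by rewrite -/(Q t i); ring.
have -> : pd l (q t j) (b t i) = 0.
  have qE : q t j = (fun x => F t i x * \prod_(s | (s != j) && (s != i)) F t s x).
    by apply/funext => x; rewrite /q (bigD1 i) 1?eq_sym.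
  have dr : differentiable (fun x => \prod_(s | (s != j) && (s != i)) F t s x) (b t i).
    have hr : Fl k.+1 U one one (fun t x => \prod_(s | (s != j) && (s != i)) F t s x).
      by apply: (Fl_prod oU) => s _.
    exact: Fl_diff hr _ _ (Ub i).
  rewrite qE pdM //; last exact: dF.
  rewrite F0 mul0r addr0 /F pd_sum => [|s _]; last first.
    by apply: differentiableM; exact: differentiable_coordB.
  rewrite big1 ?mul0r // => s _.
  rewrite (_ : (fun y : 'rV[R]_n => _) = (fun y => (y 0 s - b t i 0 s) * (y 0 s - b t i 0 s))).
    by rewrite pdM; try exact: differentiable_coordB; rewrite subrr mulr0 mul0r addr0.
  by apply/funext => y; rewrite expr2.
by rewrite !(mulr0, mul0r, subrr, addr0).
Qed.

End Interpolation.

(** * Uniformly Morse functions *)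

Section UniformlyMorse.
Context {R : realType} {n' : nat}.
Local Notation n := n'.+1.
Local Notation D := (closed_unit_eball R n).
Implicit Types (f : 'rV[R]_n -> R) (x y z : 'rV[R]_n).

Lemma closed_unit_eball_convex x y (t : R) : 0 <= t <= 1 -> D x -> D y -> D (x + t *: (y - x)).
Proof. exact: enorm_convex. Qed.

Lemma classC_near_iterpd j (s : seq 'I_n) f : (size s <= j)%N -> classC_near j D f ->
  classC_near (j - size s) D (iterpd s f).
Proof. by move=> sj [U [oU DU cf]]; exists U; split=> //; exact: classC_iterpd. Qed.

Lemma classC_near_diff j f x : classC_near j.+1 D f -> D x -> differentiable f x.
Proof. by move=> [U [_ DU [df _]]] /DU; exact: df. Qed.

Lemma criticalP j f x : classC_near j.+1 D f -> critical f x <-> D x /\ forall i, pd i f x = 0.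
Proof.
move=> cf; split=> -[Dx Hx]; split=> //; have dx := classC_near_diff cf Dx.
  by move=> i; rewrite /pd deriveE.
by move=> v; rewrite -deriveE // derive_pd // big1 // => i _; rewrite Hx mulr0.
Qed.

Lemma lipschitz_iterpd j f (K : R) s x y : classC_near j D f -> (size s < j)%N ->
  (forall i z, D z -> `|iterpd (i :: s) f z| <= K) -> D x -> D y ->
  `|iterpd s f y - iterpd s f x| <= n%:R * K * `|y - x|.
Proof.
move=> cf sj HK Dx Dy; apply: (@lipschitz_pd _ _ _ D) => [t t01|z Dz|i z Dz].
- exact: closed_unit_eball_convex.
- have := classC_near_iterpd (ltnW sj) cf; rewrite -subnSK // => /classC_near_diff; exact.
- exact: HK.
Qed.

(** The Hessian is frozen at a third point [x]. With [z' = x] this is Taylor's formula for the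
    gradient; with [z] and [z'] free it is the contraction property of Newton's map. *)
Lemma grad_increment f (K r : R) x z z' j : classC_near 3 D f ->
  (forall s : seq 'I_n, size s = 3 -> forall y, D y -> `|iterpd s f y| <= K) ->
  D x -> D z -> D z' -> `|z - x| <= r -> `|z' - x| <= r ->
  `|pd j f z - pd j f z' - ((z - z') *m hess f x) 0 j| <= n%:R * (`|z - z'| * (n%:R * K * r)).
Proof.
move=> cf HK Dx Dz Dz' zr zr'.
have K0 : 0 <= n%:R * K.
  by rewrite mulr_ge0 //; apply: le_trans (HK [:: j; j; j] erefl x Dx).
have [t t01 ->] : exists2 t : R, 0 <= t <= 1 &
    pd j f z - pd j f z' = \sum_i (z - z') 0 i * pd i (pd j f) (z' + t *: (z - z')).
  apply: mean_value_segment => t t01.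
  have := @classC_near_iterpd _ [:: j] _ _ cf => /(_ isT)/classC_near_diff; apply.
  exact: closed_unit_eball_convex.
have [xi xiE] : exists xi, xi = z' + t *: (z - z') by eexists.
have Dxi : D xi by rewrite xiE; exact: closed_unit_eball_convex.
have xir : `|xi - x| <= r.
  have -> : xi - x = (1 - t) *: (z' - x) + t *: (z - x).
    by rewrite xiE; apply/rowP => i; rewrite !mxE; ring.
  have /andP[t0 t1] := t01.
  apply: le_trans (ler_normD _ _) _; rewrite !normrZ (ger0_norm t0) ger0_norm ?subr_ge0 //.
  rewrite (_ : r = (1 - t) * r + t * r); last by ring.
  by apply: lerD; apply: ler_wpM2l => //; rewrite subr_ge0.
rewrite -xiE mxE -sumrB.
rewrite (eq_bigr (fun i => (z - z') 0 i * (pd i (pd j f) xi - pd i (pd j f) x))); last first.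
  by move=> i _; rewrite [hess _ _ _ _]mxE mulrBr.
apply: sum_norm_le => // i; first exact: ler_coord_norm.
apply: le_trans (ler_wpM2l K0 xir).
by apply: (lipschitz_iterpd (s := [:: i; j]) cf) => // l y; apply: HK.
Qed.

(** The third condition is imposed wherever the gradient is small, not only at critical points; so
    it survives small perturbations and holds at the starting point of Newton's method. *)
Definition uniformly_morse k (K mi gam m0 : R) f :=
  [/\ classC_near k D f,
    forall s : seq 'I_n, (1 <= size s <= k)%N -> forall x, D x -> `|iterpd s f x| <= K &
    forall x, D x -> (forall j, `|pd j f x| <= m0) ->
      enorm x <= 1 - mi /\ forall xi : 'rV[R]_n, gam * `|xi| <= `|xi *m hess f x|].

Lemma classC_near_leq i j f : (i <= j)%N -> classC_near j D f -> classC_near i D f.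
Proof. by move=> ij [U [? ? cf]]; exists U; split=> //; exact: classC_leq cf. Qed.

Section Constants.
Variables (q : nat) (K mi gam m0 : R).
Hypotheses (K0 : 0 < K) (mi0 : 0 < mi <= 1) (g0 : 0 < gam) (m00 : 0 < m0).
Local Notation UM := (uniformly_morse q.+3 K mi gam m0).
Local Notation L := (n%:R * (n%:R * K)).

Let L0 : 0 < L. Proof. by rewrite !mulr_gt0 ?ltr0n. Qed.

Lemma critical_morse f x : UM f -> critical f x ->
  enorm x <= 1 - mi /\ forall xi : 'rV[R]_n, gam * `|xi| <= `|xi *m hess f x|.
Proof.
move=> [cf HK Hg] /(criticalP x cf)[Dx Hx]; apply: Hg => // j.
by rewrite Hx normr0 ltW.
Qed.

(** At a second critical point the gradient term drops out, which separates the two; with a gradient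
    term it shows that critical points of certain perturbations have not moved. *)
Lemma critical_lower_bound f x y : UM f -> critical f x -> D y ->
  gam * `|y - x| <= `|grad f y| + L * `|y - x| ^+ 2.
Proof.
move=> fM cx Dy; have [_ Hg] := critical_morse fM cx.
have [cf HK _] := fM; have /(criticalP x cf)[Dx Hx] := cx.
apply: le_trans (Hg _) _; apply: rV_norm_le => [|j]; first by rewrite addr_ge0 // mulr_ge0 ?exprn_ge0 ?(ltW L0).
have : `|pd j f y - pd j f x - ((y - x) *m hess f x) 0 j| <= L * `|y - x| ^+ 2.
  have -> : L * `|y - x| ^+ 2 = n%:R * (`|y - x| * (n%:R * K * `|y - x|)) by rewrite expr2; ring.
  apply: grad_increment => //; first exact: classC_near_leq cf.
    by move=> s s3; apply: HK; rewrite s3.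
  by rewrite subrr normr0.
rewrite Hx subr0 => h; rewrite -[X in `|X|](subKr (pd j f y)).
apply: le_trans (ler_normB _ _) _; apply: lerD h.
by have := ler_coord_norm (grad f y) j; rewrite mxE.
Qed.

Lemma critical_grad f x : UM f -> critical f x -> grad f x = 0.
Proof.
by move=> [cf _ _] /(criticalP x cf)[_ Hx]; apply/rowP => i; rewrite !mxE; exact: Hx.
Qed.

Lemma critical_separated f x y : UM f -> critical f x -> critical f y -> x <> y ->
  gam / L <= `|x - y|.
Proof.
move=> fM cx cy /eqP xy; have := critical_lower_bound fM cx cy.1.
rewrite (critical_grad fM cy) normr0 add0r expr2 distrC => H.
have p0 : 0 < `|x - y| by rewrite normr_gt0 subr_eq0.
have H' : gam <= L * `|x - y| by rewrite -(ler_pM2r p0) -[leRHS]mulrA.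
by rewrite ler_pdivrMr // mulrC.
Qed.

Lemma near_critical delta : 0 < delta -> exists2 eta : R, 0 < eta & forall f, UM f ->
  forall x, D x -> (forall j, `|pd j f x| <= eta) -> exists2 z, critical f z & eball z delta x.
Proof.
move=> d0; have /andP[mip mi1] := mi0.
(* [r1] keeps the iteration inside the unit ball, [r2] its limit within [delta], and [r3] makes it a
   contraction. *)
have [r r0 [r1 r2 r3]] : exists2 r : R, 0 < r & [/\ n%:R * r <= mi, n%:R * r < delta & L * r <= gam / 2].
  exists (Num.min (mi / n%:R) (Num.min (delta / 2 / n%:R) (gam / 2 / L))).
    by rewrite !lt_min !divr_gt0 ?ltr0n.
  split.
  - by rewrite mulrC -ler_pdivlMr ?ltr0n // ge_min lexx.
  - apply: (@le_lt_trans _ _ (delta / 2)); last by rewrite ltr_pdivrMr // ltr_pMr // ltr1n.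
    by rewrite mulrC -ler_pdivlMr ?ltr0n // !ge_min lexx orbT.
  - by rewrite mulrC -ler_pdivlMr // !ge_min lexx !orbT.
(* Below [m0] the Hessian at [x] is controlled; below [gam * (r / 2)] the first Newton step is at
   most [r / 2]. *)
exists (Num.min m0 (gam * (r / 2))) => [|f fM x Dx Hx]; first by rewrite lt_min m00 mulr_gt0 // divr_gt0.
have [cf HK Hg] := fM.
have [||ex Hgx] := Hg x => //; first by move=> j; apply: le_trans (Hx j) _; rewrite ge_min lexx.
pose H := hess f x; have uH : H \in unitmx := lower_bound_unit g0 Hgx.
have invH (w : 'rV[R]_n) : gam * `|w *m invmx H| <= `|w|.
  by apply: le_trans (Hgx _) _; rewrite mulmxKV.
(* [z + u z = 0] says that the gradient at [z] vanishes; the fixed-point map is Newton's with the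
   Hessian frozen at [x]. *)
pose u z := grad f z *m invmx H - z.
have Dz z : `|z - x| <= r -> D z.
  move=> zr; rewrite /D /= -(subrK x z) addrC; apply: le_trans (enormD _ _) _.
  rewrite -[leRHS](subrK mi) lerD //; apply: le_trans (enorm_le_norm _) _.
  by apply: le_trans r1; rewrite ler_wpM2l.
have [||z zr uz] := @near_identity_onto _ _ u x 0 r r0.
- move=> z z' zr zr'.
  have -> : u z - u z' = (grad f z - grad f z' - (z - z') *m H) *m invmx H.
    by rewrite [RHS]mulmxBl mulmxBl mulmxK // /u !opprD addrACA.
  rewrite -(ler_pM2l g0); apply: le_trans (invH _) _.
  have hr : 0 <= gam * (2^-1 * `|z - z'|) by rewrite !mulr_ge0 // ltW.
  apply: rV_norm_le => // j.
  have -> : (grad f z - grad f z' - (z - z') *m H) 0 j = pd j f z - pd j f z' - ((z - z') *m H) 0 j.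
    by rewrite 2!mxE [grad f z 0 j]mxE [(- grad f z') 0 j]mxE [grad f z' 0 j]mxE [(- ((z - z') *m H)) 0 j]mxE.
  apply: le_trans (grad_increment j (classC_near_leq _ cf) _ Dx (Dz _ zr) (Dz _ zr') zr zr') _ => //.
    by move=> s s3; apply: HK; rewrite s3.
  have -> : n%:R * (`|z - z'| * (n%:R * K * r)) = L * r * `|z - z'| by ring.
  by rewrite [leRHS]mulrA ler_wpM2r.
- rewrite sub0r normrN addrC subrK -(ler_pM2l g0); apply: le_trans (invH _) _.
  apply: rV_norm_le => [|j]; first by rewrite mulr_ge0 ?divr_ge0 ?(ltW g0) ?(ltW r0).
  by rewrite mxE; apply: le_trans (Hx j) _; rewrite ge_min lexx orbT.
exists z.
  apply/(criticalP z cf); split; first exact: Dz.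
  have g00 : grad f z = 0 by rewrite -(mulmxKV uH (grad f z)) -[grad f z *m _](subrK z) addrC uz mul0mx.
  by move=> i; have := congr1 (fun w : 'rV[R]_n => w 0 i) g00; rewrite !mxE.
rewrite /eball /= -enormN opprB; apply: le_lt_trans (enorm_le_norm _) _.
by apply: le_lt_trans r2; rewrite ler_wpM2l.
Qed.

Lemma critical_charts : exists2 delta : R, 0 < delta & exists2 M : R, 0 < M & forall f, UM f ->
  forall x, critical f x -> eball x delta `<=` D /\
  exists phi psi : 'rV[R]_n -> 'rV[R]_n, coord_transf q.+2 (eball x delta) phi psi /\
    (exists (l : nat) (c : R), (l <= n)%N /\
       forall y, (phi @` eball x delta) y ->
         f (psi y) = \sum_(i < n | (i < l)%N) y 0 i ^+ 2
                   - \sum_(i < n | (l <= i)%N) y 0 i ^+ 2 + c) /\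
    (Cnorm (@enorm R n) q.+2 (eball x delta) phi <= M%:E)%E.
Proof.
have [S [TT [ST S0]]] := sqrt_poly R q.+1.
(* The top derivatives oscillate by at most [2 K]; the added 1 ensures that the radius, at most 1,
   does not exceed [e]. *)
have E0 : 0 < 2 * K + 1 by rewrite addr_gt0 // mulr_gt0.
have [d d0 [M M0 HM]] := @morse_chart R n' q.+1 S TT K gam (2 * K + 1) ST S0 g0 isT E0.
have /andP[mip mi1] := mi0.
have [delta [dp dmi dd]] : exists delta : R, [/\ 0 < delta, delta <= mi & delta <= d].
  by exists (Num.min mi d); split; rewrite ?lt_min ?mip // ge_min lexx ?orbT.
exists delta => //; exists (q.+2%:R * (n%:R * (n%:R ^+ q.+2 * M))).
  have nq : 0 < n%:R ^+ q.+2 :> R by rewrite exprn_gt0 // ltr0n.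
  by rewrite mulr_gt0 ?ltr0n // mulr_gt0 ?ltr0n // mulr_gt0.
move=> f fM x cx; have [ex Hgx] := critical_morse fM cx.
have BD : eball x delta `<=` D.
  move=> y yx; rewrite /D /= -(subrK x y) addrC; apply: le_trans (enormD _ _) _.
  by rewrite -[leRHS](subrK mi) lerD //; apply: le_trans (ltW yx) dmi.
split=> //; have [cf HK _] := fM; have /(criticalP x cf)[Dx Hx] := cx.
have [U [oU DU cU]] := cf.
have G : morse_data q.+1 K gam (2 * K + 1) f x delta (2 * K + 1).
  split; first split=> //.
  - by rewrite dp (le_trans dmi).
  - by rewrite lexx andbT (le_trans (le_trans dmi mi1)) // lerDr mulr_ge0 // ltW.
  - by apply: classC_sub cU => y /BD/DU.
  split=> [s /andP[s1 s2]|s s3 y By]; first by apply: HK => //; rewrite s2 andbT ltnW.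
  apply: le_trans (ler_normB _ _) _; apply: (@le_trans _ _ (K + K)); last by lra.
  by apply: lerD; apply: HK; rewrite ?s3 ?leqnn //; exact: BD.
have [phi [psi [cphi nf bphi]]] := HM _ _ _ _ G dd.
exists phi, psi; split=> //; split=> //.
have [cp _ _ _] := cphi.
have oB : open (eball x delta) by exact: open_eball.
exact: (Cnorm_vector_le oB cp (ltW M0) bphi).
Qed.

Lemma hessian_eigenvalue f x (a : R) : UM f -> critical f x -> eigenvalue (hessian f x) a ->
  gam <= `|a|.
Proof.
move=> fM cx /eigenvalueP[v vH v0]; have [_ /(_ v)] := critical_morse fM cx.
have -> : hess f x = hessian f x by [].
by rewrite vH normrZ ler_pM2r // normr_gt0.
Qed.

End Constants.

End UniformlyMorse.

(** * Perturbations *)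

Section Perturbation.
Context {R : realType} {n' : nat}.
Local Notation n := n'.+1.
Local Notation D := (closed_unit_eball R n).
Implicit Types (f g : 'rV[R]_n -> R) (U : set 'rV[R]_n).

Lemma classCD j U f g : open U -> classC j U f -> classC j U g -> classC j U (fun x => f x + g x).
Proof.
move=> oU; elim: j f g => [|j IH] f g cf cg.
  by move=> x Ux; apply: continuousD; [exact: cf|exact: cg].
have [[df _] [dg _]] := (cf, cg).
apply: classC_pd => // [x Ux|i]; first by apply: differentiableD; [exact: df|exact: dg].
apply: (classC_eq oU _ (IH _ _ (pd_classC i cf) (pd_classC i cg))) => x Ux.
by rewrite pdD; [|exact: df|exact: dg].
Qed.

Lemma classCZ j U (c : R) f : open U -> classC j U f -> classC j U (fun x => c * f x).
Proof.
move=> oU; elim: j f => [|j IH] f cf.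
  by move=> x Ux; apply: continuousM; [exact: cst_continuous|exact: cf].
have [df _] := cf.
apply: classC_pd => // [x Ux|i]; first by apply: differentiableM => //; exact: df.
apply: (classC_eq oU _ (IH _ (pd_classC i cf))) => x Ux.
by rewrite pdZ //; exact: df.
Qed.

Lemma iterpdD s U f g x : open U -> classC (size s) U f -> classC (size s) U g -> U x ->
  iterpd s (fun y => f y + g y) x = iterpd s f x + iterpd s g x.
Proof.
move=> oU cf cg; elim: s x cf cg => //= i s IH x cf cg Ux.
have E y : U y -> iterpd s (fun y => f y + g y) y = iterpd s f y + iterpd s g y.
  by move=> Uy; apply: IH => //; exact: classCW.
have df h : classC (size s).+1 U h -> differentiable (iterpd s h) x.
  by move=> ch; have := classC_iterpd (leqnSn _) ch; rewrite subSnn => -[+ _]; exact.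
by rewrite (pd_eq i oU E Ux) pdD //; exact: df.
Qed.

Lemma iterpdZ s U (c : R) f x : open U -> classC (size s) U f -> U x ->
  iterpd s (fun y => c * f y) x = c * iterpd s f x.
Proof.
move=> oU cf; elim: s x cf => //= i s IH x cf Ux.
have E y : U y -> iterpd s (fun y => c * f y) y = c * iterpd s f y.
  by move=> Uy; apply: IH => //; exact: classCW.
have df : differentiable (iterpd s f) x.
  by have := classC_iterpd (leqnSn _) cf; rewrite subSnn => -[+ _]; exact.
by rewrite (pd_eq i oU E Ux) pdZ.
Qed.

Lemma differentiable_dot (v x : 'rV[R]_n) : differentiable (dot v) x.
Proof.
apply: differentiable_sumr => j _; apply: differentiableM => //.
by apply: (differentiable_eq (@openT _) _ _ (differentiable_coordB 0 j x)) => // y _; rewrite mxE subr0.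
Qed.

Lemma pd_dot (v : 'rV[R]_n) i : pd i (dot v) = fun=> v 0 i.
Proof.
apply/funext => x; have dc j : differentiable (fun y : 'rV[R]_n => y 0 j) x.
  by apply: (differentiable_eq (@openT _) _ _ (differentiable_coordB 0 j x)) => // y _; rewrite mxE subr0.
rewrite pd_sum => [|j _]; last exact: differentiableM.
have pdc j : pd i (fun y : 'rV[R]_n => y 0 j) x = (i == j)%:R.
  rewrite -(pd_coordB 0 i j x); apply: (pd_eq i (@openT _)) => // y _.
  by rewrite mxE subr0.
rewrite (bigD1 i) //= big1 ?addr0 => [|j ji]; rewrite pdZ ?pdc //.
  by rewrite eqxx mulr1.
by rewrite eq_sym (negPf ji) mulr0.
Qed.

Lemma iterpd_cst s (c : R) : (0 < size s)%N -> iterpd s (fun _ : 'rV[R]_n => c) = fun=> 0.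
Proof.
elim/last_ind: s c => // s i IH c _; rewrite iterpd_rcons.
have -> : pd i (fun _ : 'rV[R]_n => c) = fun=> 0 by apply/funext => x; rewrite pd_cst.
by case: s IH => // a s ->.
Qed.

Lemma iterpd_dot (v : 'rV[R]_n) s x (c : R) : (0 < size s)%N -> (forall j, 0 <= v 0 j <= c) ->
  `|iterpd s (dot v) x| <= c.
Proof.
case/lastP: s => // s i _ vc; rewrite iterpd_rcons pd_dot; have /andP[v0 v1] := vc i.
case: s => [|a s]; first by rewrite /= ger0_norm.
by rewrite iterpd_cst // normr0 (le_trans v0).
Qed.

Lemma classC_cst j U (c : R) : open U -> classC j U (fun _ : 'rV[R]_n => c).
Proof.
move=> oU; elim: j c => [|j IH] c; first by move=> x _; exact: cst_continuous.
apply: classC_pd => // l.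
by rewrite (_ : pd l _ = fun=> 0); [exact: IH|apply/funext => x; rewrite pd_cst].
Qed.

Lemma classC_dot j U (v : 'rV[R]_n) : open U -> classC j U (dot v).
Proof.
move=> oU; case: j => [|j].
  by move=> x _; exact: differentiable_continuous (differentiable_dot v x).
apply: classC_pd => // [x _|i]; first exact: differentiable_dot.
by rewrite pd_dot; exact: classC_cst.
Qed.

Lemma classC_nearD j f g : classC_near j D f -> classC_near j D g ->
  classC_near j D (fun x => f x + g x).
Proof.
move=> [U [oU DU cf]] [V [oV DV cg]]; have oUV : open (U `&` V) by exact: openI.
exists (U `&` V); split=> // [x Dx|]; first by split; [exact: DU|exact: DV].
by apply: classCD => //; [apply: classC_sub cf|apply: classC_sub cg]; move=> x [].
Qed.

Lemma iterpd_nearD s f g x : classC_near (size s) D f -> classC_near (size s) D g -> D x ->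
  iterpd s (fun y => f y + g y) x = iterpd s f x + iterpd s g x.
Proof.
move=> [U [oU DU cf]] [V [oV DV cg]] Dx; have oUV : open (U `&` V) by exact: openI.
apply: (iterpdD oUV); last by split; [exact: DU|exact: DV].
  by apply: classC_sub cf => y [].
by apply: classC_sub cg => y [].
Qed.

Lemma uniformly_morse_perturb k (K mi gam m0 c : R) f p : (1 < k)%N ->
  uniformly_morse k K mi gam m0 f -> classC_near k D p ->
  (forall s : seq 'I_n, (size s <= k)%N -> forall x, D x -> `|iterpd s p x| <= c) ->
  c <= m0 / 2 -> n%:R * c <= gam / 2 ->
  uniformly_morse k (K + c) mi (gam / 2) (m0 / 2) (fun x => f x + p x).
Proof.
move=> k1 [cf HK Hg] cp Hp c1 c2.
have E s x : (size s <= k)%N -> D x ->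
    iterpd s (fun y => f y + p y) x = iterpd s f x + iterpd s p x.
  by move=> sk Dx; apply: iterpd_nearD => //; apply: classC_near_leq; eassumption.
split; first exact: classC_nearD.
  move=> s s1 x Dx; have /andP[_ sk] := s1; rewrite E //.
  by apply: le_trans (ler_normD _ _) _; apply: lerD; [exact: HK|exact: Hp].
move=> x Dx Hx; have [j|ex Hxi] := Hg x Dx.
  have := E [:: j] x (ltnW k1) Dx; rewrite /= => Ej.
  rewrite -(addrK (pd j p x) (pd j f x)) -Ej; apply: le_trans (ler_normB _ _) _.
  have hp := Hp [:: j] (ltnW k1) x Dx; rewrite /= in hp.
  by rewrite [leRHS](splitr m0); apply: lerD => //; exact: le_trans hp c1.
split; first exact: ex.
move=> xi; have -> : hess (fun x => f x + p x) x = hess f x + hess p x.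
  apply/matrixP => i j; rewrite [LHS]mxE [RHS]mxE [hess f x i j]mxE [hess p x i j]mxE.
  exact: (E [:: i; j] x k1 Dx).
have hp : `|xi *m hess p x| <= gam / 2 * `|xi|.
  have h : `|xi *m hess p x| <= n%:R * c * `|xi|.
    apply: mulmx_norm_le => [|i j]; first by apply: le_trans (Hp [::] (leq0n _) x Dx).
    by rewrite mxE; exact: (Hp [:: i; j] k1 x Dx).
  by apply: le_trans h _; rewrite ler_wpM2r.
have := Hxi xi; rewrite mulmxDr => h.
have h2 : `|xi *m hess f x| <= `|xi *m hess f x + xi *m hess p x| + `|xi *m hess p x|.
  by rewrite -{1}(addrK (xi *m hess p x) (xi *m hess f x)); exact: ler_normB.
have -> : gam / 2 * `|xi| = gam * `|xi| - gam / 2 * `|xi| by field.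
rewrite lerBlDr; apply: le_trans h _; apply: le_trans h2 _.
by rewrite lerD2l.
Qed.

Lemma morse_linear q (K c : R) : 0 < K -> 0 < c -> exists2 mi : R, 0 < mi <= 1 & forall f,
  classC_near q.+3 D f ->
  (forall s : seq 'I_n, (1 <= size s <= q.+3)%N -> forall x, D x -> `|iterpd s f x| <= K) ->
  exists2 v : 'rV[R]_n, (forall j, 0 <= v 0 j <= c) &
    uniformly_morse q.+3 (K + c) mi mi (mi ^+ 2) (fun x => f x + dot v x).
Proof.
move=> K0 c0; have L0 : 0 <= n%:R * (n%:R * K) by rewrite !mulr_ge0 // ltW.
have [mi /andP[mi0 mi2] H] := good_linear_perturbation (ltn0Sn n') L0 c0.
exists mi => [|f cf HK]; first by rewrite mi0 (le_trans mi2) // invf_le1 // ler1n.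
have KL : n%:R * K <= n%:R * (n%:R * K).
  by rewrite ler_peMl ?ler1n // mulr_ge0 // ltW.
have [||| v [vc Hv]] := H (fun j => pd j f) (hess f).
- move=> x y j Dx Dy; apply: (@le_trans _ _ (n%:R * K * `|y - x|)); last exact: ler_wpM2r.
  by apply: (lipschitz_iterpd (s := [:: j]) cf) => // i z Dz; apply: HK.
- move=> x y j Dx Dy.
  have -> : n%:R * (n%:R * K) * `|y - x| ^+ 2 = n%:R * (`|y - x| * (n%:R * K * `|y - x|)).
    by rewrite expr2; ring.
  apply: grad_increment => //; first exact: classC_near_leq cf.
    by move=> s s3; apply: HK; rewrite s3.
  by rewrite subrr normr0.
- move=> x Dx; have [U [oU DU cU]] := cf.
  by apply: (hess_sym (k := q) oU (DU _ Dx)); exact: classC_leq cU.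
exists v; first exact: vc.
have cv j : classC_near j D (dot v).
  exists setT; split=> //; [exact: openT|apply: classC_dot; exact: openT].
have E s x : (size s <= q.+3)%N -> D x ->
    iterpd s (fun y => f y + dot v y) x = iterpd s f x + iterpd s (dot v) x.
  by move=> sk Dx; apply: iterpd_nearD => //; apply: classC_near_leq; eassumption.
split; first exact: (classC_nearD cf (cv _)).
  move=> s s1 x Dx; have /andP[s0 sk] := s1; rewrite (E _ _ sk Dx).
  apply: le_trans (ler_normD _ _) _; apply: lerD; first exact: (HK _ s1 _ Dx).
  exact: (iterpd_dot _ s0 vc).
move=> x Dx Hx; have [|ex Hxi] := Hv x Dx.
  by move=> j; have := Hx j; have /= -> := E [:: j] x isT Dx; rewrite pd_dot.
split; first exact: ex.
move=> xi; have -> : hess (fun x => f x + dot v x) x = hess f x; last exact: Hxi.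
apply/matrixP => i j; rewrite [LHS]mxE [RHS]mxE; have /= -> := E [:: i; j] x isT Dx.
by rewrite pd_dot pd_cst addr0.
Qed.

(** Among [N ^ 2 + 1] equally spaced values of [t], each pair of indices spoils at most one: passing
    to another value changes the difference by at least the spacing, which is twice the
    threshold. *)
Lemma separating_parameter m N (b : 'I_m -> R) (tau : R) : (m <= N)%N -> 0 < tau ->
  exists2 t, 0 <= t <= tau & forall i j, i != j ->
    tau / (2 * (N * N).+1%:R) <= `|b i + t * i%:R - (b j + t * j%:R)|.
Proof.
move=> mN t0; have L0 : 0 < (N * N).+1%:R :> R by rewrite ltr0n.
pose t (l : 'I_(N * N).+1) : R := tau * l%:R / (N * N).+1%:R.
apply: contrapT => no.
have bad l : exists ij : 'I_m * 'I_m, ij.1 != ij.2 /\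
    `|b ij.1 + t l * ij.1%:R - (b ij.2 + t l * ij.2%:R)| < tau / (2 * (N * N).+1%:R).
  apply: contrapT => nb; apply: no; exists (t l).
    rewrite /t; apply/andP; split; first by rewrite divr_ge0 ?mulr_ge0 // ltW.
    by rewrite ler_pdivrMr // ler_pM2l // ler_nat ltnW // ltn_ord.
  move=> i j ij; rewrite leNgt; apply/negP => h; apply: nb; by exists (i, j).
have [F HF] := choice bad.
have : ~~ injectiveb F.
  apply/negP => /injectiveP/leq_card; rewrite card_prod !card_ord leqNgt => /negP; apply.
  by rewrite ltnS leq_mul.
move=> /injectivePn[l [l' ll' FE]].
have [ij] := HF l; have [_] := HF l'; rewrite -FE.
move: (F l).1 (F l).2 ij => i j ij.
set u := b i + _ - _; set w := b i + _ - _ => h1 h2.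
have uw : u - w = (t l' - t l) * (i%:R - j%:R) by rewrite /u /w; ring.
have : `|u - w| < tau / (N * N).+1%:R.
  apply: le_lt_trans (ler_normB _ _) _.
  rewrite (_ : tau / (N * N).+1%:R = tau / (2 * (N * N).+1%:R) + tau / (2 * (N * N).+1%:R)).
    exact: ltrD.
  by rewrite invfM; field; rewrite gt_eqF.
have nat1 (a c : nat) : a != c -> 1 <= `|a%:R - c%:R : R|.
  move=> ac; wlog ca : a c ac / (c <= a)%N.
    by move=> H; have /orP[/H|/H] := leq_total c a; [exact|rewrite distrC eq_sym; exact].
  by rewrite -natrB // normr_nat ler1n subn_gt0 ltn_neqAle eq_sym ac.
have tt : t l' - t l = tau / (N * N).+1%:R * (l'%:R - l%:R) by rewrite /t; ring.
apply/negP; rewrite -leNgt uw tt -mulrA normrM ger0_norm ?divr_ge0 ?(ltW t0) ?(ltW L0) //.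
rewrite ler_peMr ?divr_ge0 ?(ltW t0) ?(ltW L0) // normrM mulr_ege1 // nat1 //.
by apply: contra_neq ll' => /val_inj.
Qed.

End Perturbation.

(** * Choice of the perturbation and of the constants *)

Section Main.
Context {R : realType} {n' : nat}.
Local Notation n := n'.+1.
Local Notation D := (closed_unit_eball R n).
Implicit Types (f g : 'rV[R]_n -> R).

Lemma min_bounds (a b c d : R) : 0 < a -> 0 < b -> 0 < c -> 0 < d ->
  exists2 e : R, 0 < e & [/\ e <= a, e <= b, e <= c & e <= d].
Proof.
move=> a0 b0 c0 d0; exists (Num.min (Num.min a b) (Num.min c d)).
  by rewrite !lt_min a0 b0 c0 d0.
by split; rewrite !ge_min lexx ?orbT.
Qed.

(* A critical point of [f + p] is close to a critical point [z] of [f], and the gradient of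
   [f] grows linearly at [z] while the gradient of [p] vanishes at [z] and is flat. *)
Lemma critical_perturb q (K mi gam m0 : R) : 0 < K -> 0 < mi <= 1 -> 0 < gam -> 0 < m0 ->
  exists2 c : R, 0 < c & forall f p, uniformly_morse q.+3 K mi gam m0 f -> classC_near 2 D p ->
  (forall s : seq 'I_n, (size s <= 2)%N -> forall x, D x -> `|iterpd s p x| <= c) ->
  (forall z, critical f z -> forall i, pd i p z = 0) ->
  forall x, critical (fun y => f y + p y) x -> critical f x.
Proof.
move=> K0 mi0 g0 m00; pose L : R := n%:R * (n%:R * K).
have L0 : 0 < L by rewrite !mulr_gt0 ?ltr0n.
have d0 : 0 < gam / (4 * L) by rewrite divr_gt0 // mulr_gt0.
have [eta eta0 Heta] := @near_critical R n' q _ _ _ _ K0 mi0 g0 m00 _ d0.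
(* [c <= eta] places [x] near some [z]. There the gradient of [p] is at most [gam / 4] times
   [|x - z|], and so is the quadratic term by the radius [gam / (4 L)]; together they stay below
   [gam |x - z|] unless [x = z]. *)
have [c c0 [c1 c2 _ _]] : exists2 c : R, 0 < c & [/\ c <= eta, c <= gam / (4 * n%:R), c <= 1 & c <= 1].
  by apply: min_bounds; rewrite ?divr_gt0 ?mulr_gt0 ?ltr0n.
exists c => // f p fM cp Hp pz x cx.
have [cf HK _] := fM.
have c2f : classC_near 2 D f by exact: classC_near_leq cf.
have [Dx Hx] := (criticalP x (classC_nearD c2f cp)).1 cx.
have gE i : pd i f x = - pd i p x.
  apply/eqP; rewrite -addr_eq0; apply/eqP.
  have c1f : classC_near 1 D f by exact: classC_near_leq c2f.
  have c1p : classC_near 1 D p by exact: classC_near_leq cp.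
  have /= <- := @iterpd_nearD _ _ [:: i] f p x c1f c1p Dx.
  exact: Hx.
have [|z cz zx] := Heta f fM x Dx.
  by move=> j; rewrite gE normrN; apply: le_trans c1; exact: (Hp [:: j]).
have zw : `|x - z| <= gam / (4 * L) by exact: ltW (eball_norm zx).
have Dz := cz.1.
have gl : `|grad f x| <= gam / 4 * `|x - z|.
  apply: rV_norm_le => [|i]; first by rewrite mulr_ge0 // divr_ge0 // ltW.
  rewrite mxE -/(pd i f x) gE normrN -(subr0 (pd i p x)) -(pz z cz i).
  apply: (@le_trans _ _ (n%:R * c * `|x - z|)).
    by apply: (lipschitz_iterpd (s := [:: i]) cp) => // l y Dy; exact: (Hp [:: l; i]).
  rewrite ler_wpM2r // -ler_pdivlMl ?ltr0n //; apply: le_trans c2 _.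
  by rewrite invfM [leLHS]mulrA [leLHS]mulrC.
have := critical_lower_bound K0 m00 fM cz Dx; rewrite -/L expr2 => h.
have g4 : gam / 2 / 2 = gam / 4 by field.
have : gam * `|x - z| <= gam / 2 * `|x - z|.
  apply: le_trans h _; rewrite (splitr (gam / 2)) mulrDl; apply: lerD.
    by rewrite g4.
  rewrite g4 [leLHS]mulrA ler_wpM2r //; rewrite -ler_pdivlMl //; apply: le_trans zw _.
  by rewrite invfM [leLHS]mulrA [leLHS]mulrC.
rewrite -subr_ge0 -mulrBl => h2.
have xz : `|x - z| = 0.
  apply/eqP; rewrite -normr_le0 normr_id leNgt; apply/negP => w0.
  by move: h2; rewrite pmulr_lge0 //; apply/negP; rewrite -ltNge; lra.
by move/eqP: xz; rewrite normr_eq0 subr_eq0 => /eqP ->.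
Qed.

Definition morse_bounds q (K eps psi1 psi2 psi3 d M N eta : R) : Prop :=
  forall f0, classC_near q.+3 D f0 ->
  (forall s : seq 'I_n, (1 <= size s <= q.+3)%N -> forall x, D x -> `|iterpd s f0 x| <= K) ->
  exists h : 'rV[R]_n -> R,
    classC_near q.+3 D h /\
    (Cnorm (fun t : R => `|t|%R) q.+3 D h <= eps%:E)%E /\
    let f := fun x => f0 x + h x in
    (forall x, critical f x ->
       forall lambda : R, eigenvalue (hessian f x) lambda -> psi1 <= `|lambda|) /\
    ((forall x y, critical f x -> critical f y -> x <> y -> d <= enorm (x - y)) /\
     (exists m : nat, critical f #= `I_m /\ m%:R <= N)) /\
    (forall x y, critical f x -> critical f y -> x <> y -> psi2 <= `|f x - f y|) /\
    (forall x, critical f x ->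
       eball x psi3 `<=` D /\
       exists phi psi : 'rV[R]_n -> 'rV[R]_n,
         coord_transf q.+2 (eball x psi3) phi psi /\
         (exists (l : nat) (c : R), (l <= n)%N /\
            forall y, (phi @` eball x psi3) y ->
              f (psi y) = \sum_(i < n | (i < l)%N) y 0 i ^+ 2
                        - \sum_(i < n | (l <= i)%N) y 0 i ^+ 2 + c) /\
         (Cnorm (@enorm R n) q.+2 (eball x psi3) phi <= M%:E)%E) /\
    (forall x, D x -> enorm (grad f x) <= eta ->
       exists2 xi, critical f xi & eball xi psi3 x).

Lemma morse_perturbation q (K eps : R) : 0 < K -> 0 < eps ->
  exists psi1 psi2 psi3 d M N eta : R,
    (0 < psi1 /\ 0 < psi2 /\ 0 < psi3 /\ 0 < d /\ 0 < M /\ 0 < N /\ 0 < eta) /\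
    morse_bounds q K eps psi1 psi2 psi3 d M N eta.
Proof.
move=> K0 eps0.
have k0 : 0 < q.+3%:R :> R by rewrite ltr0n.
have nq : 0 < n%:R ^+ q.+3 :> R by rewrite exprn_gt0 // ltr0n.
have n0 : 0 < n%:R :> R by rewrite ltr0n.
(* One [c1] for each of the two perturbations; [n ^ (q + 3)] is the cost of passing from partial
   derivatives to operator norms, and [q + 3] the number of summands of the norm. *)
have [c1 [c10 c1E]] : exists c1 : R, 0 < c1 /\ q.+3%:R * (n%:R ^+ q.+3 * (c1 + c1)) = eps.
  exists (eps / (q.+3%:R * n%:R ^+ q.+3) / 2); split; first by rewrite !divr_gt0 // mulr_gt0.
  by rewrite -splitr mulrA mulrC mulfVK // mulf_neq0 // gt_eqF.
have [mi mi01 Hlin] := @morse_linear R n' q K c1 K0 c10.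
have /andP[mi0 mi1] := mi01.
have K10 : 0 < K + c1 by rewrite addr_gt0.
have mm0 : 0 < mi ^+ 2 by rewrite exprn_gt0.
pose L1 : R := n%:R * (n%:R * (K + c1)).
have L10 : 0 < L1 by rewrite !mulr_gt0.
have d10 : 0 < mi / L1 by rewrite divr_gt0.
have [N0 HN0] := @separated_finite R n (mi / L1) d10.
have HG m : exists G : R, 0 < G /\ forall a : 'I_m -> 'rV[R]_n, (forall i, enorm (a i) <= 1) ->
  (forall i j, i != j -> mi / L1 <= enorm (a i - a j)) ->
  exists g : 'rV[R]_n -> R, [/\ classC q.+3 (eball 0 2) g,
    forall s : seq 'I_n, (size s <= q.+3)%N -> forall x, eball 0 2 x -> `|iterpd s g x| <= G,
    forall i, g (a i) = i%:R & forall i l, pd l g (a i) = 0].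
  by have [G G0 H] := @interpolation R n' q.+3 m (mi / L1) d10; exists G.
have [Gm HGm] := choice HG.
(* The number [m] of critical points depends on [f0] but is at most [N0], so the sum bounds all
   interpolation constants at once. *)
pose G := \sum_(m < N0.+1) Gm m.
have GG m : (m <= N0)%N -> Gm m <= G.
  move=> mN; rewrite /G (bigD1 (Ordinal (mN : (m < N0.+1)%N))) //= lerDl sumr_ge0 // => i _.
  by rewrite ltW // (HGm i).1.
have G0 : 0 < G by apply: lt_le_trans (GG 0 (leq0n _)); exact: (HGm 0).1.
have [cp cp0 Hcp] := @critical_perturb q _ _ _ _ K10 mi01 mi0 mm0.
(* The four bounds are for the norm of [h], for creating no critical points, and for losing at most
   half of the gradient threshold and half of the Hessian bound. *)
have [c2 c20 [c2a c2b c2c c2d]] := min_bounds c10 cp0 (divr_gt0 mm0 (ltr0n R 2)) (divr_gt0 (divr_gt0 mi0 (ltr0n R 2)) n0).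
pose tau := c2 / G.
have tau0 : 0 < tau by rewrite divr_gt0.
have K20 : 0 < K + c1 + c2 by rewrite addr_gt0.
pose L2 : R := n%:R * (n%:R * (K + c1 + c2)).
have L20 : 0 < L2 by rewrite !mulr_gt0.
have g20 : 0 < mi / 2 by rewrite divr_gt0.
have m20 : 0 < mi ^+ 2 / 2 by rewrite divr_gt0.
have d20 : 0 < mi / 2 / L2 by rewrite divr_gt0.
have [N1 HN1] := @separated_finite R n (mi / 2 / L2) d20.
have [psi3 psi30 [M M0 HM]] := @critical_charts R n' q _ _ _ _ K20 mi01 g20 m20.
have [eta eta0 Heta] := @near_critical R n' q _ _ _ _ K20 mi01 g20 m20 _ psi30.
have psi20 : 0 < tau / (2 * (N0 * N0).+1%:R) by rewrite divr_gt0 // mulr_gt0 // ltr0n.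
exists (mi / 2), (tau / (2 * (N0 * N0).+1%:R)), psi3, (mi / 2 / L2), M, (N1%:R + 1), eta.
split; first by do !split => //; rewrite ltr_wpDl.
move=> f0 cf0 HK0.
have [v vc f1M] := Hlin f0 cf0 HK0.
pose f1 x := f0 x + dot v x.
have sep1 x y : critical f1 x -> critical f1 y -> x <> y -> mi / L1 <= `|x - y|.
  exact: (critical_separated K10 mm0 f1M).
have [m mN0 crit1] := HN0 (critical f1) (fun x (cx : critical f1 x) => cx.1) sep1.
have [a [fa ia sa]] : exists a, set_bij `I_m (critical f1) a.
  by apply/card_set_bijP; rewrite card_eq_sym.
pose b (i : 'I_m) := a i.
have [||g [cg gb ga gda]] := (HGm m).2 b.
- by move=> i; have [] := fa i (ltn_ord i).
- move=> i j ij; apply: le_trans (ler_norm_enorm _).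
  apply: sep1; [exact: fa (ltn_ord i)|exact: fa (ltn_ord j)|].
  by move=> /(ia _ _ (mem_set (ltn_ord i)) (mem_set (ltn_ord j)))/val_inj/eqP; rewrite (negPf ij).
have [t /andP[t0 tt] Ht] := separating_parameter (fun i => f1 (b i)) mN0 tau0.
pose p x := t * g x.
have D2 : D `<=` eball 0 2.
  by move=> x Dx; rewrite /eball /= subr0; apply: le_lt_trans Dx _; rewrite ltr1n.
have oB2 : open (eball (0 : 'rV[R]_n) 2) by exact: open_eball.
have cp2 : classC q.+3 (eball 0 2) p by exact: classCZ.
have cpn : classC_near q.+3 D p by exists (eball 0 2).
have pE s x : (size s <= q.+3)%N -> D x -> iterpd s p x = t * iterpd s g x.
  by move=> sk Dx; apply: (iterpdZ t oB2 (classC_leq sk cg)); exact: D2.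
have pb s : (size s <= q.+3)%N -> forall x, D x -> `|iterpd s p x| <= c2.
  move=> sk x Dx; rewrite pE // normrM ger0_norm // (_ : c2 = tau * G); last first.
    by rewrite /tau mulfVK // gt_eqF.
  by apply: ler_pM => //; apply: le_trans (gb s sk x (D2 _ Dx)) (GG _ mN0).
have fM : uniformly_morse q.+3 (K + c1 + c2) mi (mi / 2) (mi ^+ 2 / 2) (fun x => f1 x + p x).
  apply: uniformly_morse_perturb => //.
  by rewrite mulrC -ler_pdivlMr.
have hE : (fun x => f0 x + (dot v x + p x)) = (fun x => f1 x + p x).
  by apply/funext => x; rewrite addrA.
have cdot : classC_near q.+3 D (dot v).
  by exists setT; split; [exact: openT|by []|apply: classC_dot; exact: openT].
exists (fun x => dot v x + p x); split; first exact: (classC_nearD cdot cpn).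
split.
  rewrite -c1E; apply: (Cnorm_scalar_le oB2 D2).
  - by apply: (classCD oB2 _ cp2); exact: classC_dot.
  - by rewrite ltW // addr_gt0.
  move=> s /andP[s0 sk] x Dx.
  rewrite (iterpd_nearD (classC_near_leq sk cdot) (classC_near_leq sk cpn) Dx).
  apply: le_trans (ler_normD _ _) _; apply: lerD; first exact: iterpd_dot.
  exact: le_trans (pb s sk x Dx) c2a.
cbv zeta; rewrite hE.
have sub x : critical (fun x => f1 x + p x) x -> critical f1 x.
  apply: Hcp => //; first exact: classC_near_leq cpn.
    by move=> s s2 y Dy; apply: le_trans c2b; apply: pb => //; exact: leq_trans s2 _.
  move=> z cz i; have [j jm jz] := sa z cz.
  have /= -> := pE [:: i] z isT cz.1.
  by rewrite -jz (gda (Ordinal jm)) mulr0.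
split.
  by move=> x cx lambda; exact: (hessian_eigenvalue m20 fM cx).
split.
  have sep2 x y : critical (fun x => f1 x + p x) x -> critical (fun x => f1 x + p x) y -> x <> y ->
      mi / 2 / L2 <= `|x - y| by exact: (critical_separated K20 m20 fM).
  split; first by move=> x y cx cy xy; apply: le_trans (sep2 x y cx cy xy) (ler_norm_enorm _).
  have [m2 m2N cr] := HN1 _ (fun x (cx : critical (fun x => f1 x + p x) x) => cx.1) sep2.
  by exists m2; split=> //; rewrite -[leLHS]addr0 lerD // ler_nat.
split.
  (* Critical points of the final function are among those of [f1], where [p] takes the value [t]
     times their number in the enumeration [a]. *)
  move=> x y /sub cx /sub cy xy.
  have [i im ix] := sa x cx; have [j jm jy] := sa y cy.
  have ij : Ordinal im != Ordinal jm.
    by apply/eqP => -[ij]; apply: xy; rewrite -ix -jy ij.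
  have := Ht _ _ ij; rewrite -(ga (Ordinal im)) -(ga (Ordinal jm)) /b /= ix jy.
  exact.
split; first exact: (HM _ fM).
move=> x Dx gx; apply: (Heta _ fM x Dx) => j.
apply: le_trans gx; have := ler_coord_enorm (grad (fun x => f1 x + p x) x) j.
by rewrite mxE.
Qed.

End Main.

Theorem theorem3p1 (R : realType) (n k : nat) (hn : (1 <= n)%N)
    (hk : (3 <= k)%N) :
  exists psi1 psi2 psi3 d M N eta : R -> R -> R,
    (forall K eps : R, 0 < K -> 0 < eps ->
       0 < psi1 K eps /\ 0 < psi2 K eps /\ 0 < psi3 K eps /\ 0 < d K eps /\
       0 < M K eps /\ 0 < N K eps /\ 0 < eta K eps) /\
    (forall (K : R) (f0 : 'rV[R]_n -> R),
       0 < K ->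
       classC_near k (closed_unit_eball R n) f0 ->
       (forall (j : nat) (x : 'rV[R]_n),
          (1 <= j <= k)%N -> closed_unit_eball R n x ->
          (Dnorm (fun t : R => `|t|%R) j f0 x <= K%:E)%E) ->
       forall eps : R, 0 < eps ->
       exists h : 'rV[R]_n -> R,
         classC_near k (closed_unit_eball R n) h /\
         (Cnorm (fun t : R => `|t|%R) k (closed_unit_eball R n) h <= eps%:E)%E /\
         let f := fun x => f0 x + h x in
         let delta := psi3 K eps in
         (* (i) *)
         (forall x, critical f x ->
            forall lambda : R, eigenvalue (hessian f x) lambda ->
              psi1 K eps <= `|lambda|) /\
         (* (ii) *)
         ((forall x y, critical f x -> critical f y -> x <> y ->
             d K eps <= enorm (x - y)) /\
          (exists m : nat, critical f #= `I_m /\ m%:R <= N K eps)) /\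
         (* (iii) *)
         (forall x y, critical f x -> critical f y -> x <> y ->
            psi2 K eps <= `|f x - f y|) /\
         (* (iv) *)
         (forall x, critical f x ->
            eball x delta `<=` closed_unit_eball R n /\
            exists phi psi : 'rV[R]_n -> 'rV[R]_n,
              coord_transf k.-1 (eball x delta) phi psi /\
              (exists (l : nat) (c : R), (l <= n)%N /\
                 forall y, (phi @` eball x delta) y ->
                   f (psi y) = \sum_(i < n | (i < l)%N) y 0 i ^+ 2
                             - \sum_(i < n | (l <= i)%N) y 0 i ^+ 2 + c) /\
              (Cnorm (@enorm R n) k.-1 (eball x delta) phi <= (M K eps)%:E)%E) /\
         (* (v) *)
         (forall x, closed_unit_eball R n x -> enorm (grad f x) <= eta K eps ->
            exists2 xi, critical f xi & eball xi delta x)).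
Proof.
case: n hn => // n' _; case: k hk => [|[|[|q]]] // _.
(* The constants are chosen for all pairs of parameters at once, hence as functions of them; outside
   the positive quadrant they are set to 0. *)
have H (Ke : R * R) : exists F : R * R * R * R * R * R * R,
  let: (psi1, psi2, psi3, d, M, N, eta) := F in 0 < Ke.1 -> 0 < Ke.2 ->
    (0 < psi1 /\ 0 < psi2 /\ 0 < psi3 /\ 0 < d /\ 0 < M /\ 0 < N /\ 0 < eta) /\
    @morse_bounds R n' q Ke.1 Ke.2 psi1 psi2 psi3 d M N eta.
  have [[K0 e0]|no] := pselect (0 < Ke.1 /\ 0 < Ke.2).
    have [psi1 [psi2 [psi3 [d [M [N [eta HH]]]]]]] := @morse_perturbation R n' q _ _ K0 e0.
    by exists (psi1, psi2, psi3, d, M, N, eta) => _ _; exact: HH.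
  by exists (0, 0, 0, 0, 0, 0, 0) => K0 e0; case: no.
have [F HF] := choice H.
exists (fun K e => (F (K, e)).1.1.1.1.1.1), (fun K e => (F (K, e)).1.1.1.1.1.2),
  (fun K e => (F (K, e)).1.1.1.1.2), (fun K e => (F (K, e)).1.1.1.2),
  (fun K e => (F (K, e)).1.1.2), (fun K e => (F (K, e)).1.2), (fun K e => (F (K, e)).2).
split=> [K eps K0 e0|K f0 K0 cf0 HD eps e0].
  by have := HF (K, eps); case: (F _) => [[[[[[psi1 psi2] psi3] d] M] N] eta] /(_ K0 e0)[].
have := HF (K, eps); case: (F _) => [[[[[[psi1 psi2] psi3] d] M] N] eta] /(_ K0 e0)[_ ].
apply=> // s sk x Dx.
by apply: Dnorm_iterpd; exact: HD.
Qed.
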